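(* Let $T_0:[0,1]\to[0,1]$ be a map such that: (A1) $T_0$ is a nonsingular piecewise $C^2$ map and there is $C\ge0$ with $\|L_{T_0}f\|_{BV}\le C\|f\|_{BV}$ for all $f\in BV[0,1]$; (A2) for each open interval $I\subseteq[0,1]$ there is $n$ such that $T_0^n(I)=[0,1]$. Let $a>0$, $\rho_0=a^{-1}1_{[-a/2,a/2]}$, $L_0f=\rho_0\,\hat\ast\,L_{T_0}f$, and let $f_0$ be the fixed probability measure of $L_0$. (1) (perturbing the map) Let $T_\delta=D_\delta\circ T_0$, where $D_\delta=\mathrm{Id}+\delta S:[0,1]\to[0,1]$, $\delta\in[0,\overline\delta)$, is a family of continuous bijections and $S$ is a $1$-Lipschitz map with $S(0)=S(1)=0$ whose support $\chi_S$ is a finite union of intervals. Let $f_\delta$ be fixed probability measures of $f\mapsto\rho_0\,\hat\ast\,L_{T_\delta}f$. Then $$\lim_{\delta\to0}\left\|\frac{f_\delta-f_0}{\delta}-R(1,L_0)\big[\rho_0\,\hat\ast\,(-L_{T_0}(f_0)S)'\big]\right\|_1=0 .$$ (2) (perturbing the noise radius) Suppose in addition that $T_0$ is Lipschitz. For $\xi\ge0$ let $\rho_\xi=(a+\xi)^{-1}1_{[-(a+\xi)/2,(a+\xi)/2]}$ and let $f_\xi$ be fixed probability measures of $f\mapsto\rho_\xi\,\hat\ast\,L_{T_0}f$. Then $$\lim_{\xi\to0}\left\|\frac{f_\xi-f_0}{\xi}-R(1,L_0)\big[\dot\rho\,\hat\ast\,L_{T_0}(f_0)\big]\right\|_W=0,$$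 where $$\dot\rho=-a^{-2}1_{[-a/2,a/2]}+\frac{a^{-1}}2\delta_{-a/2}+\frac{a^{-1}}2\delta_{a/2}$$ and $\delta_x$ is the Dirac mass at $x$.
   Context: Piecewise $C^2$ means that $[0,1]$ can be decomposed into a finite union of intervals $I_i$ such that $T_0|_{I_i}$ extends to a $C^2$ function $\overline{I_i}\to[0,1]$. Absolutely continuous measures are identified with densities in $L^1[0,1]$; $BV[0,1]$ has norm $\|f\|_{BV}=\|f\|_1+\mathrm{Var}_{[0,1]}(f)$. $L_T$ is the pushforward $L_T\mu(A)=\mu(T^{-1}A)$; $T$ nonsingular means that $L_T$ preserves absolutely continuous measures. Let $\pi:\mathbb R\to[0,1]$, $\pi(x)=\min_{i\in\mathbb Z}|x-2i|$. For a finite signed measure $\rho$ on $\mathbb R$ and a finite signed measure $\mu$ on $[0,1]$, $\rho\,\hat\ast\,\mu=\pi_*(\rho\ast\hat\mu)$, where $\hat\mu$ is the extension of $\mu$ by zero to $\mathbb R$, $\ast$ is the usual convolution on $\mathbb R$, and $\pi_*$ is the pushforward by $\pi$. $(L_{T_0}(f_0)S)'$ is the distributional derivative (a finite signed measure) of the $BV$ function $L_{T_0}(f_0)S$. $\|\mu\|_W=\sup\{\int_0^1 g\,d\mu:\|g\|_\infty\le1,\ \mathrm{Lip}(g)\le1\}$. $R(1,L)=\sum_{n\ge0}L^n=(\mathrm{Id}-L)^{-1}$, acting on zero-average measures. *)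

(* Defs.v *)
(* MathComp-Analysis, over an arbitrary R : realType. *)
From HB Require Import structures.
From mathcomp Require Import all_boot all_order all_algebra.
From mathcomp Require Import all_classical all_reals all_analysis.
From mathcomp Require Import measurable_realfun.

Set Implicit Arguments.
Unset Strict Implicit.
Unset Printing Implicit Defensive.

Import Order.TTheory GRing.Theory Num.Theory.
Import numFieldNormedType.Exports.

Local Open Scope classical_set_scope.
Local Open Scope ring_scope.

Notation signed_measure R := (charge (measurableTypeR R) R).

Notation unit_itv R := (`[0%R, 1%R]%classic : set (measurableTypeR R)).

Section algebra.
Context {R : realType}.
Implicit Types mu nu : signed_measure R.

Definition smadd mu nu : signed_measure R := cadd mu nu.
Definition smscale (c : R) mu : signed_measure R := cscale c mu.
Definition smsub mu nu : signed_measure R := smadd mu (smscale (-1) nu).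
Definition sm0 : signed_measure R := czero.
Definition smdirac (x : R) : signed_measure R :=
  charge_of_finite_measure (dirac (x : measurableTypeR R)).

(* charges may differ on non-measurable sets *)
Definition sm_eq mu nu := forall A : set (measurableTypeR R), measurable A -> mu A = nu A.

(* A signed measure on [0,1] is represented by its extension by zero to R. *)
Definition on01 mu := sm_eq mu (crestr0 mu (measurable_itv `[0%R, 1%R])).

End algebra.

Section jordan.
Context {R : realType}.
Variable mu : signed_measure R.

Let hahnP := cid (Hahn_decomposition mu).
Let hahnN := cid (svalP hahnP).

Definition pos_part : {finite_measure set (measurableTypeR R) -> \bar R} :=
  jordan_pos (svalP hahnN).
Definition neg_part : {finite_measure set (measurableTypeR R) -> \bar R} :=
  jordan_neg (svalP hahnN).

End jordan.

Definition sm_integral {R : realType} (mu : signed_measure R) (D : set R)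
    (g : R -> R) : \bar R :=
  (\int[pos_part mu]_(x in D) (g x)%:E - \int[neg_part mu]_(x in D) (g x)%:E)%E.

Section transfer.
Context {R : realType}.
Variables (T : R -> R) (mu : signed_measure R).

(* L_T mu (A) = mu (T^-1 A) for T : [0,1] -> [0,1] and mu on [0,1]; the values
   of T outside [0,1] are not used. The zero measure is a default value for a T
   which is not Borel on [0,1]. *)
Definition transfer_fun (A : set (measurableTypeR R)) : \bar R :=
  if `[< measurable_fun (unit_itv R) (T : measurableTypeR R -> measurableTypeR R) >]
  then mu (unit_itv R `&` T @^-1` A) else 0%E.

Let transfer0 : transfer_fun set0 = 0%E.
Proof. by rewrite /transfer_fun preimage_set0 setI0 charge0 if_same. Qed.

Let transfer_fin A : measurable A -> transfer_fun A \is a fin_num.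
Proof.
move=> mA; rewrite /transfer_fun; case: asboolP => // mT.
by apply: fin_num_measure; apply: mT => //; exact: measurable_itv.
Qed.

Let transfer_sigma_additive : semi_sigma_additive transfer_fun.
Proof.
move=> F mF tF mUF; rewrite /transfer_fun; case: asboolP => mT; last first.
  rewrite (_ : (fun _ => _) = fun=> 0%E); first exact: cvg_cst.
  by apply/funext => n; rewrite big1.
rewrite preimage_bigcup setI_bigcupr.
apply: charge_semi_sigma_additive.
- by move=> n; apply: mT => //; exact: measurable_itv.
- by move=> i j _ _ [x [[_ Fix] [_ Fjx]]]; apply: tF => //; exists (T x).
- rewrite -setI_bigcupr -preimage_bigcup.
  by apply: mT => //; exact: measurable_itv.
Qed.

HB.instance Definition _ := isCharge.Build _ _ _ transfer_fun
  transfer0 transfer_fin transfer_sigma_additive.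

Definition transfer : signed_measure R := transfer_fun.

End transfer.

Section convolution.
Context {R : realType}.

Definition sum_pair (p : measurableTypeR R * measurableTypeR R) :
  measurableTypeR R := (p.1 : R) + (p.2 : R).

Lemma measurable_sum_pair : measurable_fun setT sum_pair.
Proof. by apply: measurable_funD; [exact: measurable_fst|exact: measurable_snd]. Qed.

Section finite_measures.
Variables mu nu : {finite_measure set (measurableTypeR R) -> \bar R}.

Definition fmconv_fun : set (measurableTypeR R) -> \bar R :=
  pushforward (mu \x nu)%E sum_pair.

Let mpreimage A : measurable A -> measurable (sum_pair @^-1` A).
Proof. by move=> mA; rewrite -[X in measurable X]setTI; exact: measurable_sum_pair. Qed.

Let fmconv0 : fmconv_fun set0 = 0%E.
Proof. by rewrite /fmconv_fun /pushforward preimage_set0 measure0. Qed.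

Let fmconv_fin A : measurable A -> fmconv_fun A \is a fin_num.
Proof.
move=> mA; rewrite /fmconv_fun /pushforward ge0_fin_numE//.
apply: (@le_lt_trans _ _ ((mu \x nu)%E setT)).
  by apply: le_measure; rewrite ?inE//; exact: mpreimage.
rewrite -setXTT product_measure1E//.
apply: lte_mul_pinfty => //; first by apply: fin_num_measure.
by rewrite ltey_eq fin_num_measure.
Qed.

Let fmconv_sigma_additive : semi_sigma_additive fmconv_fun.
Proof.
move=> F mF tF mUF; rewrite /fmconv_fun /pushforward preimage_bigcup.
apply: measure_semi_sigma_additive.
- by move=> n; exact: mpreimage.
- by move=> i j _ _ [x [Fix Fjx]]; apply: tF => //; exists (sum_pair x).
- by rewrite -preimage_bigcup; exact: mpreimage.
Qed.

HB.instance Definition _ := isCharge.Build _ _ _ fmconv_fun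
  fmconv0 fmconv_fin fmconv_sigma_additive.

Definition fmconv : signed_measure R := fmconv_fun.

End finite_measures.

(* rho * mu, the image under addition of the product signed measure
   (rho^+ - rho^-) x (mu^+ - mu^-) *)
Definition smconv (rho mu : signed_measure R) : signed_measure R :=
  smsub (smadd (fmconv (pos_part rho) (pos_part mu))
               (fmconv (neg_part rho) (neg_part mu)))
        (smadd (fmconv (pos_part rho) (neg_part mu))
               (fmconv (neg_part rho) (pos_part mu))).

End convolution.

Section reflection.
Context {R : realType}.

(* pi(x) = min_i |x - 2i| *)
Definition fold01 (x : R) : R := inf (range (fun i : int => `|x - 2 * i%:~R|)).

Lemma fold01_lipschitz (x y : R) : `|fold01 x - fold01 y| <= `|x - y|.
Proof.
have half u v : fold01 u - fold01 v <= `|u - v|.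
  rewrite lerBlDr -lerBlDl; apply: lb_le_inf.
    by exists `|v - 2 * (0 : int)%:~R|; exists 0.
  move=> _ [i _ <-]; rewrite lerBlDl.
  apply: (@le_trans _ _ `|u - 2 * i%:~R|).
    apply: ge_inf; last by exists i.
    by exists 0 => _ [j _ <-].
  have -> : u - 2 * i%:~R = (u - v) + (v - 2 * i%:~R) by rewrite addrA subrK.
  exact: ler_normD.
by rewrite ler_norml half andbT lerNl opprB distrC half.
Qed.

Lemma measurable_fold01 :
  measurable_fun setT (fold01 : measurableTypeR R -> measurableTypeR R).
Proof.
apply: continuous_measurable_fun => x.
apply/cvgrPdist_le => e e0.
have /cvgrPdist_le /(_ e e0) := @cvg_id _ (nbhs (x : R)).
by apply: filterS => y; exact: (le_trans (fold01_lipschitz _ _)).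
Qed.

Variable mu : signed_measure R.

Definition fold01_push_fun : set (measurableTypeR R) -> \bar R :=
  pushforward mu (fold01 : measurableTypeR R -> measurableTypeR R).

Let mpreimage A : measurable A ->
  measurable ((fold01 : measurableTypeR R -> measurableTypeR R) @^-1` A).
Proof. by move=> mA; rewrite -[X in measurable X]setTI; exact: measurable_fold01. Qed.

Let push0 : fold01_push_fun set0 = 0%E.
Proof. by rewrite /fold01_push_fun /pushforward preimage_set0 charge0. Qed.

Let push_fin A : measurable A -> fold01_push_fun A \is a fin_num.
Proof. by move=> /mpreimage mA; rewrite /fold01_push_fun /pushforward fin_num_measure. Qed.

Let push_sigma_additive : semi_sigma_additive fold01_push_fun.
Proof.
move=> F mF tF mUF; rewrite /fold01_push_fun /pushforward preimage_bigcup.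
apply: charge_semi_sigma_additive.
- by move=> n; exact: mpreimage.
- by move=> i j _ _ [x [Fix Fjx]]; apply: tF => //; exists (fold01 x).
- by rewrite -preimage_bigcup; exact: mpreimage.
Qed.

HB.instance Definition _ := isCharge.Build _ _ _ fold01_push_fun
  push0 push_fin push_sigma_additive.

Definition fold01_push : signed_measure R := fold01_push_fun.

End reflection.

(* The extension of mu by zero is mu itself, by the representation of on01. *)
Definition rconv {R : realType} (rho mu : signed_measure R) : signed_measure R :=
  fold01_push (smconv rho mu).

Section noise.
Context {R : realType}.

Lemma integrable_box (c b : R) :
  (@lebesgue_measure R).-integrable [set: measurableTypeR R]
    (fun x => (c * \1_(`[- (b / 2), b / 2] : set R) x)%:E).
Proof.
under eq_fun do rewrite EFinM.
by apply: integrableZl => //; exact: integrable_indic_itv.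
Qed.

(* the measure of density c 1_[-b/2, b/2] *)
Definition box (c b : R) : signed_measure R := induced_charge (integrable_box c b).

(* rho_xi is uniform_noise (a + xi) *)
Definition uniform_noise (b : R) : signed_measure R := box b^-1 b.

(* derivative in b of uniform_noise b at b = a *)
Definition noise_dot (a : R) : signed_measure R :=
  smadd (box (- a ^- 2) a)
    (smadd (smscale (a^-1 / 2) (smdirac (- (a / 2))))
           (smscale (a^-1 / 2) (smdirac (a / 2)))).

Definition noisy_transfer (b : R) (T : R -> R) (mu : signed_measure R) :
  signed_measure R := rconv (uniform_noise b) (transfer T mu).

Definition fixed_probability (L : signed_measure R -> signed_measure R)
  (f : signed_measure R) :=
  [/\ on01 f, (forall A : set (measurableTypeR R), measurable A -> (0 <= f A)%E),
      f setT = 1%E & sm_eq (L f) f].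

End noise.

Section norms.
Context {R : realType}.
Notation leb := (@lebesgue_measure R).
Implicit Types (mu nu v r : signed_measure R) (g h phi : R -> R).

Definition has_density mu g :=
  leb.-integrable (unit_itv R) (fun x => (g x)%:E) /\
  forall A : set (measurableTypeR R), measurable A ->
    mu A = (\int[leb]_(x in A `&` unit_itv R) (g x)%:E)%E.

(* Absolutely continuous measures on [0,1] are identified with their densities.
   The infimum ranges over the a.e. equal densities of mu, which have the same
   integral; it is +oo when mu has no density. *)
Definition norm1 mu : \bar R :=
  ereal_inf [set (\int[leb]_(x in unit_itv R) `|g x|%:E)%E | g in has_density mu].

(* The variation of an a.e. class is the infimum over its representatives. *)
Definition norm_BV mu : \bar R :=
  ereal_inf [set (\int[leb]_(x in unit_itv R) `|g x|%:E + total_variation 0 1 g)%E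
            | g in has_density mu].

Definition norm_W mu : \bar R :=
  ereal_sup [set sm_integral mu (unit_itv R) g |
    g in [set g | (forall x, unit_itv R x -> `|g x| <= 1) /\
                  1.-lipschitz_(unit_itv R) g]].

End norms.

Section resolvent.
Context {R : realType}.
Variable L : signed_measure R -> signed_measure R.

Definition zero_average (mu : signed_measure R) := on01 mu /\ mu setT = 0%E.

Definition neumann (v : signed_measure R) (N : nat) : signed_measure R :=
  \big[@smadd R/sm0]_(n < N) iter n L v.

(* r = R(1, L) v on the space of zero-average measures: r is the sum of the
   series of the L^n v for the norm nrm, and the only solution of (Id - L) r = v *)
Definition is_resolvent (nrm : signed_measure R -> \bar R) (v r : signed_measure R) :=
  [/\ zero_average v, zero_average r,
      nrm (smsub (neumann v N) r) @[N --> \oo] --> 0%E,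
      sm_eq (smsub r (L r)) v
    & forall r', zero_average r' -> sm_eq (smsub r' (L r')) v -> sm_eq r' r].

End resolvent.

Section maps.
Context {R : realType}.
Implicit Types (T S h phi : R -> R).
Notation leb := (@lebesgue_measure R).

Definition C2 h :=
  [/\ forall x, derivable h x 1, forall x, derivable (derive1 h) x 1
    & continuous (derive1n 2 h)].

(* A C^2 function on a closed interval is the restriction of a C^2 function
   on the line. *)
Definition piecewise_C2 T := exists n (I : 'I_n -> set R) (h : 'I_n -> R -> R),
  [/\ forall i, is_interval (I i), trivIset setT I, \bigcup_i I i = unit_itv R
    & forall i, [/\ C2 (h i), set_fun (closure (I i)) (unit_itv R) (h i)
                  & {in I i, T =1 h i}]].

Definition nonsingular T := forall mu : signed_measure R,
  on01 mu -> mu `<< leb -> transfer T mu `<< leb.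

Definition transfer_BV_bounded T := exists2 C : R, 0 <= C &
  forall mu : signed_measure R, (norm_BV mu < +oo)%E ->
    (norm_BV (transfer T mu) <= C%:E * norm_BV mu)%E.

Definition covering T := forall c d : R, 0 <= c -> c < d -> d <= 1 ->
  exists n, iter n T @` `]c, d[ = unit_itv R.

Definition perturbation (delta : R) S (x : R) : R := x + delta * S x.

Definition support01 S : set R :=
  closure [set x | unit_itv R x /\ S x != 0].

Definition finite_union_of_intervals (A : set R) :=
  exists n (J : 'I_n -> set R),
    (forall i, is_interval (J i)) /\ A = \bigcup_i J i.

Definition test_function phi :=
  (forall n x, derivable (derive1n n phi) x 1) /\
  exists c d : R, [/\ 0 < c, d < 1 & forall x, ~ (c <= x <= d) -> phi x = 0].

(* nu is the distributional derivative of h on ]0,1[, extended by zero *)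
Definition is_distr_derivative h (nu : signed_measure R) :=
  [/\ leb.-integrable (`]0%R, 1%R[ : set (measurableTypeR R)) (fun x => (h x)%:E),
      sm_eq nu (crestr0 nu (measurable_itv `]0%R, 1%R[))
    & forall phi, test_function phi ->
        sm_integral nu `]0, 1[ phi =
        (- \int[leb]_(x in `]0%R, 1%R[) (h x * derive1 phi x)%:E)%E].

End maps.

(* Main.v *)
(* Signed measures on [0,1] are compared in total variation, which dominates
   both norms. The covering property spreads the mass of any probability over
   [0,1], up to finitely many points, so together with the noise some iterate
   of L_0 has a Doeblin minorization by Lebesgue measure; hence L_0^N contracts
   zero-average measures, the Neumann series converges, and
   tv w <= C tv (w - L_0 w) for zero-average w. With L_h the perturbed operator,
   the error y = (f_h - f_0) / h - r solves
   y - L_0 y = (L_h - L_0) (f_h - f_0) / h + ((L_h - L_0) f_0 / h - v),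
   and the same bound first gives tv (f_h - f_0) = O(h), then tv y = O(h), once
   both terms are O(h). For the second one, f_0 = L_0 f_0 has a BV density, and
   so does L_{T_0} f_0: this density is the difference of the distribution
   functions of two finite measures k1 and k2, so its oscillation near t is at
   most the mass of a window around t for k1 + k2, and the integral over t of
   such a mass is the window length times a constant. *)
Require Import Defs.
From HB Require Import structures.
From mathcomp Require Import all_boot all_order all_algebra.
From mathcomp Require Import all_classical all_reals all_analysis.
From mathcomp Require Import measurable_realfun ring lra.

Set Implicit Arguments.
Unset Strict Implicit.
Unset Printing Implicit Defensive.

Import Order.TTheory GRing.Theory Num.Theory.
Import numFieldNormedType.Exports.

Local Open Scope classical_set_scope.
Local Open Scope ring_scope.

Local Notation MR R := (measurableTypeR R).
Local Notation leb := (@lebesgue_measure _).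

(** * Total variation of signed measures *)
Section values.
Context {R : realType}.
Implicit Types (mu nu : signed_measure R) (A B : set (MR R)).

(** Composing with D_delta is not a small perturbation in total variation: moving a point mass by
    any positive distance costs 2. Its effect on the distribution function F of the transferred
    measure is small in L1, since F(t) changes by at most the mass of a window of half-width delta
    around t. The noise converts one kind of smallness into the other: before folding, the
    convolution has density b^-1 (F(t + b/2) - F(t - b/2)), so an L1 bound on a difference of
    distribution functions becomes a total variation bound. Folding is a push-forward and cannot
    increase total variation. The estimates at f_0 require an L1 modulus of continuity, linear in h,
    for the density of L_{T_0} f_0. Bounded variation provides it although the density may jump, so
    that no pointwise bound of this order could hold. The density is therefore put in the form w1 -
    w2 with w1 and w2 nondecreasing, right-continuous, zero before 0 and equal to the same constant
    from 1 on: these are distribution functions of finite measures, and the difference vanishes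
    outside [0,1]. *)

Definition charge_of (m : {finite_measure set (MR R) -> \bar R}) : signed_measure R :=
  charge_of_finite_measure m.

(** Charges are finite on measurable sets, so nothing is lost there by passing to real values, where
    [lra] and [ring] apply. *)
Definition mval mu A : R := fine (mu A).

Lemma mvalE mu A : measurable A -> mu A = (mval mu A)%:E.
Proof. by move=> mA; rewrite /mval fineK// fin_num_measure. Qed.

Lemma mval0 mu : mval mu set0 = 0.
Proof. by rewrite /mval charge0. Qed.

Lemma mvalU mu A B : measurable A -> measurable B -> A `&` B = set0 ->
  mval mu (A `|` B) = mval mu A + mval mu B.
Proof.
move=> mA mB AB; rewrite /mval chargeU// fineD//; exact: fin_num_measure.
Qed.

Lemma mval_add mu nu A : measurable A -> mval (smadd mu nu) A = mval mu A + mval nu A.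
Proof. by move=> mA; rewrite /mval /= /cadd fineD//; exact: fin_num_measure. Qed.

Lemma mval_scale c mu A : measurable A -> mval (smscale c mu) A = c * mval mu A.
Proof. by move=> mA; rewrite /mval /= /cscale fineM//; exact: fin_num_measure. Qed.

Lemma mval_sub mu nu A : measurable A -> mval (smsub mu nu) A = mval mu A - mval nu A.
Proof. by move=> mA; rewrite mval_add// mval_scale// mulN1r. Qed.

Lemma mval_sm0 A : mval sm0 A = 0.
Proof. by []. Qed.

Lemma sm_eqP mu nu :
  sm_eq mu nu <-> forall A, measurable A -> mval mu A = mval nu A.
Proof.
split=> h A mA; first by rewrite /mval h.
by rewrite mvalE// [RHS]mvalE// h.
Qed.

Lemma mvalC mu A : measurable A -> mval mu (~` A) = mval mu setT - mval mu A.
Proof.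
move=> mA; have := @mvalU mu A (~` A) mA (measurableC mA) (setICr A).
by rewrite setUCr => ->; rewrite addrC addKr.
Qed.

Lemma mvalD mu A B : measurable A -> measurable B -> A `<=` B ->
  mval mu (B `\` A) = mval mu B - mval mu A.
Proof.
move=> mA mB AB; have := @mvalU mu A (B `\` A) mA (measurableD mB mA).
rewrite setDE setICA setICr setI0 => /(_ erefl).
by rewrite -setDE setUIr setUCr setIT (setUidr AB) => ->; rewrite addrC addKr.
Qed.

Lemma mval_ge0 (m : {finite_measure set (MR R) -> \bar R}) A : 0 <= mval (charge_of m) A.
Proof. by rewrite /mval fine_ge0. Qed.

Lemma mval_le (m : {finite_measure set (MR R) -> \bar R}) A B :
  measurable A -> measurable B -> A `<=` B -> mval (charge_of m) A <= mval (charge_of m) B.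
Proof. by move=> mA mB AB; rewrite -subr_ge0 -mvalD//; exact: mval_ge0. Qed.

Lemma mval_jordan mu A : measurable A ->
  mval mu A = mval (charge_of (pos_part mu)) A - mval (charge_of (neg_part mu)) A.
Proof.
move=> mA; have := jordan_decomp (svalP (cid (svalP (cid (Hahn_decomposition mu))))) mA.
rewrite /mval => ->.
exact: (@mval_sub (charge_of (pos_part mu)) (charge_of (neg_part mu))).
Qed.

(** The Jordan parts come from a chosen Hahn pair; this exposes its positive set P. The negative set
    is exactly the complement of P because the pair is a partition. *)
Lemma jordan_set mu : exists P, [/\ measurable P,
  (forall A, measurable A -> mval (charge_of (pos_part mu)) A = mval mu (A `&` P)) &
  (forall A, measurable A -> mval (charge_of (neg_part mu)) A = - mval mu (A `&` ~` P))].
Proof.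
pose hP := cid (Hahn_decomposition mu); pose hN := cid (svalP hP).
have [[mP posP] [mN negN] PN PN0] := svalP hN.
have NC : sval hN = ~` sval hP.
  apply/seteqP; split => x Nx.
    by move=> Px; have : (sval hP `&` sval hN) x by []; rewrite PN0.
  by have : setT x by []; rewrite -PN => -[|//].
exists (sval hP); split => // A mA.
  rewrite /mval; congr fine.
  by have := jordan_posE (svalP hN) A; rewrite cjordan_posE /crestr0 mem_set.
rewrite /mval -NC -fineN; congr fine.
by have := jordan_negE (svalP hN) A; rewrite cjordan_negE /crestr0 mem_set.
Qed.

Definition tv mu : R := mval (charge_of (pos_part mu)) setT + mval (charge_of (neg_part mu)) setT.

Lemma tv_ge0 mu : 0 <= tv mu.
Proof. by rewrite addr_ge0// mval_ge0. Qed.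

Lemma tv_ge mu A B : measurable A -> measurable B -> mval mu A - mval mu B <= tv mu.
Proof.
move=> mA mB; rewrite (mval_jordan mu mA) (mval_jordan mu mB) /tv.
have a := @mval_le (pos_part mu) _ _ mA measurableT (@subsetT _ A).
have b := @mval_le (neg_part mu) _ _ mB measurableT (@subsetT _ B).
have c := @mval_ge0 (pos_part mu) B.
have d := @mval_ge0 (neg_part mu) A.
lra.
Qed.

Lemma tv_le mu c : (forall A, measurable A -> mval mu A - mval mu (~` A) <= c) ->
  tv mu <= c.
Proof.
have [P [mP pP nP]] := jordan_set mu.
by move=> /(_ P mP); rewrite /tv pP// nP// !setTI.
Qed.

Lemma mval_le_tv mu A : measurable A -> `|mval mu A| <= tv mu.
Proof.
move=> mA; rewrite ler_norml lerNl; apply/andP; split.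
  by have := tv_ge mu measurable0 mA; rewrite mval0 sub0r.
by have := tv_ge mu mA measurable0; rewrite mval0 subr0.
Qed.

Lemma tv_eq mu nu : (forall A, measurable A -> mval mu A = mval nu A) -> tv mu = tv nu.
Proof.
move=> h; apply/eqP; rewrite eq_le; apply/andP; split; apply: tv_le => A mA.
  by rewrite !h//; [exact: tv_ge (measurableC _)|exact: measurableC].
by rewrite -!h//; [exact: tv_ge (measurableC _)|exact: measurableC].
Qed.

Lemma tv_add mu nu : tv (smadd mu nu) <= tv mu + tv nu.
Proof.
apply: tv_le => A mA; have mA' := measurableC mA; rewrite !mval_add//.
by have := tv_ge mu mA mA'; have := tv_ge nu mA mA'; lra.
Qed.

Lemma tv_scale c mu : tv (smscale c mu) <= `|c| * tv mu.
Proof.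
apply: tv_le => A mA; have mA' := measurableC mA; rewrite !mval_scale// -mulrBr.
apply: le_trans (ler_norm _) _; rewrite normrM ler_wpM2l//.
rewrite ler_norml (tv_ge _ mA mA') andbT lerNl opprB; exact: tv_ge.
Qed.

Lemma tv_sub mu nu : tv (smsub mu nu) <= tv mu + tv nu.
Proof.
apply: le_trans (tv_add _ _) _; rewrite lerD2l.
by apply: le_trans (tv_scale _ _) _; rewrite normrN1 mul1r.
Qed.

Lemma tv0_eq mu nu : tv (smsub mu nu) <= 0 -> sm_eq mu nu.
Proof.
move=> h; apply/sm_eqP => A mA.
have := mval_le_tv (smsub mu nu) mA; rewrite mval_sub// => /le_trans /(_ h).
by rewrite normr_le0 subr_eq0 => /eqP.
Qed.

Lemma mval_crestr0 mu D (mD : measurable D) A : measurable A ->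
  mval (crestr0 mu mD : signed_measure R) A = mval mu (A `&` D).
Proof. move=> mA; rewrite /mval; congr fine; 
transitivity (if A \in measurable then crestr mu mD A else 0%E) => //.
by rewrite ifT// inE.
Qed.

Lemma on01P mu : on01 mu <-> (forall A, measurable A ->
  mval mu (A `&` unit_itv R) = mval mu A).
Proof.
split=> [h A mA|h].
  move/sm_eqP : h => /(_ A mA) ->; apply/esym.
  exact: (mval_crestr0 mu (measurable_itv `[0%R, 1%R])).
apply/sm_eqP => A mA; rewrite -h//; apply/esym.
exact: (mval_crestr0 mu (measurable_itv `[0%R, 1%R])).
Qed.

Lemma nonneg_neg0 mu : (forall A, measurable A -> (0 <= mu A)%E) ->
  forall A, measurable A -> mval (charge_of (neg_part mu)) A = 0 /\ mval (charge_of (pos_part mu)) A = mval mu A.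
Proof.
move=> mu0 A mA; have [P [mP pP nP]] := jordan_set mu.
have n0 : mval (charge_of (neg_part mu)) A = 0.
  apply/eqP; rewrite eq_le mval_ge0 andbT nP// oppr_le0 fine_ge0// mu0//.
  by apply: measurableI => //; exact: measurableC.
by split => //; rewrite (mval_jordan mu)// n0 subr0.
Qed.

End values.

(** * Translation and reflection invariance of Lebesgue integrals *)

Section lebesgue_invariance.
Context {R : realType}.
Implicit Types (A B : set (MR R)).

Lemma measurable_translate (s : R) :
  measurable_fun setT ((fun x => x + s) : MR R -> MR R).
Proof. by apply: measurable_funD => //; exact: measurable_id. Qed.

Lemma measurable_reflect (s : R) :
  measurable_fun setT ((fun x => s - x) : MR R -> MR R).
Proof. by apply: measurable_funB => //; exact: measurable_id. Qed.

Lemma measurable_preimage (f : MR R -> MR R) A : measurable_fun setT f -> measurable A ->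
  measurable (f @^-1` A).
Proof. by move=> mf mA; rewrite -[X in measurable X]setTI; exact: mf. Qed.

Lemma lebesgue_preimage_eq (f : MR R -> MR R) (mf : measurable_fun setT f) :
  (forall a b : R, a < b ->
    leb (f @^-1` (`]a, b]%classic : set (MR R))) = (b - a)%:E :> \bar R) ->
  forall A, measurable A -> leb (f @^-1` A) = leb A :> \bar R.
Proof.
move=> h A mA.
pose m := measure_function_pushforward__canonical__measure_function_Measure
  (@lebesgue_measure R) mf.
have := @lebesgue_measure_unique R m _ A mA => /= -> // X /ocitvP[->|].
  by rewrite measure0 /m/= /pushforward preimage_set0 measure0.
move=> [[a b] /= ab ->].
by rewrite lebesgue_measure_itv /= lte_fin ab -EFinB /m/= /pushforward h.
Qed.

Lemma lebesgue_translate (s : R) A : measurable A ->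
  leb ((fun x : R => x + s) @^-1` A) = leb A :> \bar R.
Proof.
apply: (@lebesgue_preimage_eq _ (measurable_translate s)) => a b ab.
rewrite (_ : _ @^-1` _ = `]a - s, b - s]%classic); last first.
  by apply/seteqP; split => x /=; rewrite !in_itv/= ltrBlDr lerBrDr.
rewrite lebesgue_measure_itv /= lte_fin ltrD2r ab -EFinB.
by congr EFin; lra.
Qed.

Lemma lebesgue_reflect (s : R) A : measurable A ->
  leb ((fun x : R => s - x) @^-1` A) = leb A :> \bar R.
Proof.
apply: (@lebesgue_preimage_eq _ (measurable_reflect s)) => a b ab.
rewrite (_ : _ @^-1` _ = `[s - b, s - a[%classic); last first.
  apply/seteqP; split => x /=; rewrite !in_itv/= => /andP[h1 h2];
  apply/andP; split; lra.
rewrite lebesgue_measure_itv /= lte_fin ltrD2l ltrN2 ab -EFinB.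
by congr EFin; lra.
Qed.

Lemma ge0_integral_comp (f : MR R -> MR R) (h : MR R -> \bar R) A :
  measurable_fun setT f ->
  (forall A, measurable A -> leb (f @^-1` A) = leb A :> \bar R) ->
  measurable A -> measurable_fun A h -> (forall x, A x -> (0 <= h x)%E) ->
  (\int[leb]_(x in f @^-1` A) h (f x) = \int[leb]_(x in A) h x)%E.
Proof.
move=> mf lf mA mh h0.
pose m := measure_function_pushforward__canonical__measure_function_Measure
  (@lebesgue_measure R) mf.
rewrite -(@ge0_integral_pushforward _ _ _ _ _ f mf leb A h mA mh); last first.
  by move=> y; rewrite inE; exact: h0.
by apply: (@eq_measure_integral _ _ _ A leb m) => B mB _; exact: lf.
Qed.

Lemma integrable_comp (f : MR R -> MR R) (h : MR R -> R) A :
  measurable_fun setT f ->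
  (forall A, measurable A -> leb (f @^-1` A) = leb A :> \bar R) ->
  measurable A -> leb.-integrable A (EFin \o h) ->
  leb.-integrable (f @^-1` A) (EFin \o (h \o f)).
Proof.
move=> mf lf mA /integrableP[mh hoo]; apply/integrableP; split.
  apply: (measurable_comp mA _ mh); first by move=> _ [x Ax <-].
  exact: measurable_funTS mf.
rewrite (@ge0_integral_comp f (fun x => `|(h x)%:E|%E))//.
exact: measurableT_comp.
Qed.

Lemma Rintegral_comp (f : MR R -> MR R) (h : MR R -> R) A :
  measurable_fun setT f ->
  (forall A, measurable A -> leb (f @^-1` A) = leb A :> \bar R) ->
  measurable A -> leb.-integrable A (EFin \o h) ->
  \int[leb]_(x in f @^-1` A) h (f x) = \int[leb]_(x in A) h x.
Proof.
move=> mf lf mA ih; rewrite /Rintegral; congr fine.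
have mh := measurable_int _ ih.
rewrite integralE [RHS]integralE; congr (_ - _)%E.
  rewrite -(@ge0_integral_comp f (EFin \o h)^\+%E A mf lf mA)//.
    by apply: eq_integral => x _; rewrite !funeposE.
  exact: measurable_funepos.
rewrite -(@ge0_integral_comp f (EFin \o h)^\-%E A mf lf mA)//.
  by apply: eq_integral => x _; rewrite !funenegE.
exact: measurable_funeneg.
Qed.

End lebesgue_invariance.

(** * Convolution with the uniform noise *)
Section windows.
Context {R : realType}.
Implicit Types (X : signed_measure R) (A B : set (MR R)).
Implicit Types m : {finite_measure set (MR R) -> \bar R}.

Lemma section_tonelli d1 d2 (T1 : measurableType d1) (T2 : measurableType d2)
    (m1 : {sigma_finite_measure set T1 -> \bar R})
    (m2 : {sigma_finite_measure set T2 -> \bar R}) (Q : set (T1 * T2)) :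
  measurable Q ->
  (\int[m1]_x m2 (xsection Q x) = \int[m2]_y m1 (ysection Q y))%E.
Proof.
move=> mQ; have := @indic_fubini_tonelli _ _ _ _ _ m1 m2 Q mQ.
by rewrite indic_fubini_tonelli_FE// indic_fubini_tonelli_GE.
Qed.

Definition bounded_measurable (f : MR R -> R) :=
  measurable_fun setT f /\ exists M, forall x, `|f x| <= M.

Lemma integrable_bounded_measurable m f : bounded_measurable f -> m.-integrable setT (EFin \o f).
Proof.
move=> [mf [M fM]]; apply: measurable_bounded_integrable => //.
  by rewrite ltey_eq fin_num_measure.
exists M; split; first exact: num_real.
by move=> x Mx y _; apply: le_trans (fM y) (ltW _).
Qed.

Definition signed_integral X (f : MR R -> R) : R :=
  \int[pos_part X]_x f x - \int[neg_part X]_x f x.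

Lemma signed_integralZ X f c : bounded_measurable f -> signed_integral X (fun z => c * f z) = c * signed_integral X f.
Proof.
move=> bf; rewrite /signed_integral !RintegralZl// ?mulrBr//; exact: integrable_bounded_measurable.
Qed.

Lemma signed_integralD X f g : bounded_measurable f -> bounded_measurable g ->
  signed_integral X (fun z => f z + g z) = signed_integral X f + signed_integral X g.
Proof.
move=> bf bg; rewrite /signed_integral !RintegralD//; try exact: integrable_bounded_measurable.
lra.
Qed.

Lemma bounded_measurableD f g : bounded_measurable f -> bounded_measurable g -> bounded_measurable (fun x => f x + g x).
Proof.
move=> [mf [M fM]] [mg [N gN]]; split; first exact: measurable_funD.
by exists (M + N) => x; apply: le_trans (ler_normD _ _) (lerD _ _).
Qed.

Lemma bounded_measurableZ c f : bounded_measurable f -> bounded_measurable (fun x => c * f x).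
Proof.
move=> [mf [M fM]]; split; first exact: measurable_funM.
by exists (`|c| * M) => x; rewrite normrM ler_wpM2l.
Qed.

Lemma bounded_measurable_section m (Q : MR R -> set (MR R)) (Q' : set (MR R * MR R)) :
  measurable Q' -> (forall z, Q z = ysection Q' z) ->
  bounded_measurable (fun z => mval (charge_of m) (Q z)).
Proof.
move=> mQ QQ; split.
  have -> : (fun z => mval (charge_of m) (Q z)) = fine \o (m \o ysection Q').
    by apply/funext => z /=; rewrite QQ.
  apply: measurableT_comp; last exact: measurable_fun_ysection.
  exact: fine_measurable.
exists (mval (charge_of m) setT) => z; rewrite ger0_norm ?mval_ge0// mval_le//.
by rewrite QQ; exact: measurable_ysection.
Qed.

Lemma measurable_sum_preimage A : measurable A ->
  measurable (sum_pair @^-1` A : set (MR R * MR R)).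
Proof.
by move=> mA; rewrite -[X in measurable X]setTI; exact: measurable_sum_pair.
Qed.

Lemma shiftE A z : (fun x : MR R => (x : R) + z) @^-1` A =
  ysection (sum_pair @^-1` A : set (MR R * MR R)) z.
Proof. by rewrite ysectionE. Qed.

Lemma fmconvE m1 m2 A : measurable A ->
  mval (fmconv m1 m2) A =
  \int[m2]_z mval (charge_of m1) ((fun x : MR R => (x : R) + z) @^-1` A).
Proof.
move=> mA; rewrite /mval /Rintegral; congr fine.
have mQ := measurable_sum_preimage mA.
rewrite [LHS](section_tonelli m1 m2 mQ); apply: eq_integral => z _.
rewrite -shiftE fineK// fin_num_measure// shiftE.
exact: measurable_ysection.
Qed.

Lemma bounded_measurable_shift rho A : measurable A ->
  bounded_measurable (fun z => mval rho ((fun x : MR R => (x : R) + z) @^-1` A)).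
Proof.
move=> mA; have mQ := measurable_sum_preimage mA.
rewrite (_ : (fun _ => _) = fun z =>
    mval (charge_of (pos_part rho)) ((fun x : MR R => (x : R) + z) @^-1` A) +
    (-1) * mval (charge_of (neg_part rho)) ((fun x : MR R => (x : R) + z) @^-1` A)).
  by apply: bounded_measurableD; [|apply: bounded_measurableZ]; apply: (bounded_measurable_section _ mQ); exact: shiftE.
apply/funext => z; rewrite mulN1r -mval_jordan// shiftE.
exact: measurable_ysection.
Qed.

(** The four products of Jordan parts recombine so that [rho] enters undecomposed; linearity in
    [rho] is then linearity of the integrand. *)
Lemma smconvE rho X A : measurable A ->
  mval (smconv rho X) A =
  signed_integral X (fun z => mval rho ((fun x : MR R => (x : R) + z) @^-1` A)).
Proof.
move=> mA; rewrite /smconv mval_sub// !mval_add// !fmconvE//.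
have mQ := measurable_sum_preimage mA.
have mz z : measurable ((fun x : MR R => (x : R) + z) @^-1` A).
  by rewrite shiftE; exact: measurable_ysection.
have E m : \int[m]_z mval rho ((fun x : MR R => (x : R) + z) @^-1` A) =
  \int[m]_z mval (charge_of (pos_part rho)) ((fun x : MR R => (x : R) + z) @^-1` A) -
  \int[m]_z mval (charge_of (neg_part rho)) ((fun x : MR R => (x : R) + z) @^-1` A).
  rewrite -RintegralB//; try by apply: integrable_bounded_measurable; apply: (bounded_measurable_section _ mQ); exact: shiftE.
  by apply: eq_Rintegral => z _; rewrite -mval_jordan.
rewrite /signed_integral !E; lra.
Qed.

(* Lebesgue-almost everywhere in t, the convolution of 1_[u, v] with a measure
   is the mass of window u v t. *)
Definition window (u v t : R) : set (MR R) := `]t - v, t - u]%classic.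

(** The point t lies in [dual_window u v z] iff z lies in [window u v t]. The half-open form of
    [window] makes its mass a difference of two values of the distribution function; the price is
    one endpoint of the closed support of the noise, a Lebesgue null set. *)
Definition dual_window (u v z : R) : set (MR R) := `[z + u, z + v[%classic.

Lemma measurable_window u v t : measurable (window u v t).
Proof. exact: measurable_itv. Qed.

Lemma window_tonelli m u v A : measurable A ->
  (\int[leb]_(t in A) m (window u v t) =
   \int[m]_z leb (A `&` dual_window u v z))%E.
Proof.
move=> mA.
pose Q : set (MR R * MR R) := (A `*` setT) `&`
  (fun p => (p.1 : R) - (p.2 : R)) @^-1` `[u, v[%classic.
have mQ : measurable Q.
  apply: measurableI; first exact: measurableX.
  rewrite -[X in measurable X]setTI.
  suff /(_ measurableT) : measurable_fun setT
      (fun p : MR R * MR R => ((p.1 : R) - (p.2 : R)) : MR R).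
    by apply; exact: measurable_itv.
  by apply: measurable_funB; [exact: measurable_fst|exact: measurable_snd].
have := @section_tonelli _ _ _ _ (@lebesgue_measure R) m _ mQ.
move=> h; rewrite [LHS]integral_mkcond; apply: eq_trans (eq_trans h _).
  apply: eq_integral => t _; rewrite patchE.
  have [tA|tA] := boolP (t \in A).
    congr (m _); apply/seteqP; split=> z /=; rewrite /window /xsection /= inE /Q /= !in_itv/=.
      move=> /andP[h1 h2]; split; first by split => //; exact: set_mem.
      by apply/andP; split; lra.
    by move=> [_ /andP[h1 h2]]; apply/andP; split; lra.
  rewrite (_ : xsection _ _ = set0) ?measure0//.
  apply/seteqP; split=> z //=; rewrite /xsection /= inE => -[[At _] _].
  by move: tA; rewrite notin_setE; apply.
apply: eq_integral => z _; congr (leb _).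
apply/seteqP; split=> t /=; rewrite /dual_window /ysection /= inE /Q /= !in_itv/=.
  by move=> [[At _] /andP[h1 h2]]; split => //; apply/andP; split; lra.
by move=> [At /andP[h1 h2]]; split => //; apply/andP; split; lra.
Qed.

(** By Tonelli: each z belongs to the windows of exactly those t in its dual window, which has
    length v - u. *)
Lemma integral_window m u v : u <= v ->
  (\int[leb]_t (mval (charge_of m) (window u v t))%:E = ((v - u) * mval (charge_of m) setT)%:E)%E.
Proof.
move=> uv; transitivity (\int[leb]_t m (window u v t))%E.
  by apply: eq_integral => t _; rewrite /mval fineK// fin_num_measure//; exact: measurable_window.
rewrite window_tonelli//; under eq_integral.
  move=> z _; rewrite setTI /dual_window lebesgue_measure_itv/= lte_fin ltrD2l.
  rewrite (_ : (if _ then _ else _) = (v - u)%:E); last first.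
    case: ltP => [_|vu]; first by rewrite -EFinB; congr EFin; lra.
    by congr EFin; lra.
  over.
by rewrite integral_cst//= EFinM -mvalE.
Qed.

Lemma measurable_mval_window m u v : measurable_fun setT (fun t : MR R => mval (charge_of m) (window u v t)).
Proof.
pose Q : set (MR R * MR R) :=
  (fun p => (p.2 : R) - (p.1 : R)) @^-1` `[u, v[%classic.
have mQ : measurable Q.
  rewrite -[X in measurable X]setTI.
  suff /(_ measurableT) : measurable_fun setT
      (fun p : MR R * MR R => ((p.2 : R) - (p.1 : R)) : MR R).
    by apply; exact: measurable_itv.
  by apply: measurable_funB; [exact: measurable_snd|exact: measurable_fst].
have QE t : window u v t = ysection Q t.
  apply/seteqP; split=> z /=; rewrite /window /ysection /= inE /Q /= !in_itv/=;
  by move=> /andP[h1 h2]; apply/andP; split; lra.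
by have [] := bounded_measurable_section m mQ QE.
Qed.

Lemma integrable_mval_window m u v : u <= v ->
  leb.-integrable setT (EFin \o (fun t : MR R => mval (charge_of m) (window u v t))).
Proof.
move=> uv; apply/integrableP; split.
  by apply/measurable_EFinP; exact: measurable_mval_window.
under eq_integral => t _ do rewrite /= ger0_norm ?mval_ge0//.
by rewrite integral_window// ltry.
Qed.

End windows.

Section densities.
Context {R : realType}.
Implicit Types (X Y : signed_measure R) (A B : set (MR R)) (k : MR R -> R).
Implicit Types m : {finite_measure set (MR R) -> \bar R}.

(** Before folding, the convolution of a measure on [0,1] spreads outside [0,1], so [has_density]
    does not apply to it. *)
Definition density_on_line X k := leb.-integrable setT (EFin \o k) /\
  forall A, measurable A -> mval X A = \int[leb]_(x in A) k x.

Lemma integrable_sub k A : measurable A ->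
  leb.-integrable setT (EFin \o k) -> leb.-integrable A (EFin \o k).
Proof. by move=> mA; apply: integrableS. Qed.

Lemma integrable_fctD d (T : measurableType d) (mu : {measure set T -> \bar R}) (D : set T) (k l : T -> R) :
  measurable D -> mu.-integrable D (EFin \o k) -> mu.-integrable D (EFin \o l) ->
  mu.-integrable D (EFin \o (fun t => k t + l t)).
Proof.
move=> mA ik il.
by rewrite (_ : _ \o _ = (EFin \o k) \+ (EFin \o l))%E//; exact: integrableD.
Qed.

Lemma integrable_fctZ d (T : measurableType d) (mu : {measure set T -> \bar R}) (D : set T) c (k : T -> R) :
  measurable D -> mu.-integrable D (EFin \o k) ->
  mu.-integrable D (EFin \o (fun t => c * k t)).
Proof.
move=> mA ik.
by rewrite (_ : _ \o _ = fun t => c%:E * (EFin \o k) t)%E//; exact: integrableZl.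
Qed.

Lemma integrable_fctB d (T : measurableType d) (mu : {measure set T -> \bar R}) (D : set T) (k l : T -> R) :
  measurable D -> mu.-integrable D (EFin \o k) -> mu.-integrable D (EFin \o l) ->
  mu.-integrable D (EFin \o (fun t => k t - l t)).
Proof.
move=> mA ik il.
by rewrite (_ : _ \o _ = (EFin \o k) \- (EFin \o l))%E//; exact: integrableB.
Qed.

Lemma density_on_lineD X Y k l : density_on_line X k -> density_on_line Y l ->
  density_on_line (smadd X Y) (fun t => k t + l t).
Proof.
move=> [ik Xk] [il Yl]; split; first exact: integrable_fctD.
move=> A mA; rewrite mval_add// Xk// Yl// RintegralD//; exact: integrable_sub.
Qed.

Lemma density_on_lineZ X k c : density_on_line X k -> density_on_line (smscale c X) (fun t => c * k t).
Proof.
move=> [ik Xk]; split; first exact: integrable_fctZ.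
by move=> A mA; rewrite mval_scale// Xk// RintegralZl//; exact: integrable_sub.
Qed.

Lemma density_on_lineB X Y k l : density_on_line X k -> density_on_line Y l ->
  density_on_line (smsub X Y) (fun t => k t - l t).
Proof.
move=> Xk Yl; have := density_on_lineD Xk (density_on_lineZ (-1) Yl).
by under [X in density_on_line _ X -> _]eq_fun do rewrite mulN1r.
Qed.

(** The L1 norm of the density is replaced by the integral of a majorant W, chosen later as a
    combination of window masses, whose integrals are known exactly. *)
Lemma tv_le_Rintegral X k (W : MR R -> R) c : density_on_line X k ->
  leb.-integrable setT (EFin \o W) -> (forall t, `|k t| <= W t) ->
  \int[leb]_t W t <= c -> tv X <= c.
Proof.
move=> [ik Xk] iW kW Wc; apply: tv_le => A mA.
have mA' := measurableC mA.
rewrite !Xk//; apply: le_trans Wc.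
have -> : \int[leb]_t W t = \int[leb]_(t in A) W t + \int[leb]_(t in ~` A) W t.
  rewrite -Rintegral_setU//; first by rewrite setUCr.
  - by rewrite setUCr.
  - by apply/disj_setPS; rewrite setICr.
apply: lerD.
  apply: le_Rintegral => //; [exact: integrable_sub|exact: integrable_sub|].
  by move=> x _; apply: le_trans (kW x); rewrite ler_norm.
rewrite lerNl -mulN1r -RintegralZl//; last exact: integrable_sub.
apply: le_Rintegral => //; last first.
- by move=> x _; rewrite mulN1r lerNl; apply: le_trans (kW x); rewrite -normrN ler_norm.
- exact: integrable_sub.
- by apply: integrable_fctZ => //; exact: integrable_sub.
Qed.

Lemma Rintegral_window m u v : u <= v ->
  \int[leb]_t mval (charge_of m) (window u v t) = (v - u) * mval (charge_of m) setT.
Proof. by move=> uv; rewrite /Rintegral integral_window. Qed.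

Lemma Rintegral_window_setI m u v A : measurable A -> u <= v ->
  \int[leb]_(t in A) mval (charge_of m) (window u v t) =
  \int[m]_z fine (leb (A `&` dual_window u v z)).
Proof.
move=> mA uv; rewrite /Rintegral; congr fine.
transitivity (\int[leb]_(t in A) m (window u v t))%E.
  by apply: eq_integral => t _; rewrite /mval fineK// fin_num_measure//; exact: measurable_window.
rewrite window_tonelli//; apply: eq_integral => z _; rewrite fineK//.
rewrite ge0_fin_numE//; apply: (@le_lt_trans _ _ (leb (dual_window u v z))).
  by apply: le_measure; rewrite ?inE//; [apply: measurableI => //; exact: measurable_itv|exact: measurable_itv].
by rewrite /dual_window lebesgue_measure_itv/=; case: ifP => _; rewrite -?EFinB ltry.
Qed.

Lemma mval_box c b A : measurable A ->
  mval (box c b) A = c * fine (leb (A `&` `[- (b / 2), b / 2]%classic) : \bar R).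
Proof.
move=> mA; rewrite /mval /= /induced_charge.
under eq_integral do rewrite EFinM.
rewrite integralZl//; last first.
  apply: (integrableS (measurableT) mA (@subsetT _ _)).
  exact: integrable_indic_itv.
rewrite integral_indic//.
rewrite fineM// setIC// ge0_fin_numE//.
apply: (@le_lt_trans _ _ (leb (`[- (b / 2), b / 2]%classic : set (MR R)))).
  apply: le_measure; rewrite ?inE//.
  by apply: measurableI.
by rewrite lebesgue_measure_itv/=; case: ifP => _; rewrite -?EFinB ltry.
Qed.

Lemma mval_box_shift c b A z : measurable A ->
  mval (box c b) ((fun x : MR R => (x : R) + z) @^-1` A) =
  c * fine (leb (A `&` dual_window (- (b / 2)) (b / 2) z) : \bar R).
Proof.
move=> mA; have mA' : measurable ((fun x : MR R => (x : R) + z) @^-1` A).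
  exact: (measurable_preimage (measurable_translate z)).
rewrite mval_box//; congr (_ * fine _).
transitivity (leb ((fun x : MR R => (x : R) + z) @^-1`
    (A `&` `[z - (b / 2), z + b / 2]%classic)) : \bar R).
  congr (leb _); apply/seteqP; split=> x /=; rewrite !in_itv/= => -[Ax /andP[h1 h2]];
    split => //; apply/andP; split; lra.
have mI (i : interval R) : measurable ([set` i] : set (MR R)) by exact: measurable_itv.
rewrite lebesgue_translate//; last by apply: measurableI.
(* For b >= 0 the closed interval exceeds the dual window by its right endpoint, a null set; for b <
   0 both are empty. *)
rewrite /dual_window; have [b0|b0] := leP 0 b.
  rewrite (_ : _ `&` `[_, _]%classic = (A `&` `[z + - (b / 2), z + b / 2[%classic) `|` (A `&` [set z + b / 2])).
    rewrite measureU0//; [exact: measurableI|exact: measurableI|].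
    apply/eqP; rewrite -measure_le0; apply: (@le_trans _ _ (leb [set z + b / 2])).
      by apply: le_measure; rewrite ?inE//; exact: measurableI.
    by rewrite lebesgue_measure_set1.
  rewrite -setIUr setUitv1//; rewrite bnd_simp; lra.
rewrite !set_itv_ge ?bnd_simp ?setI0//; lra.
Qed.

(** Tonelli exchanges the X-integral of the Lebesgue measure of A in a dual window for the integral
    over A of the X-mass of a window. *)
Lemma smconv_box X c b : 0 <= b ->
  density_on_line (smconv (box c b) X) (fun t => c * mval X (window (- (b / 2)) (b / 2) t)).
Proof.
move=> b0; have uv : - (b / 2) <= b / 2 by lra.
have iX : leb.-integrable setT (EFin \o (fun t => mval X (window (- (b / 2)) (b / 2) t))).
  rewrite (_ : (fun _ => _) = fun t => mval (charge_of (pos_part X)) (window (- (b / 2)) (b / 2) t) -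
    mval (charge_of (neg_part X)) (window (- (b / 2)) (b / 2) t)).
    by apply: integrable_fctB => //; exact: integrable_mval_window.
  by apply/funext => t /=; rewrite -mval_jordan//; exact: measurable_window.
split; first exact: integrable_fctZ.
move=> A mA; rewrite smconvE// RintegralZl//; last exact: integrable_sub.
rewrite (_ : (fun z => _) = fun z => c * mval (box 1 b) ((fun x : MR R => (x : R) + z) @^-1` A)); last first.
  by apply/funext => z; rewrite !mval_box_shift// mul1r.
rewrite signed_integralZ; last exact: bounded_measurable_shift.
congr (_ * _); rewrite /signed_integral.
under eq_Rintegral do rewrite mval_box_shift// mul1r.
under [X in _ - X]eq_Rintegral do rewrite mval_box_shift// mul1r.
rewrite -!Rintegral_window_setI// -RintegralB//; try (apply: integrable_sub => //; exact: integrable_mval_window).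
by apply: eq_Rintegral => t _; rewrite -mval_jordan//; exact: measurable_window.
Qed.

End densities.

(** * The folding map *)

Section fold.
Context {R : realType}.
Implicit Types (X Y : signed_measure R) (A B : set (MR R)).

(** Distinct centres 2i are at least 2 apart, so when one is within distance 1 of x every other one
    is at distance at least 1. *)
Lemma fold01_itv (x : R) (k : int) : `|x - 2 * k%:~R| <= 1 ->
  fold01 x = `|x - 2 * k%:~R|.
Proof.
move=> xk; apply/eqP; rewrite eq_le; apply/andP; split.
  apply: ge_inf; last by exists k.
  by exists 0 => _ [j _ <-].
apply: lb_le_inf; first by exists `|x - 2 * k%:~R|, k.
move=> _ [i _ <-]; have [->//|ik] := eqVneq i k.
have k1 : 1 <= `|k%:~R - i%:~R : R|.
  rewrite -intrB -intr_norm (_ : 1 = 1%:~R)// ler_int.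
  by rewrite -gtz0_ge1 normr_gt0 subr_eq0 eq_sym.
have := ler_normB (x - 2 * i%:~R) (x - 2 * k%:~R).
have -> : x - 2 * i%:~R - (x - 2 * k%:~R) = 2 * (k%:~R - i%:~R) by lra.
by rewrite normrM (ger0_norm (_ : 0 <= 2 :> R))//; lra.
Qed.

Lemma fold01_bound (x : R) : exists k : int, `|x - 2 * k%:~R| <= 1.
Proof.
exists (Num.floor ((x + 1) / 2)).
have := floor_itv ((x + 1) / 2).
rewrite intrD => /andP[h1 h2]; rewrite ler_norml; apply/andP; split; lra.
Qed.

Lemma fold01_in (x : R) : unit_itv R (fold01 x).
Proof.
have [k xk] := fold01_bound x; rewrite (fold01_itv xk) /= in_itv /=.
by rewrite normr_ge0.
Qed.

Lemma fold01_id (x : R) : unit_itv R x -> fold01 x = x.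
Proof.
rewrite /= in_itv /= => /andP[x0 x1].
by rewrite (@fold01_itv _ 0) mulr0 subr0 ger0_norm.
Qed.

Lemma measurable_preimage_fold01 A : measurable A ->
  measurable ((fold01 : MR R -> MR R) @^-1` A).
Proof. by move=> mA; apply: measurable_preimage => //; exact: measurable_fold01. Qed.

Lemma mval_push X A : mval (fold01_push X) A = mval X ((fold01 : MR R -> MR R) @^-1` A).
Proof. by []. Qed.

Lemma tv_push X : tv (fold01_push X) <= tv X.
Proof.
apply: tv_le => A mA; rewrite !mval_push; apply: tv_ge; apply: measurable_preimage_fold01 => //.
exact: measurableC.
Qed.

Lemma on01_push X : on01 (fold01_push X).
Proof.
apply/on01P => A mA; rewrite !mval_push preimage_setI.
congr (mval X _); apply/setIidPl => x _ /=; exact: fold01_in.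
Qed.

End fold.

(** * Push-forward by a map of the unit interval *)

Section transfer.
Context {R : realType}.
Implicit Types (X Y : signed_measure R) (A B : set (MR R)) (T : R -> R).

Lemma measurable_unit_itv : measurable (unit_itv R).
Proof. exact: measurable_itv. Qed.

Definition mfun01 T := measurable_fun (unit_itv R) (T : MR R -> MR R).

Lemma measurable_transfer_preimage T A : mfun01 T -> measurable A ->
  measurable (unit_itv R `&` (T : MR R -> MR R) @^-1` A).
Proof. by move=> mT mA; apply: mT => //; exact: measurable_unit_itv. Qed.

Lemma mval_transfer T X A : mfun01 T ->
  mval (transfer T X) A = mval X (unit_itv R `&` (T : MR R -> MR R) @^-1` A).
Proof. by move=> mT; rewrite /mval /= /transfer_fun asboolT. Qed.

Lemma tv_transfer T X : mfun01 T -> tv (transfer T X) <= tv X.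
Proof.
move=> mT; apply: tv_le => A mA; rewrite !mval_transfer//.
by apply: tv_ge; apply: measurable_transfer_preimage => //; exact: measurableC.
Qed.

Lemma on01_transfer T X : mfun01 T -> set_fun (unit_itv R) (unit_itv R) T ->
  on01 (transfer T X).
Proof.
move=> mT TU; apply/on01P => A mA; rewrite !mval_transfer//; congr (mval X _).
by apply/seteqP; split=> x /= [Ux]; [move=> []|move=> ?; split=> //; split => //; exact: TU].
Qed.

Lemma mass_transfer T X : mfun01 T -> on01 X -> mval (transfer T X) setT = mval X setT.
Proof.
move=> mT /on01P X01; rewrite mval_transfer// preimage_setT -[RHS]X01//.
by rewrite setIC.
Qed.

End transfer.

Section uniform.
Context {R : realType}.
Implicit Types (X Y : signed_measure R) (A B : set (MR R)).

(** This is the mass of |X| in the window, kept as a sum over the two Jordan parts so that Tonelli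
    applies to each. *)
Definition abs_window X u v t : R :=
  mval (charge_of (pos_part X)) (window u v t) + mval (charge_of (neg_part X)) (window u v t).

Lemma norm_window_le X u v t : `|mval X (window u v t)| <= abs_window X u v t.
Proof.
rewrite mval_jordan; last exact: measurable_window.
by apply: le_trans (ler_normB _ _) _; rewrite !ger0_norm ?mval_ge0.
Qed.

Lemma integrable_abs_window X u v : u <= v ->
  leb.-integrable setT (EFin \o (abs_window X u v : MR R -> R)).
Proof. by move=> uv; apply: integrable_fctD => //; exact: integrable_mval_window. Qed.

Lemma Rintegral_abs_window X u v : u <= v -> \int[leb]_t abs_window X u v t = (v - u) * tv X.
Proof.
move=> uv; rewrite /abs_window RintegralD//; try exact: integrable_mval_window.
by rewrite !Rintegral_window// /tv mulrDr.
Qed.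

Lemma density_uniform_noise b X : 0 < b -> density_on_line (smconv (uniform_noise b) X)
  (fun t => b^-1 * mval X (window (- (b / 2)) (b / 2) t)).
Proof. by move=> b0; apply: smconv_box; exact: ltW. Qed.

Lemma tv_uniform b X : 0 < b -> tv (smconv (uniform_noise b) X) <= tv X.
Proof.
move=> b0; have uv : - (b / 2) <= b / 2 by lra.
apply: (@tv_le_Rintegral _ _ _ (fun t => b^-1 * abs_window X (- (b / 2)) (b / 2) t) _ (density_uniform_noise X b0)).
- by apply: integrable_fctZ => //; exact: integrable_abs_window.
- move=> t; have bi : 0 <= b^-1 by rewrite invr_ge0 ltW.
  by rewrite normrM (ger0_norm bi); apply: ler_wpM2l => //; exact: norm_window_le.
- rewrite RintegralZl//; last exact: integrable_abs_window.
  rewrite Rintegral_abs_window// (_ : b / 2 - _ = b) ?mulrA ?mulVf ?gt_eqF ?mul1r//; lra.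
Qed.

Lemma mass_box c b X : 0 <= b ->
  mval (smconv (box c b) X) setT = c * b * mval X setT.
Proof.
move=> b0; have uv : - (b / 2) <= b / 2 by lra.
have [_ ->//] := smconv_box X c b0.
under eq_Rintegral => t _ do rewrite (mval_jordan X (measurable_window _ _ _)).
rewrite RintegralZl//; last by apply: integrable_fctB => //; exact: integrable_mval_window.
rewrite RintegralB//; try exact: integrable_mval_window.
rewrite !Rintegral_window// -mulrBr -mval_jordan//.
by rewrite (_ : b / 2 - _ = b) ?mulrA//; lra.
Qed.

Lemma mass_uniform b X : 0 < b ->
  mval (smconv (uniform_noise b) X) setT = mval X setT.
Proof. by move=> b0; rewrite mass_box ?(ltW b0)// mulVf ?mul1r// gt_eqF. Qed.

Lemma integrable_signed_window X u v : u <= v ->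
  leb.-integrable setT (EFin \o (fun t : MR R => mval X (window u v t))).
Proof.
move=> uv; rewrite (_ : (fun _ => _) = fun t : MR R =>
    mval (charge_of (pos_part X)) (window u v t) - mval (charge_of (neg_part X)) (window u v t)).
  by apply: integrable_fctB => //; exact: integrable_mval_window.
by apply/funext => t /=; rewrite -mval_jordan//; exact: measurable_window.
Qed.

(** Linearity and monotonicity in X are visible on this formula, while the definition goes through
    the nonlinear Jordan parts. *)
Lemma mval_rconv b X A : 0 < b -> measurable A ->
  mval (rconv (uniform_noise b) X) A =
  b^-1 * \int[leb]_(t in (fold01 : MR R -> MR R) @^-1` A)
     mval X (window (- (b / 2)) (b / 2) t).
Proof.
move=> b0 mA; have mB := measurable_preimage_fold01 mA.
rewrite /rconv mval_push; have [_ ->//] := density_uniform_noise X b0.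
rewrite RintegralZl//; apply: integrable_sub => //.
by apply: integrable_signed_window; lra.
Qed.

Lemma rconv_eq b X Y : 0 < b -> sm_eq X Y ->
  sm_eq (rconv (uniform_noise b) X) (rconv (uniform_noise b) Y).
Proof.
move=> b0 /sm_eqP XY; apply/sm_eqP => A mA; rewrite !mval_rconv//; congr (_ * _).
by apply: eq_Rintegral => t _; rewrite XY//; exact: measurable_window.
Qed.

Lemma rconv_add b X Y A : 0 < b -> measurable A ->
  mval (rconv (uniform_noise b) (smadd X Y)) A =
  mval (rconv (uniform_noise b) X) A + mval (rconv (uniform_noise b) Y) A.
Proof.
move=> b0 mA; rewrite !mval_rconv// -mulrDr -RintegralD//; try exact: measurable_preimage_fold01.
- congr (_ * _); apply: eq_Rintegral => t _; rewrite mval_add//; exact: measurable_window.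
- by apply: integrable_sub; [exact: measurable_preimage_fold01|apply: integrable_signed_window; lra].
- by apply: integrable_sub; [exact: measurable_preimage_fold01|apply: integrable_signed_window; lra].
Qed.

Lemma rconv_scale b c X A : 0 < b -> measurable A ->
  mval (rconv (uniform_noise b) (smscale c X)) A =
  c * mval (rconv (uniform_noise b) X) A.
Proof.
move=> b0 mA; rewrite !mval_rconv// mulrCA -[in RHS]RintegralZl//; try exact: measurable_preimage_fold01.
- congr (_ * _); apply: eq_Rintegral => t _; rewrite mval_scale//; exact: measurable_window.
- by apply: integrable_sub; [exact: measurable_preimage_fold01|apply: integrable_signed_window; lra].
Qed.

Lemma rconv_le b X Y A : 0 < b -> measurable A ->
  (forall B, measurable B -> mval X B <= mval Y B) ->
  mval (rconv (uniform_noise b) X) A <= mval (rconv (uniform_noise b) Y) A.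
Proof.
move=> b0 mA XY; rewrite !mval_rconv// ler_pM2l ?invr_gt0//.
apply: le_Rintegral; first exact: measurable_preimage_fold01.
- by apply: integrable_sub; [exact: measurable_preimage_fold01|apply: integrable_signed_window; lra].
- by apply: integrable_sub; [exact: measurable_preimage_fold01|apply: integrable_signed_window; lra].
- by move=> t _; apply: XY; exact: measurable_window.
Qed.

Lemma on01_rconv rho X : on01 (rconv rho X).
Proof. exact: on01_push. Qed.

Lemma tv_rconv b X : 0 < b -> tv (rconv (uniform_noise b) X) <= tv X.
Proof. by move=> b0; apply: le_trans (tv_push _) (tv_uniform _ _). Qed.

Lemma mass_rconv b X : 0 < b -> mval (rconv (uniform_noise b) X) setT = mval X setT.
Proof. by move=> b0; rewrite /rconv mval_push preimage_setT mass_uniform. Qed.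

End uniform.

(** * Contraction and resolvent *)
Section operator.
Context {R : realType} (b : R) (T : R -> R) (b0 : 0 < b) (mT : mfun01 T).
Implicit Types (X Y : signed_measure R) (A B : set (MR R)).

Local Notation L := (noisy_transfer b T).

Lemma noisy_eq X Y : sm_eq X Y -> sm_eq (L X) (L Y).
Proof.
move=> /sm_eqP XY; apply: rconv_eq => //; apply/sm_eqP => A mA.
by rewrite !mval_transfer// XY//; exact: measurable_transfer_preimage.
Qed.

Lemma noisy_add X Y A : measurable A -> mval (L (smadd X Y)) A = mval (L X) A + mval (L Y) A.
Proof.
move=> mA; rewrite /noisy_transfer -rconv_add//; move: A mA; apply/sm_eqP.
apply: rconv_eq => //; apply/sm_eqP => B mB; rewrite mval_add// !mval_transfer// mval_add//.
exact: measurable_transfer_preimage.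
Qed.

Lemma noisy_scale c X A : measurable A -> mval (L (smscale c X)) A = c * mval (L X) A.
Proof.
move=> mA; rewrite /noisy_transfer -rconv_scale//; move: A mA; apply/sm_eqP.
apply: rconv_eq => //; apply/sm_eqP => B mB; rewrite mval_scale// !mval_transfer// mval_scale//.
exact: measurable_transfer_preimage.
Qed.

Lemma noisy_sub X Y A : measurable A -> mval (L (smsub X Y)) A = mval (L X) A - mval (L Y) A.
Proof. by move=> mA; rewrite noisy_add// noisy_scale// mulN1r. Qed.

Lemma noisy_le X Y A : measurable A -> (forall B, measurable B -> mval X B <= mval Y B) ->
  mval (L X) A <= mval (L Y) A.
Proof.
move=> mA XY; apply: rconv_le => // B mB; rewrite !mval_transfer//.
by apply: XY; exact: measurable_transfer_preimage.
Qed.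

Lemma tv_noisy X : tv (L X) <= tv X.
Proof. by apply: le_trans (tv_rconv _ _) (tv_transfer _ _). Qed.

Lemma on01_noisy X : on01 (L X).
Proof. exact: on01_rconv. Qed.

Lemma mass_noisy X : on01 X -> mval (L X) setT = mval X setT.
Proof. by move=> X01; rewrite /noisy_transfer mass_rconv// mass_transfer. Qed.

Lemma iter_noisy_eq n X Y : sm_eq X Y -> sm_eq (iter n L X) (iter n L Y).
Proof. by move=> XY; elim: n => //= n; exact: noisy_eq. Qed.

Lemma iter_noisy_sub n X Y A : measurable A ->
  mval (iter n L (smsub X Y)) A = mval (iter n L X) A - mval (iter n L Y) A.
Proof.
elim: n A => [|n IH] A mA; first exact: mval_sub.
rewrite /= -noisy_sub//; move: A mA; apply/sm_eqP; apply: noisy_eq; apply/sm_eqP => B mB.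
by rewrite IH// mval_sub.
Qed.

Lemma iter_noisy_scale n c X A : measurable A ->
  mval (iter n L (smscale c X)) A = c * mval (iter n L X) A.
Proof.
elim: n A => [|n IH] A mA; first exact: mval_scale.
rewrite /= -noisy_scale//; move: A mA; apply/sm_eqP; apply: noisy_eq; apply/sm_eqP => B mB.
by rewrite IH// mval_scale.
Qed.

Lemma iter_noisy_le n X Y A : measurable A ->
  (forall B, measurable B -> mval X B <= mval Y B) ->
  mval (iter n L X) A <= mval (iter n L Y) A.
Proof.
elim: n A => [|n IH] A mA XY; first exact: XY.
by apply: noisy_le => // B mB; exact: IH.
Qed.

Lemma tv_iter_noisy n X : tv (iter n L X) <= tv X.
Proof. by elim: n => //= n; apply: le_trans; exact: tv_noisy. Qed.

Lemma on01_iter_noisy n X : on01 X -> on01 (iter n L X).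
Proof. by case: n => // n _; exact: on01_noisy. Qed.

Lemma mass_iter_noisy n X : on01 X -> mval (iter n L X) setT = mval X setT.
Proof.
by move=> X01; elim: n => //= n <-; rewrite mass_noisy//; exact: on01_iter_noisy.
Qed.

Lemma zero_averageP X : zero_average X <-> on01 X /\ mval X setT = 0.
Proof.
split=> -[X01 h]; split => //; first by rewrite /mval h.
by rewrite mvalE// h.
Qed.

Lemma zero_average_noisy X : zero_average X -> zero_average (L X).
Proof.
by move=> /zero_averageP[X01 h]; apply/zero_averageP; split;
  [exact: on01_noisy|rewrite mass_noisy].
Qed.

Lemma zero_average_iter_noisy n X : zero_average X -> zero_average (iter n L X).
Proof. by move=> h; elim: n => //= n; exact: zero_average_noisy. Qed.

Lemma on01_sub X Y : on01 X -> on01 Y -> on01 (smsub X Y).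
Proof.
move=> /on01P hX /on01P hY; apply/on01P => A mA.
have mI : measurable (A `&` unit_itv R) by apply: measurableI => //; exact: measurable_unit_itv.
by rewrite !mval_sub// hX// hY.
Qed.

Lemma on01_add X Y : on01 X -> on01 Y -> on01 (smadd X Y).
Proof.
move=> /on01P hX /on01P hY; apply/on01P => A mA.
have mI : measurable (A `&` unit_itv R) by apply: measurableI => //; exact: measurable_unit_itv.
by rewrite !mval_add// hX// hY.
Qed.

Lemma on01_scale c X : on01 X -> on01 (smscale c X).
Proof.
move=> /on01P hX; apply/on01P => A mA.
have mI : measurable (A `&` unit_itv R) by apply: measurableI => //; exact: measurable_unit_itv.
by rewrite !mval_scale// hX.
Qed.

Lemma zero_average_sub X Y : zero_average X -> zero_average Y ->
  zero_average (smsub X Y).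
Proof.
move=> /zero_averageP[hX X0] /zero_averageP[hY Y0]; apply/zero_averageP; split.
  exact: on01_sub.
by rewrite mval_sub// X0 Y0 subrr.
Qed.

Lemma zero_average_add X Y : zero_average X -> zero_average Y ->
  zero_average (smadd X Y).
Proof.
move=> /zero_averageP[hX X0] /zero_averageP[hY Y0]; apply/zero_averageP; split.
  exact: on01_add.
by rewrite mval_add// X0 Y0 addr0.
Qed.

Lemma zero_average_scale c X : zero_average X -> zero_average (smscale c X).
Proof.
move=> /zero_averageP[hX X0]; apply/zero_averageP; split.
  exact: on01_scale.
by rewrite mval_scale// X0 mulr0.
Qed.

Lemma mval_neumann v N A : measurable A ->
  mval (neumann L v N) A = \sum_(n < N) mval (iter n L v) A.
Proof.
move=> mA; rewrite /neumann.
apply: (big_ind2 (fun (X : signed_measure R) (x : R) => mval X A = x)) => //.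
by move=> X x Y y <- <-; rewrite mval_add.
Qed.

Lemma zero_average_neumann v N : zero_average v -> zero_average (neumann L v N).
Proof.
move=> hv; rewrite /neumann; apply: big_ind.
- by apply/zero_averageP; split=> //; apply/on01P.
- exact: zero_average_add.
- by move=> n _; exact: zero_average_iter_noisy.
Qed.

Lemma noisy_neumann v N A : measurable A ->
  mval (L (neumann L v N)) A = \sum_(n < N) mval (iter n.+1 L v) A.
Proof.
move=> mA; rewrite /neumann.
suff : mval (L (\big[smadd/sm0]_(n < N) iter n L v)) A =
    \sum_(n < N) mval (L (iter n L v)) A /\
    forall B, measurable B -> True by case.
split => //; elim/big_ind2 : _ => //.
  (* The empty sum: [sm0] agrees with 0 times itself, so homogeneity gives the value 0. *)
  have /noisy_eq/sm_eqP <-// : sm_eq (smscale 0 sm0) (sm0 : signed_measure R).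
    by apply/sm_eqP => B mB; rewrite mval_scale// mul0r.
  by rewrite noisy_scale// mul0r.
by move=> X x Y y <- <-; rewrite noisy_add.
Qed.

Section contraction.
Variables (N : nat) (e : R).
Hypotheses (e_gt0 : 0 < e)
  (LN : forall w, zero_average w -> tv (iter N L w) <= (1 - e) * tv w).

(* If w - L w = v then w = L^N w + sum_(n < N) L^n v. *)
Lemma tv_resolvent w v : zero_average w -> sm_eq (smsub w (L w)) v ->
  tv w <= N%:R / e * tv v.
Proof.
move=> w0 /sm_eqP wv.
have tel n A : measurable A ->
    mval w A - mval (iter n L w) A = \sum_(k < n) mval (iter k L v) A.
  move=> mA; elim: n => [|n IH]; first by rewrite big_ord0 subrr.
  rewrite big_ord_recr /= -IH.
  have /sm_eqP <-// : sm_eq (iter n L (smsub w (L w))) (iter n L v).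
    by apply: iter_noisy_eq; apply/sm_eqP.
  by rewrite iter_noisy_sub// -iterSr /=; lra.
have h : tv w <= (1 - e) * tv w + N%:R * tv v.
  apply: le_trans (lerD (LN w0) (lexx _)).
  apply: tv_le => A mA; have mA' := measurableC mA.
  have -> : mval w A - mval w (~` A) = (mval (iter N L w) A - mval (iter N L w) (~` A)) +
     (\sum_(k < N) mval (iter k L v) A - \sum_(k < N) mval (iter k L v) (~` A)).
    by rewrite -!tel//; lra.
  apply: lerD; first exact: tv_ge.
  rewrite -sumrB (_ : N%:R = \sum_(k < N) 1) ?mulr_suml; last first.
    by rewrite sumr_const card_ord.
  apply: ler_sum => k _; rewrite mul1r; apply: le_trans (tv_iter_noisy k v).
  exact: tv_ge.
have : e * tv w <= N%:R * tv v by lra.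
by rewrite mulrC -ler_pdivlMr// mulrAC.
Qed.

Lemma tv_iter_mul w k : zero_average w -> e <= 1 ->
  tv (iter (k * N) L w) <= (1 - e) ^+ k * tv w.
Proof.
move=> w0 e1; elim: k => [|k IH]; first by rewrite mul0n expr0 mul1r.
rewrite mulSn iterD; apply: le_trans (LN _) _; first exact: zero_average_iter_noisy.
by rewrite exprS -mulrA ler_wpM2l// subr_ge0.
Qed.

Lemma tv_iter_cvg w (eta : R) : zero_average w -> e <= 1 -> 0 < eta ->
  exists M, forall n, (M <= n)%N -> tv (iter n L w) <= eta.
Proof.
move=> w0 e1 eta0.
have /cvgrPdist_le : (fun k => (1 - e) ^+ k) @ \oo --> (0 : R).
  apply: cvg_expr; rewrite ger0_norm ?subr_ge0//. by rewrite gtrBl.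
have tw := tv_ge0 w.
(* Adding 1 keeps the denominator positive when w is zero. Only multiples of N are contracted; the
   remaining iterates do not increase [tv]. *)
move=> /(_ (eta / (tv w + 1))) [|k _ hk]; first by rewrite divr_gt0//; lra.
exists (k * N)%N => n kn; rewrite -(subnK kn) iterD.
apply: le_trans (tv_iter_noisy _ _) _; apply: le_trans (tv_iter_mul _ w0 e1) _.
have := hk k (leqnn k); rewrite sub0r normrN ger0_norm ?exprn_ge0 ?subr_ge0// => h.
apply: (@le_trans _ _ (eta / (tv w + 1) * tv w)); first by rewrite ler_wpM2r.
rewrite mulrAC ler_pdivrMr; nra.
Qed.

(** Compare the sum with its shift by N: the first N terms are at most [tv w] each, and the others
    are at most 1 - e times the terms of the original sum. Absorbing this part on the left gives a
    bound independent of M. *)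
Lemma sum_tv_iter w M : zero_average w ->
  \sum_(n < M) tv (iter n L w) <= N%:R / e * tv w.
Proof.
move=> w0.
have h : \sum_(n < M + N) tv (iter n L w) <= N%:R * tv w +
    (1 - e) * \sum_(n < M) tv (iter n L w).
  rewrite addnC big_split_ord /=; apply: lerD.
    rewrite (_ : N%:R = \sum_(k < N) 1) ?mulr_suml; last by rewrite sumr_const card_ord.
    by apply: ler_sum => k _; rewrite mul1r; exact: tv_iter_noisy.
  rewrite mulr_sumr; apply: ler_sum => k _; rewrite iterD.
  by apply: LN; exact: zero_average_iter_noisy.
have h2 : \sum_(n < M) tv (iter n L w) <= \sum_(n < M + N) tv (iter n L w).
  by rewrite big_split_ord /= lerDl; apply: sumr_ge0 => k _; exact: tv_ge0.
rewrite mulrAC ler_pdivlMr//; lra.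
Qed.

End contraction.

End operator.

(** The two clauses together control tails setwise: tails are nonnegative on every set, and their
    total mass tends to 0. This is convergence in total variation. *)
Lemma measure_series {R : realType} (m_ : nat -> {finite_measure set (MR R) -> \bar R}) (C : R) :
  (forall M, \sum_(n < M) mval (charge_of (m_ n)) setT <= C) ->
  exists m : {finite_measure set (MR R) -> \bar R},
    (forall A M, measurable A -> \sum_(n < M) mval (charge_of (m_ n)) A <= mval (charge_of m) A) /\
    (forall eta, 0 < eta -> exists M0, forall M, (M0 <= M)%N ->
       mval (charge_of m) setT - \sum_(n < M) mval (charge_of (m_ n)) setT <= eta).
Proof.
move=> hC.
have partial A M : measurable A ->
    (\sum_(0 <= n < M) m_ n A = (\sum_(n < M) mval (charge_of (m_ n)) A)%:E)%E.
  by move=> mA; rewrite big_mkord -sumEFin; apply: eq_bigr => n _; rewrite -mvalE.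
have cv A : (\sum_(0 <= n < M) m_ n A)%E @[M --> \oo] --> mseries m_ 0 A.
  by apply: is_cvg_nneseries => n _ _.
have fin : (mseries m_ 0 setT < +oo)%E.
  apply: (@le_lt_trans _ _ C%:E); last exact: ltry.
  rewrite /mseries; apply: lime_le; first exact: is_cvg_nneseries.
  by apply: nearW => M; rewrite partial// lee_fin.
exists (mfrestr measurableT fin).
have E A : measurable A -> (mseries m_ 0 A = (mval (charge_of (mfrestr measurableT fin)) A)%:E)%E.
  by move=> mA; rewrite -mvalE//= /mfrestr /mrestr setIT.
split=> [A M mA|eta eta0].
  rewrite -lee_fin -partial// -E//.
  by apply: nneseries_lim_ge => n _.
have := cv setT; rewrite E// => /fine_cvgP[_ /cvgrPdist_le /(_ eta eta0)[M0 _ h]].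
exists M0 => M /h /=; rewrite partial//=; apply: le_trans; exact: ler_norm.
Qed.

Section resolvent.
Context {R : realType} (b : R) (T : R -> R) (b0 : 0 < b) (mT : mfun01 T).
Implicit Types (X Y : signed_measure R) (A B : set (MR R)).
Variables (N : nat) (e : R).
Local Notation L := (noisy_transfer b T).
Hypotheses (e_gt0 : 0 < e) (e_le1 : e <= 1)
  (LN : forall w, zero_average w -> tv (iter N L w) <= (1 - e) * tv w).

Lemma tv_sm0 : tv (sm0 : signed_measure R) <= 0.
Proof. by apply: tv_le => A mA; rewrite !mval_sm0 subr0. Qed.

Lemma resolvent_unique r r' v : zero_average r -> zero_average r' ->
  sm_eq (smsub r (L r)) v -> sm_eq (smsub r' (L r')) v -> sm_eq r' r.
Proof.
move=> r0 r0' /sm_eqP mval0 /sm_eqP rv'; apply: tv0_eq.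
apply: (@le_trans _ _ (N%:R / e * tv (sm0 : signed_measure R))).
  apply: (tv_resolvent b0 mT e_gt0 LN) => //; first exact: zero_average_sub.
  apply/sm_eqP => A mA; have := mval0 A mA; have := rv' A mA.
  rewrite !mval_sub// noisy_sub// mval_sm0; lra.
by rewrite mulr_ge0_le0 ?divr_ge0 ?(ltW e_gt0)//; exact: tv_sm0.
Qed.

(** The limit is built by summing the positive and the negative Jordan parts of the iterates
    separately, as a difference of two finite measures, instead of by a completeness argument. The
    uniform bound of [sum_tv_iter] makes both sums finite. *)
Lemma neumann_cvg v : zero_average v -> exists r : signed_measure R,
  forall eta : R, 0 < eta -> exists M0, forall M, (M0 <= M)%N ->
    tv (smsub (neumann L v M) r) <= eta.
Proof.
move=> v0; pose C := N%:R / e * tv v.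
have hC M : \sum_(n < M) tv (iter n L v) <= C by exact: (sum_tv_iter b0 mT e_gt0).
have h1 M : \sum_(n < M) mval (charge_of (pos_part (iter n L v))) setT <= C.
  by apply: le_trans (hC M); apply: ler_sum => n _; rewrite lerDl mval_ge0.
have h2 M : \sum_(n < M) mval (charge_of (neg_part (iter n L v))) setT <= C.
  by apply: le_trans (hC M); apply: ler_sum => n _; rewrite lerDr mval_ge0.
have [m1 [m1ge m1cv]] := @measure_series _ (fun n => pos_part (iter n L v)) _ h1.
have [m2 [m2ge m2cv]] := @measure_series _ (fun n => neg_part (iter n L v)) _ h2.
exists (smsub (charge_of m1) (charge_of m2)) => eta eta0.
have [|M1 hM1] := m1cv (eta / 2); first by rewrite divr_gt0.
have [|M2 hM2] := m2cv (eta / 2); first by rewrite divr_gt0.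
exists (maxn M1 M2) => M; rewrite geq_max => /andP[/hM1 k1 /hM2 k2].
apply: tv_le => A mA; have mA' := measurableC mA.
rewrite !mval_sub// !mval_neumann//.
have J B : measurable B -> \sum_(n < M) mval (iter n L v) B =
    \sum_(n < M) mval (charge_of (pos_part (iter n L v))) B -
    \sum_(n < M) mval (charge_of (neg_part (iter n L v))) B.
  by move=> mB; rewrite -sumrB; apply: eq_bigr => n _; rewrite -mval_jordan.
have S (m_ : nat -> {finite_measure set (MR R) -> \bar R}) :
    \sum_(n < M) mval (charge_of (m_ n)) (~` A) =
    \sum_(n < M) mval (charge_of (m_ n)) setT - \sum_(n < M) mval (charge_of (m_ n)) A.
  by rewrite -sumrB; apply: eq_bigr => n _; rewrite mvalC.
(* On A and on its complement the tails of both series are nonnegative, and for each series they add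
   up to at most eta / 2. *)
have a1 := m1ge A M mA; have a2 := m1ge _ M mA'.
have b1 := m2ge A M mA; have b2 := m2ge _ M mA'.
rewrite !J// !(mvalC _ mA) in a2 b2 *.
rewrite !(S (fun n => pos_part (iter n L v))) !(S (fun n => neg_part (iter n L v))) in a2 b2 *.
lra.
Qed.

Lemma resolvent_ex v : zero_average v -> exists r : signed_measure R,
  [/\ zero_average r, sm_eq (smsub r (L r)) v &
   forall eta : R, 0 < eta -> exists M0, forall M, (M0 <= M)%N ->
    tv (smsub (neumann L v M) r) <= eta].
Proof.
move=> v0; have [r hr] := neumann_cvg v0; exists r.
(* Every number below all the distances to r is nonpositive; this is how setwise identities
   satisfied by all partial sums pass to r. *)
have lim x : (forall M, x <= tv (smsub (neumann L v M) r)) -> x <= 0.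
  move=> hx; apply/ler_addgt0Pl => eta eta0; rewrite addr0.
  by have [M0 h] := hr eta eta0; apply: le_trans (hx M0) (h _ (leqnn _)).
have r0 : zero_average r.
  have z A : measurable A -> (forall M, mval (neumann L v M) A = 0) -> mval r A = 0.
    move=> mA n0; apply/eqP; rewrite -normr_le0; apply: lim => M.
    have := mval_le_tv (smsub (neumann L v M) r) mA.
    by rewrite mval_sub// n0 sub0r normrN.
  have nz M := zero_average_neumann b0 mT M v0.
  apply/zero_averageP; split; last first.
    by apply: z => // M; have /zero_averageP[] := nz M.
  apply/on01P => A mA.
  have mI : measurable (A `&` unit_itv R) by apply: measurableI => //; exact: measurable_unit_itv.
  apply/esym/eqP; rewrite -subr_eq0 -mvalD//; apply/eqP; apply: z.
    exact: measurableD.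
  move=> M; have /zero_averageP[/on01P h _] := nz M.
  by rewrite mvalD// h// subrr.
split=> //; apply: tv0_eq; apply/ler_addgt0Pl => eta eta0; rewrite addr0.
have [|M1 hM1] := hr (eta / 4); first by rewrite divr_gt0.
have [|M2 hM2] := tv_iter_cvg b0 mT e_gt0 LN v0 e_le1 (eta := eta / 4).
  by rewrite divr_gt0.
pose M := maxn M1 M2.
have k1 := hM1 M (leq_maxl _ _); have k2 := hM2 M (leq_maxr _ _).
set S := neumann L v M in k1.
(* r - L r - v = L (S - r) - (S - r) - L^M v *)
apply: (@le_trans _ _ (tv (L (smsub S r)) + tv (smsub S r) + tv (iter M L v))); last first.
  have := tv_noisy b0 mT (smsub S r); lra.
apply: le_trans (lerD (tv_sub _ _) (lexx _)); apply: le_trans (tv_sub _ _).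
apply: tv_le => A mA; have mA' := measurableC mA.
apply: le_trans (tv_ge _ mA mA').
have E B : measurable B -> mval (smsub (smsub r (L r)) v) B =
   mval (smsub (smsub (L (smsub S r)) (smsub S r)) (iter M L v)) B.
  move=> mB; rewrite !mval_sub// noisy_sub// /S noisy_neumann// mval_neumann//.
  have -> : \sum_(n < M) mval (iter n.+1 L v) B =
     \sum_(n < M) mval (iter n L v) B + mval (iter M L v) B - mval v B.
    have h1 : \sum_(n < M.+1) mval (iter n L v) B =
      \sum_(n < M) mval (iter n L v) B + mval (iter M L v) B by rewrite big_ord_recr.
    have h2 : \sum_(n < M.+1) mval (iter n L v) B =
      mval v B + \sum_(n < M) mval (iter n.+1 L v) B by rewrite big_ord_recl.
    by rewrite -h1 h2 addrC addKr.
  lra.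
by rewrite !E.
Qed.

End resolvent.

(** * Doeblin minorization *)
Section minorization.
Context {R : realType}.
Implicit Types (X Y : signed_measure R) (A B : set (MR R)).

Definition nonneg_measure X := forall A, measurable A -> 0 <= mval X A.

Lemma nonneg_measure_le X A B : nonneg_measure X -> measurable A -> measurable B -> A `<=` B ->
  mval X A <= mval X B.
Proof.
move=> X0 mA mB AB; rewrite -subr_ge0 -mvalD//; apply: X0; exact: measurableD.
Qed.

Lemma nonneg_charge_of (m : {finite_measure set (MR R) -> \bar R}) : nonneg_measure (charge_of m).
Proof. by move=> A mA; exact: mval_ge0. Qed.

Lemma nonneg_rconv b X : 0 < b -> nonneg_measure X -> nonneg_measure (rconv (uniform_noise b) X).
Proof.
move=> b0 X0 A mA; rewrite mval_rconv// mulr_ge0 ?invr_ge0 ?(ltW b0)//.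
by apply: Rintegral_ge0 => t _; apply: X0; exact: measurable_window.
Qed.

Lemma nonneg_transfer T X : mfun01 T -> nonneg_measure X -> nonneg_measure (transfer T X).
Proof.
by move=> mT X0 A mA; rewrite mval_transfer//; apply: X0; exact: measurable_transfer_preimage.
Qed.

Let leb01_fin : (leb (unit_itv R) < +oo :> \bar R)%E.
Proof. by rewrite lebesgue_measure_itv/= lte_fin ltr01 -EFinB ltry. Qed.

Definition leb01 : {finite_measure set (MR R) -> \bar R} := mfrestr measurable_unit_itv leb01_fin.

Lemma mval_leb01 A : mval (charge_of leb01) A = fine (leb (A `&` unit_itv R) : \bar R).
Proof. by []. Qed.

Lemma leb01_setT : mval (charge_of leb01) setT = 1.
Proof.
by rewrite mval_leb01 setTI lebesgue_measure_itv/= lte_fin ltr01 -EFinB/= subr0.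
Qed.

Definition leb01_restr J (mJ : measurable J) : signed_measure R := crestr0 (charge_of leb01) mJ.

Lemma mval_leb01_restr J (mJ : measurable J) A : measurable A ->
  mval (leb01_restr mJ) A = mval (charge_of leb01) (A `&` J).
Proof. exact: mval_crestr0. Qed.

Lemma rconv_ge b X c D A : 0 < b -> nonneg_measure X -> measurable D -> measurable A ->
  D `<=` (fold01 : MR R -> MR R) @^-1` A -> (leb D < +oo :> \bar R)%E -> 0 <= c ->
  (forall t, D t -> c <= mval X (window (- (b / 2)) (b / 2) t)) ->
  b^-1 * c * fine (leb D : \bar R) <= mval (rconv (uniform_noise b) X) A.
Proof.
move=> b0 X0 mD mA DA Doo c0 hc; rewrite mval_rconv// -mulrA.
rewrite ler_pM2l ?invr_gt0//.
have mB := measurable_preimage_fold01 mA.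
have iX : leb.-integrable setT
    (EFin \o (fun t : MR R => mval X (window (- (b / 2)) (b / 2) t))).
  by apply: integrable_signed_window; lra.
apply: (@le_trans _ _ (\int[leb]_(t in D) mval X (window (- (b / 2)) (b / 2) t))).
  rewrite -Rintegral_cst//; apply: le_Rintegral => //.
    apply: measurable_bounded_integrable => //.
    exists `|c|; split; first exact: num_real.
    by move=> x Mx y _; exact: ltW.
  exact: integrable_sub.
rewrite -[in leRHS](setDUK DA) Rintegral_setU//.
- rewrite lerDl; apply: Rintegral_ge0 => t _; apply: X0; exact: measurable_window.
- exact: measurableD.
- by rewrite setDUK//; exact: integrable_sub.
- by apply/disj_setPS; rewrite setDE setICA setICr setI0.
Qed.

(** For a nonnegative X this says that y lies in its topological support. *)
Definition charges_nbhs X (y : R) := forall e : R, 0 < e ->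
  0 < mval X `]y - e, y + e[%classic.

(** The finite exceptional set leaves room for the images of the points where T may be
    discontinuous, from which charged neighbourhoods need not be carried along. *)
Definition almost_full_support X := exists2 Z : set R, finite_set Z &
  forall y : R, unit_itv R y -> ~ Z y -> charges_nbhs X y.

Lemma itv_not_finite (c d : R) (Z : set R) : finite_set Z -> c < d ->
  exists y, [/\ c < y, y < d & ~ Z y].
Proof.
move=> fZ cd; apply: contrapT => h.
have : `]c, d[%classic `<=` Z.
  move=> y /=; rewrite in_itv/= => /andP[cy yd]; apply: contrapT => Zy.
  by apply: h; exists y.
move=> /sub_finite_set /(_ fZ) /finite_set_countable.
move=> /countable_lebesgue_measure0.
rewrite lebesgue_measure_itv/= lte_fin cd -EFinB => -[].
by move/eqP; rewrite subr_eq0 gt_eqF.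
Qed.

(** Take the maximum of the thresholds and the minimum of the constants. The maximum is admissible
    because each bound is assumed for all n beyond its threshold, not for a single n. *)
Lemma uniform_lower_bound K (Q : nat -> nat -> R -> Prop) :
  (forall j n e e', 0 < e' -> e' <= e -> Q j n e -> Q j n e') ->
  (forall j, (j < K)%N -> exists n0, forall n, (n0 <= n)%N ->
     exists2 e, 0 < e & Q j n e) ->
  exists n0, forall n, (n0 <= n)%N ->
     exists2 e, 0 < e & forall j, (j < K)%N -> Q j n e.
Proof.
move=> mono; elim: K => [|K IH] h; first by exists 0%N => n _; exists 1.
have [|n1 h1] := IH; first by move=> j jK; apply: h; exact: ltnW.
have [n2 h2] := h K (ltnSn K).
exists (maxn n1 n2) => n; rewrite geq_max => /andP[/h1 [e1 e10 q1] /h2 [e2 e20 q2]].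
exists (Num.min e1 e2); first by rewrite lt_min e10.
move=> j; rewrite ltnS leq_eqVlt => /predU1P[->|jK].
  by apply: mono q2; rewrite ?lt_min ?e10// ge_min lexx orbT.
by apply: mono (q1 j jK); rewrite ?lt_min ?e10// ge_min lexx.
Qed.

(** With cells shorter than b / 2, the noise window of a point contains the interior of the grid
    cell around it. *)
Lemma grid_mesh (b : R) : 0 < b -> exists K, (0 < K)%N /\ K%:R^-1 < b / 2.
Proof.
move=> b0; exists (Num.bound (b / 2)^-1).+1; split=> //.
have b2 : 0 < b / 2 by rewrite divr_gt0.
rewrite invf_plt ?posrE//.
apply: (lt_le_trans (archi_boundP _)); first by rewrite invr_ge0 ltW.
by rewrite ler_nat.
Qed.

Lemma grid_point K (t : R) : (0 < K)%N -> unit_itv R t -> exists2 j, (j < K)%N &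
  j%:R / K%:R <= t <= j.+1%:R / K%:R.
Proof.
move=> K0; rewrite /= in_itv/= => /andP[t0 t1].
have K0' : 0 < K%:R :> R by rewrite ltr0n.
pose P j := (j < K)%N && (j%:R / K%:R <= t).
have exP : exists j, P j by exists 0%N; rewrite /P K0 mul0r.
have ubP j : P j -> (j <= K)%N by move=> /andP[/ltnW].
case: (ex_maxnP exP ubP) => j /andP[jK jt] jmax; exists j => //.
rewrite jt /=; have [jK1|jK1] := ltnP j.+1 K.
  rewrite leNgt; apply/negP => /ltW tj; have Pj : P j.+1 by rewrite /P jK1.
  by have := jmax _ Pj; rewrite ltnn.
have -> : j.+1 = K by apply/eqP; rewrite eqn_leq jK.
by rewrite divff ?gt_eqF.
Qed.

Context (b : R) (T : R -> R) (E : set R).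
Hypotheses (b0 : 0 < b) (mT : mfun01 T)
  (TU : set_fun (unit_itv R) (unit_itv R) T) (fE : finite_set E)
  (Tcont : forall x : R, unit_itv R x -> ~ E x -> forall e : R, 0 < e ->
     exists2 d : R, 0 < d & forall x' : R, `|x' - x| < d ->
       unit_itv R x' /\ `|T x' - T x| < e)
  (Tcov : covering T).

Local Notation L := (noisy_transfer b T).

Lemma nonneg_noisy X : nonneg_measure X -> nonneg_measure (L X).
Proof. by move=> X0; apply: nonneg_rconv => //; exact: nonneg_transfer. Qed.

Lemma nonneg_iter_noisy n X : nonneg_measure X -> nonneg_measure (iter n L X).
Proof. by move=> X0; elim: n => //= n; exact: nonneg_noisy. Qed.

(** Apply [covering] to ]0,1[. The exponent cannot be 0, since ]0,1[ is not [0,1]; hence every y is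
    the image of a point under a last application of T. *)
Lemma covering_onto (y : R) : unit_itv R y -> exists2 x, unit_itv R x & T x = y.
Proof.
move=> Uy; have [n] := Tcov (lexx 0) ltr01 (lexx 1).
case: n => [|n] h.
  have : unit_itv R 0 by rewrite /= in_itv/= lexx ler01.
  by rewrite -h => -[x /=]; rewrite in_itv/= => /andP[x0 _] x00; rewrite x00 ltxx in x0.
move: Uy; rewrite -{1}h => -[x Jx] /= <-; exists (iter n T x) => //.
have Ux : unit_itv R x.
  by move: Jx; rewrite /= !in_itv/= => /andP[/ltW -> /ltW ->].
by elim: n {h} => //= n; exact: TU.
Qed.

Lemma charges_nbhs_transfer X (x : R) : nonneg_measure X -> unit_itv R x -> ~ E x -> charges_nbhs X x ->
  charges_nbhs (transfer T X) (T x).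
Proof.
move=> X0 Ux Ex Xx e e0; rewrite mval_transfer//.
have [d d0 hd] := Tcont Ux Ex e0.
apply: (lt_le_trans (Xx _ d0)); apply: nonneg_measure_le => //.
  by apply: measurable_transfer_preimage => //; exact: measurable_itv.
move=> x' /=; rewrite in_itv/= => /andP[h1 h2].
have [|Ux'] := hd x'; first by rewrite ltr_norml; apply/andP; split; lra.
by rewrite distrC ltr_distlC => hT; split=> //=; rewrite in_itv/=.
Qed.

Lemma charges_nbhs_rconv X (y : R) : nonneg_measure X -> unit_itv R y -> charges_nbhs X y ->
  charges_nbhs (rconv (uniform_noise b) X) y.
Proof.
(* The bound e' <= e keeps the folded points within e of y, since folding is nonexpansive and fixes
   y. The bound e' <= b / 4 puts the whole e'-neighbourhood of y inside the noise window of each of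
   its points. *)
move=> X0 Uy Xy e e0; pose e' := Num.min e (b / 4).
have e'0 : 0 < e' by rewrite lt_min e0 divr_gt0.
have e'e : e' <= e by rewrite ge_min lexx.
have e'b : e' <= b / 4 by rewrite ge_min lexx orbT.
have lD : leb (`]y - e', y + e'[%classic : set (MR R)) = (e' + e')%:E :> \bar R.
  by rewrite lebesgue_measure_itv/= lte_fin ifT ?ltrD2l ?gtrN// -EFinB; congr EFin; lra.
apply: (@lt_le_trans _ _ (b^-1 * mval X `]y - e', y + e'[%classic *
    fine (leb (`]y - e', y + e'[%classic : set (MR R)) : \bar R))).
  by rewrite lD /= !mulr_gt0 ?invr_gt0 ?addr_gt0//; exact: Xy.
apply: rconv_ge => //; try exact: measurable_itv.
- move=> t /=; rewrite !in_itv/= -ltr_distlC => ty; rewrite -ltr_distlC.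
  rewrite -{1}(fold01_id Uy); apply: le_lt_trans (fold01_lipschitz _ _) _.
  exact: lt_le_trans ty e'e.
- by rewrite lD ltry.
- by apply/ltW/Xy.
- move=> t; rewrite /= in_itv/= => /andP[h1 h2]; apply: nonneg_measure_le => //.
  + exact: measurable_window.
  + by move=> x /=; rewrite /window /= !in_itv/= => /andP[h3 h4]; apply/andP; split; lra.
Qed.

Lemma almost_full_support_transfer X : nonneg_measure X -> almost_full_support X -> almost_full_support (transfer T X).
Proof.
move=> X0 [Z fZ hZ]; exists (T @` (Z `|` E)).
  by apply: finite_image; rewrite finite_setU.
move=> y Uy Zy; have [x Ux Txy] := covering_onto Uy; rewrite -Txy.
have nZ : ~ (Z `|` E) x by move=> h; apply: Zy; exists x.
apply: charges_nbhs_transfer => //; first by move=> h; apply: nZ; right.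
by apply: hZ => // h; apply: nZ; left.
Qed.

Lemma almost_full_support_noisy X : nonneg_measure X -> almost_full_support X -> almost_full_support (L X).
Proof.
move=> X0 /(almost_full_support_transfer X0)[Z fZ hZ]; exists Z => // y Uy Zy.
by apply: charges_nbhs_rconv => //; [exact: nonneg_transfer|exact: hZ].
Qed.

(** Every open grid cell contains a non-exceptional point, hence has positive mass after the
    transfer, and finitely many cells have a positive minimum. Each noise window centred in [0,1]
    contains a cell, so the new density is bounded below on all of [0,1]. *)
Lemma minorization_full_support X : nonneg_measure X -> almost_full_support X -> exists2 e : R, 0 < e &
  forall A, measurable A -> e * mval (charge_of leb01) A <= mval (L X) A.
Proof.
move=> X0 /(almost_full_support_transfer X0)[Z fZ hZ].
have X'0 := nonneg_transfer mT X0; set X' := transfer T X in hZ X'0.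
have [K [K0 Kb]] := grid_mesh b0.
have K0' : 0 < K%:R :> R by rewrite ltr0n.
pose I j : set (MR R) := `]j%:R / K%:R, j.+1%:R / K%:R[%classic.
have mI j : measurable (I j) by exact: measurable_itv.
have h j : (j < K)%N -> 0 < mval X' (I j).
  move=> jK; have [|y [y1 y2 Zy]] := @itv_not_finite (j%:R / K%:R) (j.+1%:R / K%:R) Z fZ.
    by rewrite ltr_pM2r ?invr_gt0// ltr_nat.
  have Uy : unit_itv R y.
    rewrite /= in_itv/=; apply/andP; split.
      by apply: le_trans (ltW y1); rewrite divr_ge0.
    by apply: le_trans (ltW y2) _; rewrite ler_pdivrMr// mul1r ler_nat.
  pose d := Num.min (y - j%:R / K%:R) (j.+1%:R / K%:R - y).
  have d0 : 0 < d by rewrite lt_min !subr_gt0 y1.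
  have d1 : d <= y - j%:R / K%:R by rewrite ge_min lexx.
  have d2 : d <= j.+1%:R / K%:R - y by rewrite ge_min lexx orbT.
  apply: (lt_le_trans (hZ y Uy Zy d d0)); apply: nonneg_measure_le => //.
  move=> x; rewrite /I /= !in_itv/= => /andP[h1 h2]; apply/andP; split; lra.
have [||n0 h0] := @uniform_lower_bound K (fun j _ e => e <= mval X' (I j)).
- by move=> j _ e e' _; exact: le_trans.
- by move=> j /h hj; exists 0%N => _ _; exists (mval X' (I j)).
have [e e0 he] := h0 n0 (leqnn _).
exists (b^-1 * e); first by rewrite mulr_gt0 ?invr_gt0.
move=> A mA; rewrite mval_leb01; apply: rconv_ge => //.
- by apply: measurableI.
- by move=> t [At Ut] /=; rewrite fold01_id.
- apply: le_lt_trans leb01_fin; apply: le_measure; rewrite ?inE//.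
  by apply: measurableI.
- exact: ltW.
- move=> t [_ Ut]; have [j jK /andP[j1 j2]] := grid_point K0 Ut.
  apply: le_trans (he j jK) _; apply: nonneg_measure_le => //; first exact: measurable_window.
  have jE : j.+1%:R / K%:R = j%:R / K%:R + K%:R^-1 :> R.
    by rewrite -addn1 natrD mulrDl mul1r.
  rewrite jE in j2; move=> x; rewrite /I /window /= !in_itv/= jE => /andP[x1 x2].
  by apply/andP; split; lra.
Qed.

(** Orbits starting in J carry the mass: T moves a charged point to a charged point where it is
    continuous, and the noise keeps it charged. Once T^n J = [0,1], all but finitely many points are
    charged; this persists under [L], and one more step turns it into a minorization. *)
Lemma minorization_interval (c d : R) (mJ : measurable (`]c, d[%classic : set (MR R))) :
  0 <= c -> c < d -> d <= 1 ->
  exists n0, forall n, (n0 <= n)%N -> exists2 e : R, 0 < e &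
    forall A, measurable A -> e * mval (charge_of leb01) A <= mval (iter n L (leb01_restr mJ)) A.
Proof.
move=> c0 cd d1; have [n hn] := Tcov c0 cd d1.
have l0 : nonneg_measure (leb01_restr mJ).
  by move=> A mA; rewrite mval_leb01_restr//; apply: mval_ge0.
have itU x : `]c, d[%classic x -> forall k, unit_itv R (iter k T x).
  move=> Jx k; elim: k => [|k IH]; last exact: TU.
  by move: Jx; rewrite /= !in_itv/= => /andP[h1 h2]; apply/andP; split; lra.
have base x : `]c, d[%classic x -> charges_nbhs (leb01_restr mJ) x.
  rewrite /= in_itv/= => /andP[cx xd] e e0; rewrite mval_leb01_restr; last exact: measurable_itv.
  rewrite mval_leb01.
  pose d' := Num.min e (Num.min (x - c) (d - x)).
  have d'0 : 0 < d' by rewrite !lt_min e0 !subr_gt0 cx xd.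
  have d'e : d' <= e by rewrite ge_min lexx.
  have d'c : d' <= x - c by rewrite !ge_min lexx orbT.
  have d'd : d' <= d - x by rewrite !ge_min lexx !orbT.
  apply: (@lt_le_trans _ _ (fine (leb (`]x - d', x + d'[%classic : set (MR R)) : \bar R))).
    rewrite lebesgue_measure_itv/= lte_fin ifT; last by lra.
    by rewrite -EFinB/=; lra.
  have mI : measurable (`]x - e, x + e[%classic `&` `]c, d[%classic `&` unit_itv R : set (MR R)).
    by apply: measurableI; [apply: measurableI|]; exact: measurable_itv.
  apply: fine_le.
  - by rewrite lebesgue_measure_itv/=; case: ifP => //.
  - rewrite ge0_fin_numE//; apply: le_lt_trans leb01_fin.
    by apply: le_measure; rewrite ?inE.
  - apply: le_measure; rewrite ?inE//.
    move=> y /=; rewrite !in_itv/= => /andP[h1 h2]; repeat split; apply/andP; split; lra.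
(* The set Z depends on k but not on x: at each step it becomes the image of its union with E. An
   orbit that meets it is given up. *)
have step k : exists2 Z : set R, finite_set Z & forall x, `]c, d[%classic x ->
    Z (iter k T x) \/ charges_nbhs (iter k L (leb01_restr mJ)) (iter k T x).
  elim: k => [|k [Z fZ hZ]].
    by exists set0 => // x Jx; right; exact: base.
  exists (T @` (Z `|` E)); first by apply: finite_image; rewrite finite_setU.
  move=> x Jx; have [h|h] := pselect ((Z `|` E) (iter k T x)).
    by left; exists (iter k T x).
  right; apply: charges_nbhs_rconv => //.
  - by apply: nonneg_transfer => //; exact: nonneg_iter_noisy.
  - exact: (itU x Jx k.+1).
  - apply: charges_nbhs_transfer; [exact: nonneg_iter_noisy|exact: itU| |].
      by move=> h'; apply: h; right.
    by have [h'|//] := hZ x Jx; exfalso; apply: h; left.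
have full k : almost_full_support (iter (k + n) L (leb01_restr mJ)).
  elim: k => [|k IH]; last by apply: almost_full_support_noisy => //; exact: nonneg_iter_noisy.
  have [Z fZ hZ] := step n; exists Z => // y.
  by rewrite -hn => -[x Jx <-] Zy; have [|//] := hZ x Jx.
exists n.+1 => -[//|m]; rewrite ltnS => nm.
have := full (m - n)%N; rewrite subnK// => /minorization_full_support; apply.
exact: nonneg_iter_noisy.
Qed.

Lemma pigeonhole X K : nonneg_measure X -> on01 X -> (0 < K)%N -> exists2 j, (j < K)%N &
  mval X setT / K%:R <= mval X `[j%:R / K%:R, j.+1%:R / K%:R]%classic.
Proof.
move=> X0 /on01P X01 K0; apply: contrapT => h.
have K0' : 0 < K%:R :> R by rewrite ltr0n.
have hlt j : (j < K)%N -> mval X `[j%:R / K%:R, j.+1%:R / K%:R]%classic < mval X setT / K%:R.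
  by move=> jK; rewrite ltNge; apply/negP => hj; apply: h; exists j.
have mI (i : interval R) : measurable ([set` i] : set (MR R)) by exact: measurable_itv.
(* Closed cells share endpoints, so their masses only bound the mass of the union from above; the
   contradiction needs this direction. *)
have sumP j : (j.+1 <= K)%N -> mval X `[0, j.+1%:R / K%:R]%classic < j.+1%:R * (mval X setT / K%:R).
  elim: j => [|j IH] jK.
    by have := hlt 0%N jK; rewrite mul0r !mul1r.
  have := IH (ltnW jK); have := hlt j.+1 jK.
  have : mval X `[0, j.+2%:R / K%:R]%classic <= mval X `[0, j.+1%:R / K%:R]%classic +
     mval X `[j.+1%:R / K%:R, j.+2%:R / K%:R]%classic.
    apply: (@le_trans _ _ (mval X (`[0, j.+1%:R / K%:R]%classic `|` `]j.+1%:R / K%:R, j.+2%:R / K%:R]%classic))).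
      apply: nonneg_measure_le => //; first exact: measurableU.
      move=> x /=; rewrite !in_itv/= => /andP[x0 x1]; rewrite x0 x1 andbT /=.
      by have [|] := leP x (j.+1%:R / K%:R); [left|right].
    rewrite mvalU//; last first.
      apply/seteqP; split=> x //= []; rewrite !in_itv/= => /andP[_ h1] /andP[h2 _].
      by move: (le_lt_trans h1 h2); rewrite ltxx.
    rewrite lerD2l; apply: nonneg_measure_le => // x /=; rewrite !in_itv/= => /andP[/ltW -> ->//].
  rewrite -[j.+2]addn1 natrD mulrDl mul1r; lra.
have := sumP K.-1; rewrite prednK// => /(_ (leqnn _)).
have Kn : K%:R != 0 :> R by rewrite gt_eqF.
have := X01 _ measurableT; rewrite setTI => <-.
by rewrite divff// mulrC divfK// ltxx.
Qed.

(** One step reduces arbitrary X to K starting measures: by the pigeonhole principle some cell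
    carries at least 1/K of the mass of [transfer T X], and cells are shorter than b / 2, so [L X]
    dominates a multiple of Lebesgue measure on that cell. From there the lower bound evolves
    independently of X, and finitely many cells share one N and one constant. *)
Lemma doeblin : exists N, exists2 e : R, 0 < e & forall X, nonneg_measure X -> on01 X ->
  forall A, measurable A -> e * mval X setT * mval (charge_of leb01) A <= mval (iter N L X) A.
Proof.
have [K [K0 Kb]] := grid_mesh b0.
have K0' : 0 < K%:R :> R by rewrite ltr0n.
pose J j : set (MR R) := `]j%:R / K%:R, j.+1%:R / K%:R[%classic.
have mJ j : measurable (J j) by exact: measurable_itv.
have [||n0 h0] := @uniform_lower_bound K (fun j n e => forall A, measurable A ->
    e * mval (charge_of leb01) A <= mval (iter n L (leb01_restr (mJ j))) A).
- move=> j n e e' e'0 e'e h A mA; apply: le_trans (h A mA).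
  by rewrite ler_wpM2r// mval_ge0.
- move=> j jK; apply: minorization_interval.
  + by rewrite divr_ge0.
  + by rewrite ltr_pM2r ?invr_gt0// ltr_nat.
  + by rewrite ler_pdivrMr// mul1r ler_nat.
have [e e0 he] := h0 n0 (leqnn _).
(* The extra iterate and the factor b^-1 / K account for the step that produces Lebesgue measure on
   a cell. *)
exists n0.+1, (e * (b^-1 / K%:R)); first by rewrite !mulr_gt0 ?invr_gt0.
move=> X X0 X01 A mA.
have [j jK hj] := pigeonhole (nonneg_transfer mT X0) (on01_transfer X mT TU) K0.
rewrite mass_transfer// in hj.
pose c := b^-1 * (mval X setT / K%:R).
have c0 : 0 <= mval X setT / K%:R by rewrite divr_ge0// X0.
have LX B : measurable B -> mval (smscale c (leb01_restr (mJ j))) B <= mval (L X) B.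
  move=> mB; rewrite mval_scale// mval_leb01_restr// mval_leb01.
  have mD : measurable (B `&` J j `&` unit_itv R).
    by apply: measurableI; [exact: measurableI|exact: measurable_unit_itv].
  apply: rconv_ge => //.
  - exact: nonneg_transfer.
  - by move=> t [[Bt _] Ut] /=; rewrite fold01_id.
  - by apply: le_lt_trans leb01_fin; apply: le_measure; rewrite ?inE//; exact: measurable_unit_itv.
  - move=> t [[_ Jt] _]; apply: le_trans hj _; apply: nonneg_measure_le.
    + exact: nonneg_transfer.
    + exact: measurable_itv.
    + exact: measurable_window.
    + have jE : j.+1%:R / K%:R = j%:R / K%:R + K%:R^-1 :> R.
        by rewrite -addn1 natrD mulrDl mul1r.
      move: Jt; rewrite /J /= jE in_itv/= => /andP[t1 t2] x.
      by rewrite /window /= !in_itv/= => /andP[x1 x2]; apply/andP; split; lra.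
rewrite iterSr; apply: le_trans (iter_noisy_le b0 mT n0 mA LX).
rewrite iter_noisy_scale// (_ : e * _ * _ * _ = c * (e * mval (charge_of leb01) A)).
  by rewrite ler_wpM2l ?he// mulr_ge0// invr_ge0 ltW.
by rewrite /c; ring.
Qed.

Lemma on01_jordan (w : signed_measure R) : on01 w -> on01 (charge_of (pos_part w)) /\ on01 (charge_of (neg_part w)).
Proof.
move=> /on01P w01; have [P [mP pP nP]] := jordan_set w.
split; apply/on01P => A mA; have mI : measurable (A `&` unit_itv R) by
    (apply: measurableI => //; exact: measurable_unit_itv).
  by rewrite !pP// setIAC w01//; exact: measurableI.
rewrite !nP// setIAC w01//; apply: measurableI => //; exact: measurableC.
Qed.

(** The Jordan parts of a zero-average w have equal mass, so after N steps both dominate the same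
    multiple of Lebesgue measure, and this common part cancels in the difference. The minimum with 1
    keeps 1 - e nonnegative for the powers taken later. *)
Lemma contraction : exists N, exists e : R, [/\ 0 < e, e <= 1 &
  forall w : signed_measure R, zero_average w ->
    tv (iter N L w) <= (1 - e) * tv w].
Proof.
have [N [e0 e00 he0]] := doeblin.
pose e := Num.min e0 1.
have e_gt0 : 0 < e by rewrite lt_min e00 ltr01.
exists N, e; split=> //; first by rewrite ge_min lexx orbT.
move=> w /zero_averageP[w01 w0]; have [p01 n01] := on01_jordan w01.
pose X := charge_of (pos_part w); pose Y := charge_of (neg_part w).
have XY : mval X setT = mval Y setT.
  by apply/eqP; rewrite -subr_eq0 -mval_jordan// w0.
have tvE : tv w = mval X setT + mval X setT by rewrite {2}XY.
have he Z A : nonneg_measure Z -> on01 Z -> measurable A ->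
    e * mval Z setT * mval (charge_of leb01) A <= mval (iter N L Z) A.
  move=> Z0 Z01 mA; apply: le_trans (he0 Z Z0 Z01 A mA).
  rewrite ler_wpM2r ?mval_ge0// ler_wpM2r ?Z0//.
  by rewrite ge_min lexx.
apply: tv_le => A mA; have mA' := measurableC mA.
have E' B : measurable B -> mval (iter N L w) B = mval (iter N L X) B - mval (iter N L Y) B.
  move=> mB; rewrite -iter_noisy_sub//; move: B mB; apply/sm_eqP; apply: iter_noisy_eq => //.
  by apply/sm_eqP => B mB; rewrite mval_sub// -mval_jordan.
(* Since X and Y keep equal masses m, the quantity to bound is twice the difference of their images
   on A. The bound for X on the complement of A limits its image on A from above, the one for Y on A
   limits from below, and the Lebesgue terms leave m - e m. *)
have pA := he X _ (nonneg_charge_of _) p01 mA'.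
have qA := he Y _ (nonneg_charge_of _) n01 mA.
have pT := mass_iter_noisy b0 mT N p01; have qT := mass_iter_noisy b0 mT N n01.
rewrite !E'// mvalC// in pA *; rewrite [mval (charge_of leb01) _]mvalC// leb01_setT in pA.
rewrite !(mvalC _ mA) pT qT tvE -/X -/Y -XY in pA qA *.
nra.
Qed.

End minorization.

(** * Continuity of piecewise smooth maps off the ends of the pieces *)

Section piecewise.
Context {R : realType} (T : R -> R) (TC2 : piecewise_C2 T).

Lemma derivable_cvg (f : R -> R) (x : R) : derivable f x 1 -> f @ x --> f x.
Proof. by move=> /derivable1_diffP /differentiable_continuous. Qed.

Lemma piecewise_C2_mfun : mfun01 T.
Proof.
have [n [I [h [Iitv tI UI hI]]]] := TC2.
have mIi i : measurable (I i : set (MR R)) by exact: is_interval_measurable.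
move=> _ A mA; rewrite -UI setI_bigcupl.
apply: fin_bigcup_measurable => //= i _.
have [[dh _ _] _ Th] := hI i.
rewrite (_ : _ `&` _ = I i `&` h i @^-1` A); last first.
  by apply/seteqP; split=> x [Ix /=]; rewrite Th ?inE.
have : measurable_fun setT (h i : MR R -> MR R).
  by apply: continuous_measurable_fun => x; exact: derivable_cvg.
by move=> /(measurable_funTS (D := I i)) /(_ (mIi i) _ mA).
Qed.

Definition piece_ends (E : set R) := finite_set E /\
  forall x : R, unit_itv R x -> ~ E x -> forall e : R, 0 < e ->
     exists2 d : R, 0 < d & forall x' : R, `|x' - x| < d ->
       unit_itv R x' /\ `|T x' - T x| < e.

(** Away from the infima and suprema of the pieces, a point of [0,1] lies strictly between two
    points of its piece, so T coincides near it with one smooth function. The ends 0 and 1 are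
    excluded as well, being extremal in the pieces that contain them. *)
Lemma piecewise_C2_ends : exists E, piece_ends E.
Proof.
have [n [I [h [Iitv tI UI hI]]]] := TC2.
exists ([set inf (I i) | i in [set: 'I_n]] `|` [set sup (I i) | i in [set: 'I_n]]).
split; first by rewrite finite_setU; split; apply: finite_image; exact: finite_finset.
move=> x; rewrite -{1}UI => -[i _ Ix] nE e e0.
have IU y : I i y -> unit_itv R y by move=> Iy; rewrite -UI; exists i.
have lbI : has_lbound (I i).
  by exists 0 => y /IU /=; rewrite in_itv/= => /andP[].
have ubI : has_ubound (I i).
  by exists 1 => y /IU /=; rewrite in_itv/= => /andP[].
have I0 : I i !=set0 by exists x.
have [y Iy yx] : exists2 y, I i y & y < x.
  apply: inf_lt => //; rewrite lt_neqAle ge_inf// andbT.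
  by apply/eqP => E; apply: nE; left; exists i.
have [z Iz xz] : exists2 z, I i z & x < z.
  apply: sup_gt => //; rewrite lt_neqAle ub_le_sup// andbT.
  by apply/eqP => E; apply: nE; right; exists i.
have [[dh _ _] _ Th] := hI i.
have /cvgrPdist_lt /(_ e e0) := derivable_cvg (dh x).
move=> /nbhs_ballP[d /= d0 hd].
exists (Num.min d (Num.min (x - y) (z - x))).
  by rewrite !lt_min d0 !subr_gt0 yx.
move=> x'; rewrite !lt_min => /andP[x1 /andP[x2 x3]].
have Ix' : I i x'.
  apply: (Iitv i y z) => //; move: x2 x3; rewrite !ltr_norml => /andP[? ?] /andP[? ?].
  by apply/andP; split; lra.
split; first exact: IU.
rewrite !Th ?inE// distrC; apply: hd.
by rewrite /ball/= distrC.
Qed.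

End piecewise.

(** * Densities of bounded variation *)
Section fold_density.
Context {R : realType}.
Implicit Types (X Y : signed_measure R) (A B : set (MR R)).

(** Jordan's form of bounded variation, stated on the whole line so that it survives the shifts and
    reflections produced by folding. *)
Definition monotone_difference (g : R -> R) := exists u1 u2 : R -> R,
  [/\ {homo u1 : x y / x <= y}, {homo u2 : x y / x <= y} &
      forall x, g x = u1 x - u2 x].

Lemma monotone_differenceD g h : monotone_difference g -> monotone_difference h -> monotone_difference (fun x => g x + h x).
Proof.
move=> [u1 [u2 [hu1 hu2 gE]]] [v1 [v2 [hv1 hv2 hE]]].
exists (fun x => u1 x + v1 x), (fun x => u2 x + v2 x); split.
- by move=> x y xy; rewrite lerD ?hu1 ?hv1.
- by move=> x y xy; rewrite lerD ?hu2 ?hv2.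
- by move=> x; rewrite gE hE; lra.
Qed.

Lemma monotone_difference_shift g c : monotone_difference g -> monotone_difference (fun x => g (x + c)).
Proof.
move=> [u1 [u2 [hu1 hu2 gE]]]; exists (fun x => u1 (x + c)), (fun x => u2 (x + c)).
by split=> [x y xy|x y xy|x]; rewrite ?gE// ?hu1 ?hu2// lerD2r.
Qed.

Lemma monotone_difference_reflect g c : monotone_difference g -> monotone_difference (fun x => g (c - x)).
Proof.
move=> [u1 [u2 [hu1 hu2 gE]]].
exists (fun x => - u2 (c - x)), (fun x => - u1 (c - x)); split.
- by move=> x y xy; rewrite lerN2 hu2// lerD2l lerN2.
- by move=> x y xy; rewrite lerN2 hu1// lerD2l lerN2.
- by move=> x; rewrite gE; lra.
Qed.

Lemma monotone_differenceZ g c : 0 <= c -> monotone_difference g -> monotone_difference (fun x => c * g x).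
Proof.
move=> c0 [u1 [u2 [hu1 hu2 gE]]].
exists (fun x => c * u1 x), (fun x => c * u2 x); split.
- by move=> x y xy; rewrite ler_wpM2l// hu1.
- by move=> x y xy; rewrite ler_wpM2l// hu2.
- by move=> x; rewrite gE mulrBr.
Qed.

Lemma monotone_differenceN g : monotone_difference g -> monotone_difference (fun x => - g x).
Proof.
move=> [u1 [u2 [hu1 hu2 gE]]]; exists u2, u1; split=> // x.
by rewrite gE opprB.
Qed.

Definition ray (t : R) : set (MR R) := `]-oo, t]%classic.

Lemma measurable_ray t : measurable (ray t).
Proof. exact: measurable_itv. Qed.

Definition cdf X (t : R) : R := mval X (ray t).

Lemma cdf_le (m : {finite_measure set (MR R) -> \bar R}) x y :
  x <= y -> cdf (charge_of m) x <= cdf (charge_of m) y.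
Proof.
move=> xy; apply: mval_le; try exact: measurable_ray.
by move=> z; rewrite /ray /= !in_itv/= => /le_trans; apply.
Qed.

Lemma mval_itv X x y : x <= y -> mval X `]x, y]%classic = cdf X y - cdf X x.
Proof.
move=> xy; rewrite /cdf -mvalD; try exact: measurable_ray.
  congr (mval X _); apply/seteqP; split=> z; rewrite /ray /= !in_itv/=.
    by move=> /andP[xz zy]; split=> //; rewrite leNgt xz.
  by move=> [-> /negP]; rewrite -ltNge => ->.
by move=> z; rewrite /ray /= !in_itv/= => /le_trans; apply.
Qed.

Lemma mval_window_cdf X u v t : u <= v -> mval X (window u v t) = cdf X (t - u) - cdf X (t - v).
Proof. by move=> uv; rewrite /window mval_itv// lerD2l lerN2. Qed.

Lemma cdf_jordan X t : cdf X t = cdf (charge_of (pos_part X)) t - cdf (charge_of (neg_part X)) t.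
Proof. by rewrite /cdf -mval_jordan//; exact: measurable_ray. Qed.

Lemma monotone_difference_cdf X : monotone_difference (cdf X).
Proof.
exists (cdf (charge_of (pos_part X))), (cdf (charge_of (neg_part X))).
by split=> [x y|x y|x]; [exact: cdf_le|exact: cdf_le|exact: cdf_jordan].
Qed.

Lemma Rintegral_diff1 (k : MR R -> R) A B (p : R) : measurable A -> measurable B ->
  A `<=` B -> B `\` A `<=` [set p] -> leb.-integrable B (EFin \o k) ->
  \int[leb]_(t in B) k t = \int[leb]_(t in A) k t.
Proof.
move=> mA mB AB BAp ik; have mD : measurable (B `\` A) by exact: measurableD.
rewrite -[in LHS](setDUK AB) Rintegral_setU//.
- by rewrite [X in _ + X](_ : _ = 0) ?addr0// /Rintegral (integral_Sset1 _ BAp).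
- by rewrite setDUK.
- by apply/disj_setPS; rewrite setDE setICA setICr setI0.
Qed.

Lemma on01_null X A : on01 X -> measurable A -> A `&` unit_itv R = set0 -> mval X A = 0.
Proof. by move=> /on01P X01 mA A0; rewrite -X01// A0 mval0. Qed.

(** On the period centred at 2i the folding map is t |-> |t - 2i|: its right half is a translate of
    [0,1] and its left half a reflected copy. *)
Lemma fold_period (k : MR R -> R) A (i : int) : measurable A ->
  leb.-integrable setT (EFin \o k) ->
  \int[leb]_(t in (fold01 : MR R -> MR R) @^-1` A `&`
     `[2 * i%:~R - 1, 2 * i%:~R + 1[%classic) k t =
  \int[leb]_(s in A `&` unit_itv R) (k (s + 2 * i%:~R) + k (2 * i%:~R - s)).
Proof.
move=> mA ik; set c := 2 * i%:~R.
have mI (j : interval R) : measurable ([set` j] : set (MR R)) by exact: measurable_itv.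
(* The half-open sets make the two branches disjoint: the centre goes to the translated branch, the
   left end to the reflected one, and the right end belongs to the next period. Each loses one point
   of [0,1], a null set. *)
pose D1 : set (MR R) := A `&` `[0, 1[%classic.
pose D2 : set (MR R) := A `&` `]0, 1]%classic.
have mD1 : measurable D1 by exact: measurableI.
have mD2 : measurable D2 by exact: measurableI.
have mAU : measurable (A `&` unit_itv R) by apply: measurableI => //; exact: measurable_unit_itv.
pose f1 : MR R -> MR R := fun t : R => t - c.
pose f2 : MR R -> MR R := fun t : R => c - t.
have mf1 : measurable_fun setT f1 by exact: measurable_translate.
have mf2 : measurable_fun setT f2 by exact: measurable_reflect.
have lf1 B : measurable B -> leb (f1 @^-1` B) = leb B :> \bar R by exact: lebesgue_translate.
have lf2 B : measurable B -> leb (f2 @^-1` B) = leb B :> \bar R by exact: lebesgue_reflect.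
have mg1 : measurable_fun setT ((fun s => s + c) : MR R -> MR R) by exact: measurable_translate.
have lg1 B : measurable B -> leb ((fun s : R => s + c) @^-1` B) = leb B :> \bar R.
  exact: lebesgue_translate.
have ik1 : leb.-integrable setT (EFin \o (fun s : MR R => k (s + c))).
  exact: (integrable_comp mg1 lg1 measurableT ik).
have ik2 : leb.-integrable setT (EFin \o (fun s : MR R => k (c - s))).
  exact: (integrable_comp mf2 lf2 measurableT ik).
have foldE (t : R) : c - 1 <= t -> t < c + 1 -> fold01 t = `|t - c|.
  by move=> h1 h2; apply: fold01_itv; rewrite -/c ler_norml; apply/andP; split; lra.
have -> : (fold01 : MR R -> MR R) @^-1` A `&` `[c - 1, c + 1[%classic =
    f1 @^-1` D1 `|` f2 @^-1` D2.
  apply/seteqP; split=> t.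
    move=> [/= At]; rewrite in_itv/= => /andP[h1 h2]; rewrite foldE// in At.
    have [tc|tc] := leP c t.
      left; split; first by rewrite ger0_norm ?subr_ge0// in At.
      by rewrite /f1 /= in_itv/=; apply/andP; split; lra.
    right; split; first by rewrite ltr0_norm ?subr_lt0// opprB in At.
    by rewrite /f2 /= in_itv/=; apply/andP; split; lra.
  move=> [[]|[]]; rewrite /f1 /f2 /= in_itv/= => At /andP[h1 h2].
    have ht : c - 1 <= t /\ t < c + 1 by split; lra.
    rewrite foldE; [|exact: ht.1|exact: ht.2]; rewrite ger0_norm//.
    by split=> //; rewrite in_itv/= ht.1 ht.2.
  have ht : c - 1 <= t /\ t < c + 1 by split; lra.
  rewrite foldE; [|exact: ht.1|exact: ht.2]; rewrite distrC gtr0_norm//.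
  by split=> //; rewrite in_itv/= ht.1 ht.2.
rewrite Rintegral_setU//; try exact: measurable_preimage; last first.
- apply/disj_setPS => t [[_]] ; rewrite /f1 /f2 /= !in_itv/= => /andP[h1 _] [_].
  by move=> /andP[]; rewrite bnd_simp => h2 _; exfalso; lra.
- by apply: integrable_sub => //; apply: measurableU; exact: measurable_preimage.
rewrite RintegralD//; try exact: integrable_sub.
congr (_ + _).
  rewrite [RHS](@Rintegral_diff1 _ D1 _ 1)//.
  - rewrite -[RHS](Rintegral_comp mf1 lf1 mD1); last exact: integrable_sub.
    by apply: eq_Rintegral => t _; rewrite /f1 subrK.
  - move=> t [At]; rewrite /= !in_itv/= => /andP[h1 h2].
    by split=> //; rewrite h1 ltW.
  - move=> t [[At]]; rewrite /= !in_itv/= => /andP[t0 t1] nD.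
    apply/eqP; rewrite eq_le t1 leNgt; apply/negP => t1'; apply: nD.
    by split=> //=; rewrite in_itv/= t0.
  - exact: integrable_sub.
rewrite [RHS](@Rintegral_diff1 _ D2 _ 0)//.
- rewrite -[RHS](Rintegral_comp mf2 lf2 mD2); last exact: integrable_sub.
  by apply: eq_Rintegral => t _; rewrite /f2 opprB addrC subrK.
- move=> t [At]; rewrite /= !in_itv/= => /andP[h1 h2].
  by split=> //; rewrite h2 ltW.
- move=> t [[At]]; rewrite /= !in_itv/= => /andP[t0 t1] nD.
  apply/eqP; rewrite eq_le t0 andbT leNgt; apply/negP => t1'; apply: nD.
  by split=> //=; rewrite in_itv/= t1'.
- exact: integrable_sub.
Qed.

(** The unfolded density is a difference of shifted distribution functions and has bounded support,
    so folding adds up finitely many shifted and reflected copies of it. *)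
Lemma rconv_density b X : 0 < b -> on01 X -> exists2 g : R -> R,
  monotone_difference g & has_density (rconv (uniform_noise b) X) g.
Proof.
move=> b0 X01; pose d (t : R) : R := b^-1 * mval X (window (- (b / 2)) (b / 2) t).
have [id dE] := density_uniform_noise X b0; rewrite -/d in id dE.
have dd : monotone_difference d.
  apply: monotone_differenceZ; first by rewrite invr_ge0 ltW.
  rewrite (_ : (fun _ => _) = fun t => cdf X (t + b / 2) + - cdf X (t + - (b / 2))).
    apply: monotone_differenceD; first exact/monotone_difference_shift/monotone_difference_cdf.
    by apply/monotone_differenceN/(@monotone_difference_shift (cdf X))/monotone_difference_cdf.
  by apply/funext => t; rewrite mval_window_cdf ?opprK//; lra.
(* The periods centred at -2K, ..., 2K cover every t whose window meets [0,1]. The number [l] is the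
   left end of the first one, and [C j] is the union of the first j. *)
pose K := Num.bound (1 + b).
have K1 : 1 + b < K%:R by apply: archi_boundP; lra.
pose l : R := 2 * (- K%:Z)%:~R - 1.
have lE : l = - (2 * K%:R) - 1 by rewrite /l intrN mulrN.
pose C (j : nat) : set (MR R) := `[l, l + 2 * j%:R[%classic.
have mC j : measurable (C j) by exact: measurable_itv.
have step j : exists g : R -> R, [/\ monotone_difference g,
    leb.-integrable (unit_itv R) (EFin \o g) & forall A, measurable A ->
    \int[leb]_(t in (fold01 : MR R -> MR R) @^-1` A `&` C j) d t =
    \int[leb]_(s in A `&` unit_itv R) g s].
  elim: j => [|j [g [dg ig gE]]].
    exists (fun=> 0); split.
    - by exists (fun=> 0), (fun=> 0); split=> //; move=> x; rewrite subrr.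
    - exact: integrable0.
    - move=> A mA; rewrite /C mulr0 addr0 set_itvco0 setI0 Rintegral_set0.
      by rewrite /Rintegral integral0.
  pose k : int := j%:Z - K%:Z.
  have kE : l + 2 * j%:R = 2 * k%:~R - 1 by rewrite lE /k intrB; lra.
  exists (fun s => g s + (d (s + 2 * k%:~R) + d (2 * k%:~R - s))).
  have i1 : leb.-integrable setT (EFin \o (fun s : MR R => d (s + 2 * k%:~R))).
    apply: (integrable_comp (measurable_translate _) _ measurableT id).
    exact: lebesgue_translate.
  have i2 : leb.-integrable setT (EFin \o (fun s : MR R => d (2 * k%:~R - s))).
    apply: (integrable_comp (measurable_reflect _) _ measurableT id).
    exact: lebesgue_reflect.
  have i12 : leb.-integrable (unit_itv R) (EFin \o (fun s : MR R => d (s + 2 * k%:~R) + d (2 * k%:~R - s))).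
    by apply: integrable_sub; [exact: measurable_unit_itv|exact: integrable_fctD].
  split.
  - by apply: monotone_differenceD => //; apply: monotone_differenceD; [exact: monotone_difference_shift|exact: monotone_difference_reflect].
  - by apply: integrable_fctD => //; exact: measurable_unit_itv.
  move=> A mA; have mP := measurable_preimage_fold01 mA.
  have mAU : measurable (A `&` unit_itv R) by apply: measurableI => //; exact: measurable_unit_itv.
  rewrite RintegralD//; first last.
  - exact: integrableS i12.
  - exact: integrableS ig.
  rewrite -gE// -fold_period// -Rintegral_setU//.
  - congr Rintegral; rewrite -setIUr; congr (_ `&` _).
    have kE' : l + 2 * j.+1%:R = 2 * k%:~R + 1 by rewrite -(natr1 j) mulrDr mulr1 addrA kE; lra.
    rewrite /C kE kE'; apply/seteqP; split=> t /=; rewrite !in_itv/=.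
      move=> /andP[h1 h2]; have [h3|h3] := ltP t (2 * k%:~R - 1); [left|right] => //.
      by rewrite h1.
    have j0 : 0 <= j%:R :> R by [].
    by move=> [|] /andP[h1 h2]; apply/andP; split; lra.
  - exact: measurableI.
  - by apply: measurableI => //; exact: measurable_itv.
  - by apply: integrable_sub => //; apply: measurableU; apply: measurableI => //; exact: measurable_itv.
  - apply/disj_setPS => t [[_]]; rewrite /C /= !in_itv/= kE => /andP[_ h1] [_] /andP[h2 _].
    by exfalso; lra.
have [g [dg ig gE]] := step (2 * K).+1.
exists g => //; split=> // A mA; rewrite mvalE//; have mP := measurable_preimage_fold01 mA.
have mAU : measurable (A `&` unit_itv R) by apply: measurableI => //; exact: measurable_unit_itv.
rewrite {1}/rconv mval_push dE//.
have -> : \int[leb]_(t in (fold01 : MR R -> MR R) @^-1` A) d t =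
    \int[leb]_(t in (fold01 : MR R -> MR R) @^-1` A `&` C (2 * K).+1) d t.
  rewrite -[in LHS](setUIDK ((fold01 : MR R -> MR R) @^-1` A) (C (2 * K).+1)).
  rewrite Rintegral_setU//.
  - rewrite [X in _ + X](_ : _ = 0) ?addr0// /Rintegral integral0_eq// => t [_ nC].
    congr EFin; rewrite /d on01_null ?mulr0//; first exact: measurable_window.
    apply/seteqP; split=> // x []; rewrite /window /= !in_itv/= => /andP[h1 h2] /andP[h3 h4].
    apply: nC; rewrite /C /= in_itv/= lE -(natr1 (2 * K)) natrM.
    by apply/andP; split; lra.
  - exact: measurableI.
  - exact: measurableD.
  - by rewrite setUIDK; exact: integrable_sub.
  - by apply/disj_setPS => t [[_ h] [_ h']].
rewrite gE// /Rintegral fineK//.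
by apply: integrable_fin_num => //; exact: integrableS ig.
Qed.

Lemma monotone_difference_TV (g : R -> R) : monotone_difference g -> (total_variation 0 1 g < +oo)%E.
Proof.
move=> [u1 [u2 [hu1 hu2 gE]]].
have -> : g = u1 \+ (\- u2) by apply/funext.
apply: le_lt_trans (total_variation_le _ _ ler01) _.
rewrite total_variationN !nondecreasing_total_variation//; last first.
- by move=> x y _ _; exact: hu1.
- by move=> x y _ _; exact: hu2.
by rewrite -EFinD ltry.
Qed.

Lemma norm_BV_lty X (g : R -> R) : monotone_difference g -> has_density X g -> (norm_BV X < +oo)%E.
Proof.
move=> dg hg; apply: (@le_lt_trans _ _
  (\int[leb]_(x in unit_itv R) `|g x|%:E + total_variation 0 1 g)%E).
  by apply: ereal_inf_lbound; exists g.
apply: lte_add_pinfty; last exact: monotone_difference_TV.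
by have [/integrableP[]] := hg.
Qed.

End fold_density.

(** * Total variation dominates the two norms *)

Section norm_bounds.
Context {R : realType}.
Implicit Types (X Y : signed_measure R) (A B : set (MR R)).

(** The nearest-point retraction onto [0,1]; composition with it extends a Lipschitz function from
    [0,1] to the line with the same constant. *)
Definition clamp (x : R) : R := Num.max 0 (Num.min 1 x).

Lemma clamp_in x : unit_itv R (clamp x).
Proof.
by rewrite /= in_itv/= /clamp le_max lexx /= ge_max ler01 ge_min lexx.
Qed.

Lemma clamp_id x : unit_itv R x -> clamp x = x.
Proof.
by rewrite /= in_itv/= => /andP[x0 x1]; rewrite /clamp min_r// max_r.
Qed.

Lemma clamp_lt0 x : x <= 0 -> clamp x = 0.
Proof. by move=> x0; rewrite /clamp min_r ?max_l//; lra. Qed.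

Lemma clamp_ge1 x : 1 <= x -> clamp x = 1.
Proof. by move=> x1; rewrite /clamp min_l// max_r. Qed.

Lemma clamp_le x y : x <= y -> clamp x <= clamp y.
Proof.
move=> xy; rewrite /clamp; have [x1|x1] := leP 1 x; have [y1|y1] := leP 1 y;
have [x0|x0] := leP 0 x; have [y0|y0] := leP 0 y; rewrite ?max_r ?max_l//; lra.
Qed.

Lemma clamp_dist x y : `|clamp x - clamp y| <= `|x - y|.
Proof.
wlog xy : x y / x <= y.
  by move=> h; have [/h//|/ltW/h] := leP x y; rewrite distrC [leRHS]distrC.
rewrite distrC [leRHS]distrC !ger0_norm ?subr_ge0 ?clamp_le//.
rewrite /clamp; have [x1|x1] := leP 1 x; have [y1|y1] := leP 1 y;
have [x0|x0] := leP 0 x; have [y0|y0] := leP 0 y; rewrite ?max_r ?max_l//; lra.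
Qed.

Lemma nonexpansive_continuous (f : R -> R) :
  (forall x y, `|f x - f y| <= `|x - y|) -> continuous f.
Proof.
move=> h x; apply/cvgrPdist_le => e e0.
have /cvgrPdist_le /(_ e e0) := @cvg_id _ (nbhs (x : R)).
by apply: filterS => y; exact: (le_trans (h _ _)).
Qed.

Lemma lipschitz_clamp (g : R -> R) : 1.-lipschitz_(unit_itv R) g ->
  forall x y, `|g (clamp x) - g (clamp y)| <= `|x - y|.
Proof.
move=> lg x y; apply: le_trans (clamp_dist x y).
rewrite -[leRHS]mul1r; apply: (lg (clamp x, clamp y)).
by split; exact: clamp_in.
Qed.

Lemma lipschitz_measurable (g : R -> R) : 1.-lipschitz_(unit_itv R) g ->
  measurable_fun (unit_itv R) (g : MR R -> MR R).
Proof.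
move=> /lipschitz_clamp/nonexpansive_continuous cg.
apply: (@eq_measurable_fun _ _ _ _ _ (g \o clamp : MR R -> MR R)).
  by move=> x; rewrite inE => Ux /=; rewrite clamp_id.
by apply: measurable_funTS; exact: continuous_measurable_fun.
Qed.

Lemma norm_W_ge0 X : (0 <= norm_W X)%E.
Proof.
apply: ereal_sup_ubound; exists (fun=> 0).
  split=> [x _|]; first by rewrite normr0 ler01.
  by move=> [x y] _ /=; rewrite subrr normr0 mul1r.
by rewrite /sm_integral !integral0 sube0.
Qed.

(** The bound on g controls the integral against each Jordan part by its mass; the Lipschitz
    condition provides measurability. *)
Lemma norm_W_le X : (norm_W X <= (tv X)%:E)%E.
Proof.
apply: ge_ereal_sup => _ [g [g1 lg] <-].
have mg := lipschitz_measurable lg.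
have b (m : {finite_measure set (MR R) -> \bar R}) :
    (`|\int[m]_(x in unit_itv R) (g x)%:E| <= (mval (charge_of m) setT)%:E)%E.
  apply: le_trans (le_abse_integral _ _ _) _ => //; first exact/measurable_EFinP.
  apply: (@le_trans _ _ (\int[m]_(x in unit_itv R) 1%:E)%E).
    apply: ge0_le_integral => //.
      by apply: measurableT_comp => //; exact/measurable_EFinP.
  rewrite integral_cst//.
  by rewrite mul1e -mvalE// le_measure ?inE.
rewrite /sm_integral /tv EFinD; apply: leeD.
  by apply: le_trans (b _); exact: lee_abs.
by apply: le_trans (b _); rewrite -abseN; exact: lee_abs.
Qed.

Lemma norm1_ge0 X : (0 <= norm1 X)%E.
Proof.
apply: le_ereal_inf_tmp => _ [g _ <-]; apply: integral_ge0 => x _.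
by rewrite lee_fin.
Qed.

Lemma has_density_rv X (g : R -> R) A : has_density X g -> measurable A ->
  mval X A = \int[leb]_(x in A `&` unit_itv R) g x.
Proof. by move=> [_ h] mA; rewrite /mval h. Qed.

Lemma has_density_eq X Y (g : R -> R) : sm_eq X Y -> has_density X g -> has_density Y g.
Proof. by move=> XY [ig gE]; split=> // A mA; rewrite -XY// gE. Qed.

Lemma has_density_add X Y (g h : R -> R) : has_density X g -> has_density Y h ->
  has_density (smadd X Y) (fun x => g x + h x).
Proof.
move=> gX hY; have [ig _] := gX; have [ih _] := hY.
split; first by apply: integrable_fctD => //; exact: measurable_unit_itv.
move=> A mA; have mI : measurable (A `&` unit_itv R) by apply: measurableI => //; exact: measurable_unit_itv.
rewrite mvalE// mval_add// (has_density_rv gX)// (has_density_rv hY)// -RintegralD//.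
- rewrite /Rintegral fineK//; apply: integrable_fin_num => //; apply: integrable_fctD => //.
    exact: integrableS ig.
  exact: integrableS ih.
- exact: integrableS ig.
- exact: integrableS ih.
Qed.

Lemma has_density_scale c X (g : R -> R) : has_density X g ->
  has_density (smscale c X) (fun x => c * g x).
Proof.
move=> gX; have [ig _] := gX.
split; first by apply: integrable_fctZ => //; exact: measurable_unit_itv.
move=> A mA; have mI : measurable (A `&` unit_itv R) by apply: measurableI => //; exact: measurable_unit_itv.
rewrite mvalE// mval_scale// (has_density_rv gX)// -RintegralZl//; last exact: integrableS ig.
rewrite /Rintegral fineK//; apply: integrable_fin_num => //; apply: integrable_fctZ => //.
exact: integrableS ig.
Qed.

(** The set P where g >= 0 is a Hahn set of X: the mass of P minus that of its complement in [0,1]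
    is the integral of |g|. *)
Lemma norm1_le X (g : R -> R) : has_density X g -> (norm1 X <= (tv X)%:E)%E.
Proof.
move=> gX; have [ig _] := gX.
apply: (@le_trans _ _ (\int[leb]_(x in unit_itv R) `|g x|%:E)%E).
  by apply: ereal_inf_lbound; exists g.
have mg : measurable_fun (unit_itv R) (g : MR R -> R).
  by apply/measurable_EFinP; exact: measurable_int ig.
pose P : set (MR R) := unit_itv R `&` (g : MR R -> R) @^-1` `[0, +oo[%classic.
have mP : measurable P.
  by apply: mg.
have mPC : measurable (unit_itv R `\` P) by apply: measurableD.
have PU : P `<=` unit_itv R by move=> x [].
have iP : leb.-integrable P (EFin \o (g : MR R -> R)) by apply: integrableS ig.
have iPC : leb.-integrable (unit_itv R `\` P) (EFin \o (g : MR R -> R)).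
  by apply: integrableS ig => // x [].
have ian : leb.-integrable (unit_itv R) (EFin \o (fun x : MR R => `|g x|)).
  exact: integrable_norm.
have -> : (\int[leb]_(x in unit_itv R) `|g x|%:E =
    (\int[leb]_(x in unit_itv R) `|g x|)%:E)%E.
  by rewrite /Rintegral fineK//; apply: integrable_fin_num.
rewrite lee_fin; apply: le_trans (tv_ge X mP mPC).
rewrite !(has_density_rv gX)// (setIidl PU) (setIidl (@subDsetl _ _ _)).
rewrite -[in leLHS](setDUK PU) Rintegral_setU//.
- apply: lerD.
    rewrite le_eqVlt; apply/orP; left; apply/eqP; apply: eq_Rintegral => x.
    by rewrite inE => -[_ /=]; rewrite in_itv/= andbT => g0; rewrite ger0_norm.
  rewrite -mulN1r -RintegralZl// le_eqVlt; apply/orP; left; apply/eqP.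
  apply: eq_Rintegral => x; rewrite inE => -[Ux nP]; rewrite mulN1r ltr0_norm//.
  rewrite ltNge; apply/negP => g0; apply: nP; split=> //=.
  by rewrite in_itv/= g0.
- by rewrite setDUK.
- by apply/disj_setPS; rewrite setDE setICA setICr setI0.
Qed.

End norm_bounds.

(** * Densities of bounded variation as differences of distribution functions *)

Section bounded_variation_measures.
Context {R : realType}.
Implicit Types (X Y : signed_measure R) (A B : set (MR R)).

(** These are the distribution functions of finite measures of mass c on [0,1]. Two of them with the
    same c differ only on [0,1[. *)
Definition bounded_cdf (w : R -> R) (c : R) := [/\ {homo w : x y / x <= y},
  (forall x : R, w s @[s --> x^'+] --> w x),
  (forall t : R, t < 0 -> w t = 0) &
  (forall t : R, 1 <= t -> w t = c)].

Lemma bounded_cdf_ge0 w c t : bounded_cdf w c -> 0 <= w t.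
Proof.
move=> [hw _ w0 _]; rewrite -(w0 (Num.min (-1) t)); last first.
  by rewrite gt_min ltrN10.
by apply: hw; rewrite ge_min lexx orbT.
Qed.

Lemma bounded_cdf_le w c t : bounded_cdf w c -> w t <= c.
Proof.
move=> [hw _ _ w1]; rewrite -(w1 (Num.max 1 t)); last by rewrite le_max lexx.
by apply: hw; rewrite le_max lexx orbT.
Qed.

Lemma lebesgue_stieltjes_itv (f : cumulative R R) (x y : R) : x <= y ->
  lebesgue_stieltjes_measure f (`]x, y]%classic : set (MR R)) = (f y - f x)%:E :> \bar R.
Proof.
move=> xy; rewrite /lebesgue_stieltjes_measure /measure_extension.
rewrite measurable_mu_extE/=; last exact: is_ocitv.
by rewrite wlength_itv_bnd.
Qed.

Lemma measure_of_bounded_cdf w c : bounded_cdf w c ->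
  exists2 k : {finite_measure set (MR R) -> \bar R},
    (forall t, cdf (charge_of k) t = w t) & mval (charge_of k) setT = c.
Proof.
move=> [hw rw w0 w1].
pose f : cumulative R R := HB.pack w (isCumulative.Build R _ R w hw rw).
(* Starting below 0 keeps a possible atom at 0, since w may jump there; the restriction makes the
   Lebesgue-Stieltjes measure finite. *)
pose I : set (MR R) := `]-1, 1]%classic.
have mI : measurable I by exact: measurable_itv.
have Ifin : (lebesgue_stieltjes_measure f I < +oo :> \bar R)%E.
  by rewrite lebesgue_stieltjes_itv ?ltry//; lra.
exists (mfrestr mI Ifin) => [t|].
  rewrite /cdf /mval /= /mfrestr /mrestr.
  have [t1|t1] := ltP t (-1).
    rewrite (_ : _ `&` _ = set0) ?measure0 ?w0//; first by apply: lt_trans t1 _; rewrite ltrN10.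
    apply/seteqP; split=> x // [] ; rewrite /ray /I /= !in_itv/= => h1 /andP[h2 _].
    by have := lt_trans (le_lt_trans h1 t1) h2; rewrite ltxx.
  rewrite (_ : _ `&` _ = `]-1, Num.min t 1]%classic); last first.
    apply/seteqP; split=> x /=; rewrite /ray /I /= !in_itv/= le_min.
      by move=> [-> /andP[-> ->]].
    by move=> /andP[-> /andP[-> ->]].
  rewrite lebesgue_stieltjes_itv/=; last by rewrite le_min t1 /= (le_trans (lerN10 _) ler01).
  rewrite (w0 (-1)) ?ltrN10// subr0.
  by have [t2|t2] := leP t 1 => //; rewrite !w1// ltW.
rewrite /mval /= /mfrestr /mrestr setTI lebesgue_stieltjes_itv/=; last exact: le_trans (lerN10 _) ler01.
by rewrite (w0 (-1)) ?ltrN10// subr0 w1.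
Qed.

Section right_version.
Variables (v : R -> R) (c : R).
Hypotheses (hv : {homo v : x y / x <= y}) (v0 : forall t : R, t < 0 -> v t = 0)
  (v1 : forall t : R, 1 < t -> v t = c).

(** The right limit v(t+), an infimum because v is nondecreasing. *)
Definition right_value (t : R) : R := inf [set v s | s in [set s | t < s]].

Lemma right_value_le t s : t < s -> right_value t <= v s.
Proof.
move=> ts; apply: ge_inf; last by exists s.
by exists (v t) => _ [r /= /ltW tr <-]; exact: hv.
Qed.

Lemma right_value_glb t x : (forall s, t < s -> x <= v s) -> x <= right_value t.
Proof.
move=> h; apply: lb_le_inf; last by move=> _ [s ts <-]; exact: h.
by exists (v (t + 1)), (t + 1) => //=; rewrite ltrDl.
Qed.

Lemma right_value_ge t : v t <= right_value t.
Proof. by apply: right_value_glb => s /ltW; exact: hv. Qed.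

Lemma right_value_bounded_cdf : bounded_cdf right_value c.
Proof.
have hr : {homo right_value : x y / x <= y}.
  by move=> x y xy; apply: right_value_glb => s ys; apply: right_value_le; exact: le_lt_trans ys.
split=> //.
- move=> x; apply/cvgrPdist_le => e e0.
  have [s xs vs] : exists2 s, x < s & v s < right_value x + e.
    apply: contrapT => h.
    suff : right_value x + e <= right_value x by rewrite gerDl leNgt e0.
    by apply: right_value_glb => s xs; rewrite leNgt; apply/negP => ?; apply: h; exists s.
  near=> y; have xy : x < y by near: y; exact: nbhs_right_gt.
  have ys : y < s by near: y; exact: nbhs_right_lt.
  have := hr _ _ (ltW xy); have := right_value_le ys.
  by rewrite distrC => h1 h2; rewrite ger0_norm ?subr_ge0//; lra.
- move=> t t0; apply/eqP; rewrite eq_le; apply/andP; split.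
    by rewrite -(v0 (t := t / 2)) ?right_value_le//; lra.
  by rewrite -{1}(v0 t0) right_value_ge.
- move=> t t1; apply/eqP; rewrite eq_le; apply/andP; split.
    by rewrite -(v1 (t := t + 1)) ?right_value_le//; lra.
  by apply: right_value_glb => s ts; rewrite v1//; exact: le_lt_trans ts.
Unshelve. all: by end_near. Qed.

(* Disjoint jumps are separated by rationals. *)
Lemma countable_jumps : countable [set t | v t != right_value t].
Proof.
have jump t : v t != right_value t -> v t < right_value t.
  by move=> h; rewrite lt_neqAle h right_value_ge.
have rt t : exists q : rat, v t != right_value t -> v t < ratr q < right_value t.
  have [//|/jump h] := eqVneq (v t) (right_value t); first by exists 0.
  have [q] := rat_in_itvoo h; rewrite in_itv/= => hq.
  by exists q.
pose F t : nat := pickle (projT1 (cid (rt t))).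
apply/countable_injP; exists F => s t; rewrite !inE /= => hs ht /(pcan_inj pickleK) e.
have := projT2 (cid (rt s)) hs; have := projT2 (cid (rt t)) ht; rewrite e.
set q := ratr _; move=> /andP[t1 t2] /andP[s1 s2].
have [st|ts|//] := ltgtP s t.
  by have := lt_trans t1 (lt_le_trans s2 (right_value_le st)); rewrite ltxx.
by have := lt_trans s1 (lt_le_trans t2 (right_value_le ts)); rewrite ltxx.
Qed.

End right_version.

Lemma has_density_ae X (g h : R -> R) (N : set (MR R)) : has_density X g ->
  leb.-integrable (unit_itv R) (EFin \o (h : MR R -> R)) ->
  measurable N -> leb N = 0 :> \bar R ->
  (forall x, unit_itv R x -> ~ N x -> g x = h x) -> has_density X h.
Proof.
move=> [ig gE] ih mN N0 gh; split=> // A mA; rewrite gE//.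
have mI : measurable (A `&` unit_itv R) by apply: measurableI => //; exact: measurable_unit_itv.
rewrite (negligible_integral mN mI)//; last exact: integrableS ig.
rewrite [RHS](negligible_integral mN mI)//; last exact: integrableS ih.
by apply: eq_integral => x; rewrite inE => -[[_ Ux] Nx]; rewrite gh.
Qed.

Lemma integrable_mono (w : R -> R) c : bounded_cdf w c ->
  leb.-integrable (unit_itv R) (EFin \o (w : MR R -> R)).
Proof.
have Ufin : (leb (unit_itv R) < +oo :> \bar R)%E.
  by rewrite lebesgue_measure_itv/= lte_fin ltr01 -EFinB ltry.
move=> hw; apply: measurable_bounded_integrable => //.
- by apply: nondecreasing_measurable => //; case: hw.
- exists c; split; first exact: num_real.
  move=> x cx y _ /=; rewrite ger0_norm ?(bounded_cdf_ge0 _ hw)//.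
  exact: le_trans (bounded_cdf_le _ hw) (ltW cx).
Qed.

(** The two monotone Jordan components of g are made right-continuous; this changes them only at
    their jumps, a countable and hence null set, so the result is still a density of X. *)
Lemma bv_bounded_cdf X (g : R -> R) : has_density X g ->
  (total_variation 0 1 g < +oo)%E -> exists w1 w2 c,
  [/\ bounded_cdf w1 c, bounded_cdf w2 c & has_density X (fun x => w1 x - w2 x)].
Proof.
move=> gX TVg.
have bv : bounded_variation 0 1 g.
  by apply/bounded_variationP => //; rewrite ge0_fin_numE// total_variation_ge0.
clear TVg; have gE := bounded_variation_pos_neg_tvE bv.
have h2 := fine_neg_tv_nondecreasing bv.
have h1 := fine_neg_tv_nondecreasing (bounded_variationN bv).
pose p1 := fine \o pos_tv 0 g; pose p2 := fine \o neg_tv 0 g.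
have i0 : (0 : R) \in `[0, 1] by rewrite in_itv/= lexx ler01.
have i1 : (1 : R) \in `[0, 1] by rewrite in_itv/= lexx ler01.
(* Subtracting the same m preserves the difference of the components and makes both nonnegative at
   0. The common final value c is reached by an upward jump at 1. *)
pose m := Num.min (p1 0) (p2 0); pose c := Num.max (p1 1) (p2 1) - m.
pose ext (p : R -> R) (t : R) : R := if t < 0 then 0 else if t <= 1 then p t - m else c.
have extP (p : R -> R) : {in `[0, 1] &, {homo p : x y / x <= y}} -> m <= p 0 -> p 1 - m <= c ->
    {homo ext p : x y / x <= y}.
  move=> hp mp pc x y xy; rewrite /ext.
  have [x0|x0] := ltP x 0; have [y0|y0] := ltP y 0 => //.
  - have [y1|y1] := leP y 1.
      rewrite subr_ge0; apply: le_trans mp _; apply: hp => //.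
      by rewrite in_itv/= y0.
    by apply: le_trans pc; rewrite subr_ge0; apply: le_trans mp _; apply: hp.
  - by exfalso; lra.
  - have [x1|x1] := leP x 1; have [y1|y1] := leP y 1 => //.
    + by rewrite lerD2r; apply: hp => //; rewrite in_itv/= ?x0 ?y0.
    + apply: le_trans pc; rewrite lerD2r; apply: hp => //.
      by rewrite in_itv/= x0.
    + by exfalso; lra.
have m1 : m <= p1 0 by rewrite ge_min lexx.
have m2 : m <= p2 0 by rewrite ge_min lexx orbT.
have c1 : p1 1 - m <= c by rewrite lerD2r le_max lexx.
have c2 : p2 1 - m <= c by rewrite lerD2r le_max lexx orbT.
have e0 p t : t < 0 -> ext p t = 0 by rewrite /ext => ->.
have e1 p t : 1 < t -> ext p t = c.
  by move=> t1; rewrite /ext ltNge (le_trans ler01 (ltW t1)) /= leNgt t1.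
have H1 := extP p1 h1 m1 c1; have H2 := extP p2 h2 m2 c2.
have R1 := right_value_bounded_cdf H1 (e0 p1) (e1 p1); have R2 := right_value_bounded_cdf H2 (e0 p2) (e1 p2).
exists (right_value (ext p1)), (right_value (ext p2)), c; split=> //.
pose N : set (MR R) := [set t | ext p1 t != right_value (ext p1) t] `|` [set t | ext p2 t != right_value (ext p2) t].
have cN : countable N.
  by rewrite /N -bigcup2E; apply: bigcup_countable => // -[_|[_|n _]] /=;
    [exact: countable_jumps H1|exact: countable_jumps H2|exact: countable0].
apply: (has_density_ae (N := N) gX).
- apply: integrable_fctB; [exact: measurable_unit_itv|exact: integrable_mono R1|exact: integrable_mono R2].
- exact: countable_measurable.
- exact: countable_lebesgue_measure0.
- move=> x Ux Nx; have Ux' : x \in `[0, 1] by [].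
  have q1 : ext p1 x = right_value (ext p1) x.
    by apply/eqP; apply: contrapT => /negP h; apply: Nx; left.
  have q2 : ext p2 x = right_value (ext p2) x.
    by apply/eqP; apply: contrapT => /negP h; apply: Nx; right.
  have -> : g x = p1 x - p2 x by rewrite gE.
  rewrite -q1 -q2 /ext; move: Ux; rewrite /= in_itv/= => /andP[x0 x1].
  by rewrite ltNge x0 /= x1; lra.
Qed.

End bounded_variation_measures.

(** * The distributional derivative of the product with S *)
Section test_integral.
Context {R : realType}.
Implicit Types (X Y : signed_measure R) (A B : set (MR R)).
Notation open01 := (`]0%R, 1%R[%classic : set (MR R)).

Section test.
Variable phi : R -> R.
Hypothesis test_phi : test_function phi.

Lemma test_derivable x : derivable phi x 1.
Proof. by have [h _] := test_phi; exact: (h 0%N x). Qed.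

Lemma test_derive1_continuous : continuous (derive1 phi).
Proof. by have [h _] := test_phi => x; apply: derivable_cvg; exact: (h 1%N x). Qed.

Lemma test_continuous : continuous phi.
Proof. by move=> x; apply: derivable_cvg; exact: test_derivable. Qed.

Lemma test_1 : phi 1 = 0.
Proof.
have [_ [c [d [c0 d1 h]]]] := test_phi; apply: h => /andP[_ h].
by move: (le_lt_trans h d1); rewrite ltxx.
Qed.

Lemma test_FTC x : x < 1 ->
  (\int[leb]_(t in `[x, 1%R]) (derive1 phi t)%:E = (- phi x)%:E)%E.
Proof.
move=> x1; rewrite (@continuous_FTC2 _ (derive1 phi) phi)//.
- by rewrite test_1 sub0e EFinN.
- by apply: continuous_subspaceT => y; exact: test_derive1_continuous.
- split=> [y _||]; first exact: test_derivable.
  + by apply: cvg_at_right_filter; exact: test_continuous.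
  + by apply: cvg_at_left_filter; exact: test_continuous.
Qed.

Lemma continuous_bounded01 (h : R -> R) : continuous h ->
  exists2 M, 0 <= M & forall t, unit_itv R t -> `|h t| <= M.
Proof.
move=> ch; have cn : {within `[0, 1], continuous (fun t => `|h t|)}.
  by apply: continuous_subspaceT => y; apply: cvg_norm; exact: ch.
have [m _ hm] := EVT_max ler01 cn.
by exists `|h m| => // t Ut; exact: hm.
Qed.

Lemma test_measurable : measurable_fun setT (derive1 phi : MR R -> R).
Proof. exact: continuous_measurable_fun test_derive1_continuous. Qed.

Lemma test_integrable (m : {finite_measure set (MR R) -> \bar R}) :
  m.-integrable open01 (EFin \o (phi : MR R -> R)).
Proof.
have [M M0 hM] := continuous_bounded01 test_continuous.
apply: measurable_bounded_integrable => //.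
- by rewrite ltey_eq fin_num_measure.
- by apply: measurable_funTS; exact: continuous_measurable_fun test_continuous.
- exists M; split; first exact: num_real.
  move=> y My x xo; apply: le_trans (hM x _) (ltW My).
  by move: xo; rewrite /= !in_itv/= => /andP[/ltW -> /ltW ->].
Qed.

(** Integration by parts: phi x is minus the integral of phi' over [x, 1], as phi 1 = 0, and Fubini
    on the triangle 0 < x <= t < 1 yields the distribution function as the factor of phi'. *)
Lemma test_fubini (m : {finite_measure set (MR R) -> \bar R}) :
  \int[m]_(x in open01) phi x =
   - \int[leb]_(t in open01) (mval (charge_of m) `]0%R, t]%classic * derive1 phi t).
Proof.
pose Q : set (MR R * MR R) := [set p : MR R * MR R |
  [/\ 0 < (p.1 : R), (p.1 : R) <= p.2 & (p.2 : R) < 1]].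
have mfst := @measurable_fst _ _ (MR R) (MR R).
have msnd := @measurable_snd _ _ (MR R) (MR R).
have mQ : measurable Q.
  rewrite (_ : Q = (fst @^-1` `]0, +oo[%classic) `&`
     ((fun p : MR R * MR R => (p.2 : R) - (p.1 : R) : MR R) @^-1` `[0, +oo[%classic) `&`
     (snd @^-1` `]-oo, 1[%classic)).
    apply: measurableI; first apply: measurableI.
    - by rewrite -[X in measurable X]setTI; apply: mfst => //; exact: measurable_itv.
    - rewrite -[X in measurable X]setTI.
      suff /(_ measurableT) : measurable_fun setT
        (fun p : MR R * MR R => ((p.2 : R) - (p.1 : R)) : MR R).
        by apply; exact: measurable_itv.
      by apply: measurable_funB.
    - by rewrite -[X in measurable X]setTI; apply: msnd => //; exact: measurable_itv.
  apply/seteqP; split=> -[x t]; rewrite /Q /= !in_itv/= ?andbT.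
    by move=> [x0 xt t1]; rewrite subr_ge0.
  by rewrite subr_ge0 => -[[x0 xt] t1].
have [M M0 hM] := continuous_bounded01 test_derive1_continuous.
pose f (p : MR R * MR R) : \bar R := (\1_Q p * derive1 phi p.2)%:E.
have mf : measurable_fun setT f.
  apply/measurable_EFinP/measurable_funM; first exact: measurable_indic.
  exact: (measurableT_comp test_measurable).
have dom x t : `|\1_Q (x, t) * derive1 phi t| <= M * \1_(unit_itv R) t.
  rewrite indicE; have [|] := boolP ((x, t) \in Q).
    rewrite inE => -[/= x0 xt t1].
    have Ut : unit_itv R t by rewrite /= in_itv/= (ltW t1) (le_trans (ltW x0) xt).
    by rewrite mul1r indicE mem_set// mulr1 hM.
  by rewrite mul0r normr0 mulr_ge0.
have intf : (m \x leb)%E.-integrable setT f.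
  apply/integrable12ltyP => //.
  apply: (@le_lt_trans _ _ (\int[m]_x M%:E)%E); last first.
    by rewrite integral_cst//= lte_mul_pinfty// ltey_eq fin_num_measure.
  apply: ge0_le_integral => //.
  - by move=> x _; apply: integral_ge0.
  - by apply: (measurable_fun_fubini_tonelli_F (abse \o f)) => //=; exact: measurableT_comp.
  move=> x _; apply: (@le_trans _ _ (\int[leb]_t (M * \1_(unit_itv R) t)%:E)%E).
    apply: ge0_le_integral => //.
    - apply: measurableT_comp => //; apply/measurable_EFinP/measurable_funM.
        apply: measurableT_comp => //; exact: measurable_pair1.
      exact: test_measurable.
    - by apply/measurable_EFinP/measurable_funM => //; exact: measurable_indic.
    - by move=> t _; rewrite lee_fin.
  under eq_integral do rewrite EFinM.
  rewrite integralZl//; last by exact: integrable_indic_itv.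
  by rewrite integral_indic//= setIT lebesgue_measure_itv/= lte_fin ltr01 -EFinB subr0 mule1.
have := Fubini intf.
have -> : (\int[m]_x \int[leb]_t f (x, t) =
    \int[m]_(x in open01) (-1 * phi x)%:E)%E.
  rewrite [RHS]integral_mkcond; apply: eq_integral => x _; rewrite patchE.
  case: ifPn => [|xn].
    rewrite inE /= in_itv/= => /andP[x0 x1].
    rewrite mulN1r -(test_FTC x1) -(@integral_itv_bndo_bndc _ (BLeft x) 1).
      rewrite [RHS]integral_mkcond; apply: eq_integral => t _; rewrite patchE /f.
      rewrite indicE /=; case: ifPn => [|tn].
        rewrite inE /= in_itv/= => /andP[xt t1].
        by rewrite mem_set ?mul1r//; split.
      rewrite memNset ?mul0r// => -[/= _ h1 h2].
      by move/negP: tn; apply; rewrite inE /= in_itv/= h1.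
    by apply/measurable_EFinP; apply: measurable_funTS; exact: test_measurable.
  rewrite integral0_eq// => t _; rewrite /f indicE memNset ?mul0r// => -[/= h1 h2 h3].
  by move/negP: xn; apply; rewrite inE /= in_itv/= h1 (le_lt_trans h2 h3).
have -> : (\int[leb]_t \int[m]_x f (x, t) =
    \int[leb]_(t in open01) (mval (charge_of m) `]0%R, t]%classic * derive1 phi t)%:E)%E.
  rewrite [RHS]integral_mkcond; apply: eq_integral => t _; rewrite patchE.
  case: ifPn => [|tn].
    rewrite inE /= in_itv/= => /andP[t0 t1].
    transitivity (\int[m]_x ((derive1 phi t)%:E * (\1_(`]0%R, t]%classic : set (MR R)) x)%:E))%E.
      apply: eq_integral => x _; rewrite /f /= -EFinM mulrC; congr (_ * _)%:E.
      rewrite !indicE; have -> // : ((x, t) \in Q) = (x \in (`]0%R, t]%classic : set (MR R))).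
      apply/idP/idP; rewrite !inE /= in_itv/=; first by move=> [-> ->].
      by move=> /andP[h1 h2].
    rewrite integralZl//.
      by rewrite integral_indic//= setIT mulrC EFinM -mvalE//; exact: measurable_itv.
    by apply: integrable_indic => //; rewrite ltey_eq fin_num_measure.
  rewrite integral0_eq// => x _; rewrite /f indicE memNset ?mul0r// => -[/= h1 h2 h3].
  by move/negP: tn; apply; rewrite inE /= in_itv/= h3 (lt_le_trans h1 h2).
move=> h.
have <- : \int[m]_(x in open01) (-1 * phi x) =
    \int[leb]_(t in open01) (mval (charge_of m) `]0%R, t]%classic * derive1 phi t).
  by rewrite /Rintegral h.
by rewrite RintegralZl ?mulN1r ?opprK//; exact: test_integrable.
Qed.

Lemma sm_integral_test X : (forall t, 0 < t -> t < 1 -> cdf X t = mval X `]0%R, t]%classic) ->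
  leb.-integrable open01 (EFin \o (fun t => cdf X t * derive1 phi t : R)) ->
  sm_integral X `]0, 1[ phi =
  (- \int[leb]_(t in open01) (cdf X t * derive1 phi t)%:E)%E.
Proof.
move=> cX iX; rewrite /sm_integral.
have E (m : {finite_measure set (MR R) -> \bar R}) :
    (\int[m]_(x in open01) (phi x)%:E = (\int[m]_(x in open01) phi x)%:E)%E.
  rewrite /Rintegral fineK//; apply: integrable_fin_num => //.
  exact: test_integrable.
have -> : (\int[leb]_(t in open01) (cdf X t * derive1 phi t)%:E =
    (\int[leb]_(t in open01) (cdf X t * derive1 phi t))%:E)%E.
  by rewrite /Rintegral fineK//; exact: integrable_fin_num.
rewrite !E -EFinB -EFinN; congr EFin; rewrite !test_fubini.
have [M M0 hM] := continuous_bounded01 test_derive1_continuous.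
have im (m : {finite_measure set (MR R) -> \bar R}) :
    leb.-integrable open01 (EFin \o (fun t : MR R => mval (charge_of m) `]0%R, t]%classic * derive1 phi t)).
  apply: measurable_bounded_integrable => //.
  - have : (leb open01 < +oo :> \bar R)%E by rewrite lebesgue_measure_itv/= lte_fin ltr01 -EFinB ltry.
    exact.
  - apply: measurable_funM; last by apply: measurable_funTS; exact: test_measurable.
    apply: nondecreasing_measurable => // x y xy; apply: mval_le; try exact: measurable_itv.
    by move=> z /=; rewrite !in_itv/= => /andP[-> /le_trans]; apply.
  - exists (mval (charge_of m) setT * M); split; first exact: num_real.
    move=> y My x xo; apply: le_trans (ltW My); rewrite normrM ler_pM//.
      rewrite ger0_norm ?mval_ge0//; apply: mval_le => //; exact: measurable_itv.
    by apply: hM; move: xo; rewrite /= !in_itv/= => /andP[/ltW -> /ltW ->].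
rewrite -opprD; congr (- _); rewrite -RintegralB//.
apply: eq_Rintegral => t; rewrite inE /= in_itv/= => /andP[t0 t1].
by rewrite cX// [in RHS]mval_jordan ?mulrBl//; exact: measurable_itv.
Qed.

End test.
End test_integral.

Section product_derivative.
Context {R : realType}.
Implicit Types (X Y : signed_measure R) (A B : set (MR R)).
Notation open01 := (`]0%R, 1%R[%classic : set (MR R)).

(** It will be applied twice with p and q exchanged; the final value c + c is the same both
    times. *)
Lemma bounded_cdf_mul_add (w1 w2 p q : R -> R) (c : R) : bounded_cdf w1 c -> bounded_cdf w2 c ->
  continuous p -> continuous q ->
  {homo p : x y / x <= y} -> {homo q : x y / x <= y} ->
  (forall t, 0 <= p t) -> (forall t, 0 <= q t) ->
  (forall t, 1 <= t -> p t = 1) -> (forall t, 1 <= t -> q t = 1) ->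
  bounded_cdf (fun t => w1 t * p t + w2 t * q t) (c + c).
Proof.
move=> h1 h2 cp cq hp hq p0 q0 p1 q1.
have [hw1 r1 w10 w11] := h1; have [hw2 r2 w20 w21] := h2; split.
- by move=> x y xy; apply: lerD; apply: ler_pM;
    rewrite ?(bounded_cdf_ge0 _ h1) ?(bounded_cdf_ge0 _ h2) ?hw1 ?hw2 ?hp ?hq.
- move=> x; apply: cvgD; apply: cvgM => //.
    by apply: cvg_at_right_filter; exact: cp.
  by apply: cvg_at_right_filter; exact: cq.
- by move=> t t0; rewrite w10// w20// !mul0r addr0.
- by move=> t t1; rewrite w11// w21// p1// q1// !mulr1.
Qed.

Lemma cdf_left_limit (m : {finite_measure set (MR R) -> \bar R}) (x : R) :
  cdf (charge_of m) (x - n.+1%:R^-1) @[n --> \oo] --> mval (charge_of m) `]-oo, x[%classic.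
Proof.
have UE : \bigcup_n ray (x - n.+1%:R^-1) = `]-oo, x[%classic.
  apply/seteqP; split=> y /=; rewrite in_itv/=.
    move=> [n _]; rewrite /ray /= in_itv/= => /le_lt_trans; apply.
    by rewrite ltrBlDr ltrDl invr_gt0.
  move=> yx; exists (Num.bound (x - y)^-1) => //.
  rewrite /ray /= in_itv/= lerBrDr -lerBrDl.
  have xy : 0 < x - y by rewrite subr_gt0.
  rewrite invf_ple ?posrE//.
  apply: le_trans (ltW (archi_boundP _)) _; first by rewrite invr_ge0 ltW.
  by rewrite ler_nat.
have h : (m \o (fun n => ray (x - n.+1%:R^-1))) n @[n --> \oo] --> m (\bigcup_n ray (x - n.+1%:R^-1)).
  apply: nondecreasing_cvg_mu.
  - by move=> n; exact: measurable_ray.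
  - by apply: bigcup_measurable => n _; exact: measurable_ray.
  - move=> n k nk; apply/subsetPset => y; rewrite /ray /= !in_itv/= => /le_trans; apply.
    by rewrite lerD2l lerN2 lef_pV2 ?posrE// ler_nat.
rewrite UE in h; have := h.
rewrite -(@fineK _ (m `]-oo, x[%classic)); last first.
  by rewrite fin_num_measure//; exact: measurable_itv.
by move=> /fine_cvgP[_].
Qed.

Section nu.
Variables (w1 w2 S : R -> R) (c : R).
Hypotheses (h1 : bounded_cdf w1 c) (h2 : bounded_cdf w2 c)
  (lS : 1.-lipschitz_(unit_itv R) S) (S0 : S 0 = 0) (S1 : S 1 = 0).

Let Sc (t : R) : R := S (clamp t).
Let p (t : R) : R := Sc t + clamp t.

Let Sc_lip x y : `|Sc x - Sc y| <= `|x - y|.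
Proof. exact: lipschitz_clamp. Qed.

Let Sc_lipc x y : `|Sc x - Sc y| <= `|clamp x - clamp y|.
Proof.
rewrite -[leRHS]mul1r; apply: (lS (x := (clamp x, clamp y))).
by split; exact: clamp_in.
Qed.

Let p_homo : {homo p : x y / x <= y}.
Proof.
move=> x y xy; have := Sc_lipc x y; have cxy := clamp_le xy.
by rewrite distrC [leRHS]distrC (ger0_norm (_ : 0 <= clamp y - clamp x)) ?subr_ge0//
  ler_norml => /andP[a b]; rewrite /p; lra.
Qed.

Let clamp_cont : continuous (@clamp R).
Proof. by apply: nonexpansive_continuous => x y; exact: clamp_dist. Qed.

Let p_cont : continuous p.
Proof.
move=> x; apply: cvgD; last exact: clamp_cont.
by apply: nonexpansive_continuous => ? ?; exact: Sc_lip.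
Qed.

Let p_ge0 t : 0 <= p t.
Proof.
apply: (@le_trans _ _ (p (Num.min t 0))).
  by rewrite /p /Sc clamp_lt0 ?ge_min ?lexx ?orbT// S0 addr0.
by apply: p_homo; rewrite ge_min lexx.
Qed.

Let p1 t : 1 <= t -> p t = 1.
Proof. by move=> t1; rewrite /p /Sc clamp_ge1// S1 add0r. Qed.

Let clamp_ge0 (t : R) : 0 <= clamp t.
Proof. by have := clamp_in t; rewrite /= in_itv/= => /andP[]. Qed.

Let Sc_bound t : t <= 1 -> `|Sc t| <= 1 - t.
Proof.
move=> t1; have S1c : Sc 1 = 0 by rewrite /Sc clamp_ge1.
by have := Sc_lip t 1; rewrite S1c subr0 (distrC t) (ger0_norm (x := 1 - t)) ?subr_ge0.
Qed.

Let w_bound t : `|w1 t - w2 t| <= c.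
Proof.
have a := bounded_cdf_ge0 t h1; have b := bounded_cdf_ge0 t h2.
have d := bounded_cdf_le t h1; have e := bounded_cdf_le t h2.
by rewrite ler_norml; apply/andP; split; lra.
Qed.

(* With p = S + id and q = id, both nondecreasing and nonnegative on [0,1],
   - (w1 - w2) S = (w1 q + w2 p) - (w1 p + w2 q) is a difference of two
   nondecreasing functions, to which Lebesgue-Stieltjes measures apply. *)
Lemma product_derivative : exists nu : signed_measure R,
  [/\ (forall t, cdf nu t = - ((w1 t - w2 t) * S (clamp t))), mval nu setT = 0,
      on01 nu & is_distr_derivative (fun x => - ((w1 x - w2 x) * S x)) nu].
Proof.
have k1 := bounded_cdf_mul_add h1 h2 p_cont clamp_cont p_homo (@clamp_le R) p_ge0 clamp_ge0 p1 (@clamp_ge1 R).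
have k2 := bounded_cdf_mul_add h1 h2 clamp_cont p_cont (@clamp_le R) p_homo clamp_ge0 p_ge0 (@clamp_ge1 R) p1.
have [l1 l1E _] := measure_of_bounded_cdf k1; have [l2 l2E _] := measure_of_bounded_cdf k2.
pose X := smsub (charge_of l2) (charge_of l1).
have cX t : cdf X t = - ((w1 t - w2 t) * Sc t).
  have := l1E t; have := l2E t; rewrite /cdf mval_sub; last exact: measurable_ray.
  by move=> -> ->; rewrite /p; ring.
have moo : measurable open01 by exact: measurable_itv.
have X0 : cdf X 0 = 0 by rewrite cX /Sc clamp_lt0// S0 mulr0 oppr0.
(* No atom at 1: although w1 - w2 may jump there, it is bounded by c while |Sc t| <= 1 - t, so the
   left limit of the distribution function is 0. *)
have X1 : mval X `]-oo, 1[%classic = 0.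
  have mI : measurable (`]-oo, 1[%classic : set (MR R)) by exact: measurable_itv.
  have lim : cdf X (1 - n.+1%:R^-1) @[n --> \oo] --> mval X `]-oo, 1[%classic.
    rewrite mval_sub// (_ : (fun n => _) = fun n : nat =>
        cdf (charge_of l2) (1 - n.+1%:R^-1) - cdf (charge_of l1) (1 - n.+1%:R^-1)).
      by apply: cvgB; exact: cdf_left_limit.
    by apply/funext => n; rewrite /cdf mval_sub//; exact: measurable_ray.
  have lim0 : cdf X (1 - n.+1%:R^-1) @[n --> \oo] --> (0 : R).
    apply/cvgrPdist_le => e e0.
    have e0' : 0 < e / (c + 1).
      by rewrite divr_gt0//; have := w_bound 0; have := normr_ge0 (w1 0 - w2 0); lra.
    have /cvgrPdist_le /(_ _ e0') := @cvg_harmonic R.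
    apply: filterS => n; rewrite sub0r normrN ger0_norm ?invr_ge0// => hn.
    rewrite sub0r normrN cX normrN normrM.
    have n1 : 1 - n.+1%:R^-1 <= 1 :> R by rewrite gerBl invr_ge0.
    have c0 : 0 <= c by apply: le_trans (w_bound 0).
    apply: (@le_trans _ _ (c * (e / (c + 1)))).
      apply: ler_pM => //; apply: le_trans (Sc_bound n1) _.
      by rewrite opprB addrC subrK.
    by rewrite mulrA ler_pdivrMr; nra.
  exact: cvg_unique lim lim0.
(* X has no atom at 0 or 1, so the restriction keeps its distribution function and puts the measure
   on the open interval, as [is_distr_derivative] asks. *)
pose nu : signed_measure R := crestr0 X moo.
have rnu A : measurable A -> mval nu A = mval X (A `&` open01) by exact: mval_crestr0.
have nu01 : mval X open01 = 0.
  transitivity (mval X (`]-oo, 1[%classic `\` ray 0)).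
    congr (mval X _); apply/seteqP; split=> x /=; rewrite /ray /= !in_itv/=.
      by move=> /andP[x0 x1]; split=> //; apply/negP; rewrite -ltNge.
    by move=> [-> /negP]; rewrite -ltNge => ->.
  rewrite mvalD; [|exact: measurable_ray|exact: measurable_itv|].
    by rewrite X1 -/(cdf X 0) X0 subr0.
  by move=> x; rewrite /ray /= !in_itv/= => /le_lt_trans; apply; exact: ltr01.
have ray_pos t : 0 < t -> t < 1 -> mval nu `]0%R, t]%classic = cdf X t.
  move=> t0 t1; rewrite rnu; last exact: measurable_itv.
  rewrite (_ : _ `&` _ = `]0%R, t]%classic); last first.
    apply/seteqP; split=> x /=; rewrite !in_itv/=; first by move=> [].
    by move=> /andP[x0 xt]; rewrite x0 xt (le_lt_trans xt t1).
  by rewrite mval_itv ?ltW// X0 subr0.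
have cnu t : cdf nu t = - ((w1 t - w2 t) * S (clamp t)).
  rewrite -/(Sc t) /cdf rnu; last exact: measurable_ray.
  have [t0|t0] := leP t 0.
    rewrite (_ : _ `&` _ = set0); last first.
      apply/seteqP; split=> x // []; rewrite /ray /= !in_itv/= => xt /andP[x0 _].
      by have := lt_le_trans x0 (le_trans xt t0); rewrite ltxx.
    by rewrite mval0 /Sc clamp_lt0// S0 mulr0 oppr0.
  have [t1|t1] := leP 1 t.
    rewrite (_ : _ `&` _ = open01); first by rewrite nu01 /Sc clamp_ge1// S1 mulr0 oppr0.
    apply/seteqP; split=> x /=; rewrite /ray /= !in_itv/=; first by move=> [].
    by move=> /andP[-> x1]; rewrite x1 (le_trans (ltW x1) t1).
  rewrite -cX -(ray_pos t t0 t1) rnu; last exact: measurable_itv.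
  congr (mval X _); apply/seteqP; split=> x /=; rewrite /ray /= !in_itv/=.
    by move=> [-> /andP[-> ->]].
  by move=> [/andP[-> ->] /andP[_ ->]].
have nuT : mval nu setT = 0 by rewrite rnu// setTI.
have nuoo A : measurable A -> mval nu (A `&` open01) = mval nu A.
  by move=> mA; rewrite !rnu ?setIA//; [rewrite -setIA setIid|exact: measurableI].
have U_oo A : A `&` unit_itv R `&` open01 = A `&` open01.
  rewrite -setIA; congr (_ `&` _); apply/setIidPr => x /=.
  by rewrite !in_itv/= => /andP[/ltW -> /ltW ->].
exists nu; split=> //.
  apply/on01P => A mA; rewrite !rnu// ?U_oo//.
  by apply: measurableI => //; exact: measurable_unit_itv.
have iw : leb.-integrable (unit_itv R) (EFin \o (fun t : MR R => w1 t - w2 t)).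
  apply: integrable_fctB; [exact: measurable_unit_itv|exact: integrable_mono h1|exact: integrable_mono h2].
have mS : measurable_fun open01 (S : MR R -> MR R).
  apply: measurable_funS (lipschitz_measurable lS) => //.
  by move=> x /=; rewrite !in_itv/= => /andP[/ltW -> /ltW ->].
have mw (w : R -> R) : bounded_cdf w c -> measurable_fun open01 (w : MR R -> R).
  by move=> hw; apply: nondecreasing_measurable => //; case: hw.
have mh : measurable_fun open01 (fun x : MR R => - ((w1 x - w2 x) * S x)).
  apply: measurableT_comp => //.
  by apply: measurable_funM => //; apply: measurable_funB; exact: mw.
have oofin : (leb open01 < +oo :> \bar R)%E by rewrite lebesgue_measure_itv/= lte_fin ltr01 -EFinB ltry.
have hb t : open01 t -> `|- ((w1 t - w2 t) * S t)| <= c.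
  rewrite /= in_itv/= => /andP[t0 t1]; rewrite normrN normrM -[leRHS]mulr1.
  have Ut : unit_itv R t by rewrite /= in_itv/= (ltW t0) (ltW t1).
  apply: ler_pM => //; have := Sc_bound (ltW t1).
  by rewrite /Sc clamp_id// => /le_trans; apply; rewrite gerBl ltW.
have hcdf t : open01 t -> cdf nu t = - ((w1 t - w2 t) * S t).
  by move=> /= tt; rewrite cnu clamp_id//; move: tt; rewrite /= !in_itv/= => /andP[/ltW -> /ltW ->].
split.
- apply: measurable_bounded_integrable => //.
  exists c; split; first exact: num_real.
  by move=> x cx y /hb /le_trans; apply; exact: ltW.
- by apply/sm_eqP => A mA; rewrite -nuoo//; apply/esym; exact: mval_crestr0.
- move=> phi tphi; rewrite (sm_integral_test tphi).
  + congr (- _)%E; apply: eq_integral => t; rewrite inE => tt; rewrite hcdf//.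
  + by move=> t t0 t1; rewrite ray_pos// cnu cX.
  + have [M M0 hM] := continuous_bounded01 (test_derive1_continuous tphi).
    apply: measurable_bounded_integrable => //.
      apply: measurable_funM; last by apply: measurable_funTS; exact: test_measurable.
      apply: (eq_measurable_fun (fun x : MR R => - ((w1 x - w2 x) * S x))) => // t.
      by rewrite inE => tt; rewrite hcdf.
    exists (c * M); split; first exact: num_real.
    move=> x Mx y yo; apply: le_trans (ltW Mx); rewrite normrM ler_pM//.
      by rewrite hcdf// hb.
    by apply: hM; move: yo; rewrite /= !in_itv/= => /andP[/ltW -> /ltW ->].
Qed.

End nu.
End product_derivative.

(** * Linear response *)
Section response.
Context {R : realType}.
Implicit Types (X Y : signed_measure R) (A B : set (MR R)).

Lemma fixed_probabilityP (L : signed_measure R -> signed_measure R) f :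
  fixed_probability L f -> [/\ on01 f, (forall A, measurable A -> 0 <= mval f A),
   mval f setT = 1, tv f = 1 & sm_eq (L f) f].
Proof.
move=> [f01 f0 f1 fL]; have f1' : mval f setT = 1 by rewrite /mval f1.
split=> //; first by move=> A mA; rewrite fine_ge0// f0.
by have [n p] := nonneg_neg0 f0 measurableT; rewrite /tv n p addr0.
Qed.

Lemma cvg_linear_bound (F : R -> \bar R) (K eta : R) : 0 < eta ->
  (forall h, 0 < h -> h < eta -> (0 <= F h <= (K * h)%:E)%E) ->
  F h @[h --> 0^'+] --> 0%E.
Proof.
move=> eta0 FK; apply: (@squeeze_cvge _ _ _ _ (cst 0%E) F (fun h => (K * h)%:E)).
- near=> h; apply: FK; first by near: h; exact: nbhs_right_gt.
  by near: h; exact: nbhs_right_lt.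
- exact: cvg_cst.
- apply: cvg_EFin; first by near=> h.
  rewrite -[X in _ --> X](mulr0 K); apply: cvgM; first exact: cvg_cst.
  by apply: cvg_at_right_filter; exact: cvg_id.
Unshelve. all: by end_near. Qed.

(** Two kinds of smallness enter. K1 bounds the difference of the operators on every measure on
    [0,1], in total variation only. K2 bounds the first-order remainder at the single measure f0,
    whose transferred density has bounded variation. *)
Lemma linear_response (a b C K1 K2 h : R) (T T' : R -> R)
    (f0 f' r v : signed_measure R) :
  0 < a -> 0 < b -> 0 < h -> 0 <= C -> 0 <= K1 -> mfun01 T -> mfun01 T' ->
  (forall w v, zero_average w -> sm_eq (smsub w (noisy_transfer a T w)) v ->
     tv w <= C * tv v) ->
  fixed_probability (noisy_transfer a T) f0 ->
  fixed_probability (noisy_transfer b T') f' ->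
  zero_average r -> sm_eq (smsub r (noisy_transfer a T r)) v ->
  (forall X, on01 X ->
    tv (smsub (noisy_transfer b T' X) (noisy_transfer a T X)) <= K1 * h * tv X) ->
  tv (smsub (smscale h^-1 (smsub (noisy_transfer b T' f0) (noisy_transfer a T f0))) v)
    <= K2 * h ->
  tv (smsub (smscale h^-1 (smsub f' f0)) r) <= C * (K1 * (C * K1) + K2) * h.
Proof.
move=> a0 b0 h0 C0 K10 mT mT' hC /fixed_probabilityP[f01 _ f0T _ /sm_eqP f0L].
move=> /fixed_probabilityP[f'01 _ f'T tf' /sm_eqP f'L] r0 /sm_eqP rv' hK1 hK2.
set L := noisy_transfer a T in hC f0L rv' hK1 hK2 *.
set L' := noisy_transfer b T' in f'L hK1 hK2 *.
pose d := smsub f' f0.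
have hi : 0 < h^-1 by rewrite invr_gt0.
have d0 : zero_average d.
  apply/zero_averageP; split; first exact: on01_sub.
  by rewrite mval_sub// f'T f0T subrr.
have d01 : on01 d by have /zero_averageP[] := d0.
(* From f' = L' f' and f0 = L f0 follows d - L d = (L' - L) f', and f' has total variation 1. *)
have td : tv d <= C * (K1 * h).
  apply: (@le_trans _ _ (C * tv (smsub (L' f') (L f')))).
    apply: (hC _ _ d0); apply/sm_eqP => A mA.
    have -> : mval (smsub d (L d)) A = mval d A - mval (L d) A by exact: mval_sub.
    have -> : mval (L d) A = mval (L f') A - mval (L f0) A by exact: (noisy_sub a0 mT).
    have -> : mval d A = mval f' A - mval f0 A by exact: mval_sub.
    rewrite [RHS](mval_sub _ _ mA) (f'L A mA) (f0L A mA).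
    move: (mval f' A) (mval f0 A) (mval (L f') A); clear=> *; ring.
  by rewrite ler_wpM2l//; apply: le_trans (hK1 _ f'01) _; rewrite tf' mulr1.
pose y := smsub (smscale h^-1 d) r.
pose z := smsub (smscale h^-1 (smsub (L' f') (L f'))) v.
have yz : sm_eq (smsub y (L y)) z.
  apply/sm_eqP => A mA; rewrite mval_sub//.
  have -> : mval y A = h^-1 * (mval f' A - mval f0 A) - mval r A.
    by rewrite /y mval_sub// mval_scale// mval_sub.
  have -> : mval (L y) A = h^-1 * (mval (L f') A - mval (L f0) A) - mval (L r) A.
    by rewrite /y (noisy_sub a0 mT)// (noisy_scale a0 mT)// (noisy_sub a0 mT).
  have -> : mval z A = h^-1 * (mval (L' f') A - mval (L f') A) - mval v A.
    by rewrite /z mval_sub// mval_scale// mval_sub.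
  rewrite (f'L A mA) (f0L A mA) -(rv' A mA).
  have -> : mval (smsub r (L r)) A = mval r A - mval (L r) A by exact: mval_sub.
  move: (h^-1) (mval f' A) (mval f0 A) (mval (L f') A) (mval (L r) A) (mval r A).
  by clear=> *; ring.
have y0 : zero_average y.
  by apply: zero_average_sub => //; exact: zero_average_scale.
apply: le_trans (hC _ _ y0 yz) _; rewrite -mulrA ler_wpM2l//.
have zE : tv z <= h^-1 * tv (smsub (L' d) (L d)) + K2 * h.
  pose u := smscale h^-1 (smsub (L' d) (L d)).
  pose q := smsub (smscale h^-1 (smsub (L' f0) (L f0))) v.
  apply: (@le_trans _ _ (tv (smadd u q))).
    rewrite le_eqVlt; apply/orP; left; apply/eqP; apply: tv_eq => A mA.
    have -> : mval z A = h^-1 * (mval (L' f') A - mval (L f') A) - mval v A.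
      by rewrite /z mval_sub// mval_scale// mval_sub.
    have -> : mval (smadd u q) A = mval u A + mval q A by rewrite mval_add.
    have -> : mval q A = h^-1 * (mval (L' f0) A - mval (L f0) A) - mval v A.
      by rewrite /q mval_sub// mval_scale// mval_sub.
    have -> : mval u A = h^-1 * (mval (L' d) A - mval (L d) A).
      by rewrite /u mval_scale// mval_sub.
    have -> : mval (L' d) A = mval (L' f') A - mval (L' f0) A by exact: (noisy_sub b0 mT').
    have -> : mval (L d) A = mval (L f') A - mval (L f0) A by exact: (noisy_sub a0 mT).
    move: (h^-1) (mval (L' f') A) (mval (L f') A) (mval (L' f0) A) (mval (L f0) A) (mval v A).
    by clear=> *; ring.
  apply: le_trans (tv_add _ _) _; apply: lerD => //.
  by apply: le_trans (tv_scale _ _) _; rewrite gtr0_norm.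
apply: le_trans zE _; rewrite mulrDl lerD2r.
apply: (@le_trans _ _ (h^-1 * (K1 * h * tv d))).
  by rewrite ler_pM2l//; exact: hK1.
rewrite (_ : h^-1 * _ = K1 * tv d); last by rewrite -[K1 * h * _]mulrA mulrCA mulKf// gt_eqF.
by rewrite -!mulrA ler_wpM2l.
Qed.

End response.

(** * Estimates for the perturbation of the map *)

Section map_perturbation.
Context {R : realType}.
Implicit Types (X Y : signed_measure R) (A B : set (MR R)).

(* The density of rho * X at t is a^-1 (cdf X (t + a/2) - cdf X (t - a/2)). *)
Lemma tv_rconv_cdf (a I : R) X (W : R -> R) : 0 < a ->
  leb.-integrable setT (EFin \o (W : MR R -> R)) -> \int[leb]_t W t <= I ->
  (forall t, `|cdf X t| <= W t) ->
  tv (rconv (uniform_noise a) X) <= a^-1 * (I + I).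
Proof.
move=> a0 iW WI XW; apply: le_trans (tv_push _) _.
have lt s B : measurable B -> leb ((fun x : R => x + s) @^-1` B) = leb B :> \bar R.
  exact: lebesgue_translate.
have iWs s : leb.-integrable setT (EFin \o (fun t : MR R => W ((t : R) + s))).
  exact: (integrable_comp (measurable_translate s) (lt s) measurableT iW).
have IWs s : \int[leb]_t W ((t : R) + s) = \int[leb]_t W t.
  exact: (Rintegral_comp (measurable_translate s) (lt s) measurableT iW).
apply: (@tv_le_Rintegral _ _ _ (fun t => a^-1 * (W (t + a / 2) + W (t + - (a / 2)))) _ (density_uniform_noise X a0)).
- by apply: integrable_fctZ => //; apply: integrable_fctD => //; exact: iWs.
- move=> t; have ai : 0 <= a^-1 by rewrite invr_ge0 ltW.
  rewrite normrM (ger0_norm ai); apply: ler_wpM2l => //.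
  rewrite mval_window_cdf; last by lra.
  by apply: le_trans (ler_normB _ _) _; rewrite opprK; apply: lerD; exact: XW.
- rewrite RintegralZl//; last by apply: integrable_fctD => //; exact: iWs.
  rewrite RintegralD//; try exact: iWs.
  rewrite [X in X + _]IWs [X in _ + X]IWs ler_wpM2l ?invr_ge0 ?(ltW a0)//.
  exact: lerD.
Qed.

Lemma cdf_lt0 X t : on01 X -> t < 0 -> cdf X t = 0.
Proof.
move=> X01 t0; apply: on01_null => //; first exact: measurable_ray.
apply/seteqP; split=> x // []; rewrite /ray /= !in_itv/= => xt /andP[x0 _].
by have := le_lt_trans (le_trans x0 xt) t0; rewrite ltxx.
Qed.

Lemma cdf_ge1 X t : on01 X -> 1 <= t -> cdf X t = mval X setT.
Proof.
move=> /on01P X01 t1; rewrite /cdf -[LHS]X01; last exact: measurable_ray.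
rewrite -[RHS]X01//; congr (mval X _); rewrite setTI; apply/setIidPr => x.
by rewrite /ray /= !in_itv/= => /andP[_ /le_trans]; apply.
Qed.

Lemma cdf_dist_le X (s t d : R) : t - d <= s -> s <= t + d -> 0 <= d ->
  `|cdf X s - cdf X t| <= abs_window X (- d) d t.
Proof.
move=> h1 h2 d0; have sub (p q : R) : p <= q -> t - d <= p -> q <= t + d ->
    `|cdf X q - cdf X p| <= abs_window X (- d) d t.
  move=> pq tp qt; rewrite -mval_itv// mval_jordan; last exact: measurable_itv.
  apply: le_trans (ler_normB _ _) _; rewrite !ger0_norm ?mval_ge0// /abs_window.
  have S : `]p, q]%classic `<=` window (- d) d t.
    move=> x; rewrite /window /= !in_itv/= opprK => /andP[px xq].
    by rewrite (le_lt_trans tp px) (le_trans xq qt).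
  by apply: lerD; apply: mval_le => //; exact: measurable_window.
have [st|ts] := leP s t; first by rewrite distrC; apply: sub => //; lra.
by apply: sub => //; [exact: ltW|lra].
Qed.

Lemma has_density_on_line X (g : R -> R) : has_density X g ->
  (forall x, ~ unit_itv R x -> g x = 0) -> density_on_line X g.
Proof.
move=> gX g0; have [ig _] := gX.
have gE : (g : MR R -> R) \_ (unit_itv R) = g.
  by apply/funext => x; rewrite patchE; case: ifPn => // /negP h; rewrite g0// => Ux;
    apply: h; rewrite inE.
split.
  move/(integrable_mkcond (EFin \o (g : MR R -> R)) measurable_unit_itv) : ig.
  by rewrite restrict_EFin gE.
move=> A mA; rewrite (has_density_rv gX)// setIC Rintegral_mkcondl.
by rewrite gE.
Qed.

(** A mean value estimate: y will be the density at a nearby point and B its local oscillation. *)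
Lemma cdf_increment X (g : R -> R) (p q y B : R) : density_on_line X g -> p <= q ->
  (forall x, p < x -> x <= q -> `|g x - y| <= B) ->
  `|cdf X q - cdf X p - (q - p) * y| <= (q - p) * B.
Proof.
move=> [ig gX] pq hB.
have mI : measurable (`]p, q]%classic : set (MR R)) by exact: measurable_itv.
have igI := integrable_sub mI ig; rewrite -mval_itv// gX//.
have lI : leb (`]p, q]%classic : set (MR R)) = (q - p)%:E :> \bar R.
  rewrite lebesgue_measure_itv/= lte_fin -EFinB; case: ltP => // qp.
  by rewrite (_ : q = p) ?subrr//; apply/eqP; rewrite eq_le qp.
have icst (k : R) : leb.-integrable (`]p, q]%classic : set (MR R)) (EFin \o (fun _ : MR R => k)).
  apply: measurable_bounded_integrable => //.
    by have : (leb (`]p, q]%classic : set (MR R)) < +oo :> \bar R)%E by rewrite lI ltry.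
  exists `|k|; split; first exact: num_real.
  by move=> x kx z _; exact: ltW.
have cst (k : R) : \int[leb]_(x in (`]p, q]%classic : set (MR R))) k = k * (q - p).
  rewrite Rintegral_cst//; congr (_ * _); transitivity (fine ((q - p)%:E : \bar R)) => //.
  by rewrite -lI.
rewrite [(q - p) * y]mulrC -cst -RintegralB//.
apply: le_trans (le_normr_Rintegral _ _) _ => //; first exact: integrable_fctB.
rewrite [(q - p) * B]mulrC -cst; apply: le_Rintegral => //.
- by apply: integrable_norm; exact: integrable_fctB.
- by move=> x /=; rewrite in_itv/= => /andP[px xq]; exact: hB.
Qed.

Lemma bounded_cdf_diff0 (w1 w2 : R -> R) c x : bounded_cdf w1 c -> bounded_cdf w2 c -> ~ unit_itv R x ->
  w1 x - w2 x = 0.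
Proof.
move=> [_ _ a1 b1] [_ _ a2 b2] Ux; have [x0|x0] := ltP x 0; first by rewrite a1// a2// subrr.
have [x1|x1] := leP 1 x; first by rewrite b1// b2// subrr.
by exfalso; apply: Ux; rewrite /= in_itv/= x0 ltW.
Qed.

Lemma rconv_sub b X Y A : 0 < b -> measurable A ->
  mval (rconv (uniform_noise b) (smsub X Y)) A =
  mval (rconv (uniform_noise b) X) A - mval (rconv (uniform_noise b) Y) A.
Proof.
move=> b0 mA; rewrite -mulN1r -(rconv_scale _ _ b0 mA).
exact: (rconv_add _ _ b0 mA).
Qed.

Section perturb.
Variables (S : R -> R) (delta : R).
Hypotheses (lS : 1.-lipschitz_(unit_itv R) S) (S0 : S 0 = 0) (S1 : S 1 = 0)
  (d0 : 0 < delta) (d1 : delta < 1)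
  (Dbij : set_bij (unit_itv R) (unit_itv R) (perturbation delta S)).
Let D := perturbation delta S.

Lemma lipschitz_unit_itv x y : unit_itv R x -> unit_itv R y -> `|S x - S y| <= `|x - y|.
Proof. by move=> Ux Uy; rewrite -[leRHS]mul1r; apply: (lS (x := (x, y))). Qed.

Lemma norm_le1_unit_itv x : unit_itv R x -> `|S x| <= 1.
Proof.
move=> Ux; have U0 : unit_itv R 0 by rewrite /= in_itv/= lexx ler01.
have := lipschitz_unit_itv Ux U0; rewrite S0 !subr0 => /le_trans; apply.
by move: Ux; rewrite /= in_itv/= => /andP[x0 x1]; rewrite ger0_norm.
Qed.

Lemma measurable_perturbation : mfun01 D.
Proof.
apply: measurable_funD; first exact: measurable_id.
by apply: measurable_funM => //; exact: lipschitz_measurable.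
Qed.

Lemma perturbation_unit_itv : set_fun (unit_itv R) (unit_itv R) D.
Proof. by case: Dbij. Qed.

(** As S is 1-Lipschitz, D expands distances by at least the factor 1 - delta > 0 without changing
    the order. *)
Lemma perturbation_reflects_le x y : unit_itv R x -> unit_itv R y -> D x <= D y -> x <= y.
Proof.
move=> Ux Uy; rewrite leNgt => h; rewrite leNgt; apply: contraNN h => yx.
have := lipschitz_unit_itv Uy Ux; rewrite distrC [leRHS]distrC (gtr0_norm (_ : 0 < x - y)) ?subr_gt0//.
rewrite ler_norml /D /perturbation => /andP[h _].
have a1 : 0 <= delta * (S x - S y + (x - y)) by rewrite mulr_ge0 ?(ltW d0)//; lra.
have a2 : 0 < (1 - delta) * (x - y) by rewrite mulr_gt0 ?subr_gt0.
lra.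
Qed.

Lemma perturbation_le x y : unit_itv R x -> unit_itv R y -> x <= y -> D x <= D y.
Proof.
move=> Ux Uy xy; have := lipschitz_unit_itv Uy Ux; rewrite (ger0_norm (_ : 0 <= y - x)) ?subr_ge0//.
rewrite ler_norml /D /perturbation => /andP[h _].
have a1 : 0 <= delta * (S y - S x + (y - x)) by rewrite mulr_ge0 ?(ltW d0)//; lra.
have a2 : 0 <= (1 - delta) * (y - x) by rewrite mulr_ge0 ?subr_ge0// ltW.
lra.
Qed.

(** D is an increasing bijection of [0,1], so the preimage of the ray up to t is the part of [0,1]
    up to the point s with D s = t. *)
Lemma cdf_transfer Y t : unit_itv R t -> on01 Y -> exists s, [/\ unit_itv R s,
  t - s = delta * S s, `|t - s| <= delta & cdf (transfer D Y) t = cdf Y s].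
Proof.
move=> Ut /on01P Y01; have [_ _ Dsurj] := Dbij.
have [s Us Ds] := Dsurj t Ut; exists s.
have ts : t - s = delta * S s by rewrite -Ds /perturbation addrC addKr.
split=> //.
  by rewrite ts normrM gtr0_norm// -[leRHS]mulr1 ler_wpM2l ?(ltW d0)// norm_le1_unit_itv.
rewrite /cdf mval_transfer; last exact: measurable_perturbation.
rewrite -[RHS]Y01; last exact: measurable_ray.
congr (mval Y _); rewrite setIC; apply/seteqP; split=> x.
  move=> [xt Ux]; split=> //; move: xt; rewrite /ray /= !in_itv/= -Ds.
  exact: perturbation_reflects_le.
move=> [xs Ux]; split=> //; move: xs; rewrite /ray /= !in_itv/= -Ds.
exact: perturbation_le.
Qed.

Lemma cdf_transfer_le Y t : on01 Y ->
  `|cdf (smsub (transfer D Y) Y) t| <= abs_window Y (- delta) delta t.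
Proof.
move=> Y01; have D01 := on01_transfer Y measurable_perturbation perturbation_unit_itv.
have aw0 : 0 <= abs_window Y (- delta) delta t by apply: addr_ge0; exact: mval_ge0.
rewrite {1}/cdf mval_sub; last exact: measurable_ray.
rewrite -!/(cdf _ _); have [t0|t0] := ltP t 0; first by rewrite !cdf_lt0// subrr normr0.
have [t1|t1] := leP 1 t.
  by rewrite !cdf_ge1// (mass_transfer measurable_perturbation Y01) subrr normr0.
have Ut : unit_itv R t by rewrite /= in_itv/= t0 ltW.
have [s [Us _ ts ->]] := cdf_transfer Ut Y01.
by move: ts; rewrite ler_norml => /andP[h1 h2]; apply: cdf_dist_le; try lra; exact: ltW.
Qed.

Lemma transfer_comp (T : R -> R) X A : mfun01 T -> set_fun (unit_itv R) (unit_itv R) T ->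
  measurable A -> mval (transfer (D \o T) X) A = mval (transfer D (transfer T X)) A.
Proof.
move=> mT TU mA; have mD := measurable_perturbation.
have mDT : mfun01 (D \o T).
  apply: (measurable_comp measurable_unit_itv _ mD mT).
  by move=> _ [x Ux <-]; exact: TU.
rewrite !mval_transfer//; congr (mval X _); apply/seteqP; split=> x /=.
  by move=> [Ux h]; split=> //; split=> //; exact: TU.
by move=> [Ux [_ h]].
Qed.

Lemma mfun01_comp (T : R -> R) : mfun01 T -> set_fun (unit_itv R) (unit_itv R) T ->
  mfun01 (D \o T).
Proof.
move=> mT TU; apply: (measurable_comp measurable_unit_itv _ measurable_perturbation mT).
by move=> _ [x Ux <-]; exact: TU.
Qed.

Lemma map_difference (a : R) (T : R -> R) X A : 0 < a -> mfun01 T ->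
  set_fun (unit_itv R) (unit_itv R) T -> measurable A ->
  mval (smsub (noisy_transfer a (D \o T) X) (noisy_transfer a T X)) A =
  mval (rconv (uniform_noise a) (smsub (transfer D (transfer T X)) (transfer T X))) A.
Proof.
move=> a0 mT TU mA; rewrite [RHS](rconv_sub _ _ a0 mA) mval_sub//.
congr (_ - _); move: A mA; apply/sm_eqP; apply: rconv_eq => //.
by apply/sm_eqP => A mA; exact: transfer_comp.
Qed.

Lemma tv_map_difference (a : R) (T : R -> R) X : 0 < a -> mfun01 T ->
  set_fun (unit_itv R) (unit_itv R) T -> on01 X ->
  tv (smsub (noisy_transfer a (D \o T) X) (noisy_transfer a T X)) <=
  a^-1 * 4 * delta * tv X.
Proof.
move=> a0 mT TU X01.
rewrite (tv_eq (fun A mA => map_difference X a0 mT TU mA)).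
have dd : - delta <= delta by have := d0; lra.
(* The window has length 2 delta, and the two ends of the noise interval double it: this is the
   constant 4. *)
apply: le_trans (@tv_rconv_cdf a ((delta + delta) * tv X) _
  (abs_window (transfer T X) (- delta) delta) a0 (integrable_abs_window _ dd) _ _) _.
- rewrite Rintegral_abs_window// opprK ler_wpM2l ?tv_transfer//; have := d0; lra.
- by move=> t; apply: cdf_transfer_le; exact: on01_transfer.
- by rewrite le_eqVlt; apply/orP; left; apply/eqP; ring.
Qed.

(** With g the density of mu and D s = t, the difference quotient of the distribution functions is
    (cdf mu s - cdf mu t) / delta, close to - g(t) S(s) because t - s = delta S(s); and [cdf nu t]
    is - g(t) S(t). The error comes from the oscillation of g between s and t and from S(t) -
    S(s). *)
Lemma tv_map_quotient (a c : R) (T w1 w2 : R -> R) (f0 nu : signed_measure R) : 0 < a ->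
  mfun01 T -> set_fun (unit_itv R) (unit_itv R) T -> bounded_cdf w1 c -> bounded_cdf w2 c ->
  has_density (transfer T f0) (fun x => w1 x - w2 x) ->
  on01 nu -> mval nu setT = 0 ->
  (forall t, cdf nu t = - ((w1 t - w2 t) * S (clamp t))) ->
  tv (smsub (smscale delta^-1
      (smsub (noisy_transfer a (D \o T) f0) (noisy_transfer a T f0)))
    (rconv (uniform_noise a) nu)) <= a^-1 * (10 * c) * delta.
Proof.
move=> a0 mT TU h1 h2 gmu nu01 nuT cnu.
set mu := transfer T f0 in gmu *.
have mu01 : on01 mu by exact: on01_transfer.
have gd := has_density_on_line gmu (fun x => bounded_cdf_diff0 h1 h2).
pose m := smsub (smscale delta^-1 (smsub (transfer D mu) mu)) nu.
have -> : tv (smsub (smscale delta^-1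
      (smsub (noisy_transfer a (D \o T) f0) (noisy_transfer a T f0)))
    (rconv (uniform_noise a) nu)) = tv (rconv (uniform_noise a) m).
  apply: tv_eq => A mA; rewrite [RHS](rconv_sub _ _ a0 mA).
  rewrite (rconv_scale _ _ a0 mA) -(map_difference f0 a0 mT TU mA).
  by rewrite mval_sub// mval_scale.
have [k1 k1E k1T] := measure_of_bounded_cdf h1; have [k2 k2E k2T] := measure_of_bounded_cdf h2.
have dd : - delta <= delta by have := d0; lra.
have c0 : 0 <= c by apply: le_trans (bounded_cdf_ge0 0 h1) (bounded_cdf_le 0 h1).
pose om t := mval (charge_of k1) (window (- delta) delta t) + mval (charge_of k2) (window (- delta) delta t).
(* The mass that the Dirac measure at 0 gives to [window 0 1 t] is the indicator of [0,1[ at t;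
   writing it as a window mass lets the same integral formula apply. *)
pose dir : {finite_measure set (MR R) -> \bar R} := dirac (0 : MR R).
have dirE A : mval (charge_of dir) A = \1_A (0 : MR R) by [].
pose W (t : R) : R := om t + c * delta * mval (charge_of dir) (window 0 1 t).
have om0 t : 0 <= om t by apply: addr_ge0; exact: mval_ge0.
have W0 t : 0 <= W t.
  by apply: addr_ge0 => //; rewrite !mulr_ge0 ?(ltW d0)//; exact: mval_ge0.
have iom : leb.-integrable setT (EFin \o (om : MR R -> R)).
  by apply: integrable_fctD => //; exact: integrable_mval_window.
have idir : leb.-integrable setT (EFin \o (fun t : MR R => mval (charge_of dir) (window 0 1 t))).
  exact: integrable_mval_window.
(* The masses of k1 and k2 are c each and the windows have length 2 delta, which gives 4 c delta;
   the bound c delta on [0,1[ gives the fifth. The two ends of the noise interval turn 5 into 10. *)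
apply: le_trans (@tv_rconv_cdf a (5 * c * delta) m W a0 _ _ _) _.
- by apply: integrable_fctD => //; exact: integrable_fctZ.
- rewrite /W RintegralD//; last exact: integrable_fctZ.
  rewrite RintegralZl// Rintegral_window// RintegralD//; try exact: integrable_mval_window.
  rewrite !Rintegral_window// k1T k2T (_ : mval (charge_of dir) setT = 1).
    by rewrite le_eqVlt; apply/orP; left; apply/eqP; ring.
  by rewrite dirE indicE in_setT.
- move=> t; rewrite {1}/cdf mval_sub; last exact: measurable_ray.
  rewrite mval_scale ?mval_sub; try exact: measurable_ray.
  rewrite -!/(cdf _ _).
  have D01 := on01_transfer mu measurable_perturbation perturbation_unit_itv.
  have [t0|t0] := ltP t 0; first by rewrite !cdf_lt0// !subrr mulr0 subr0 normr0.
  have [t1|t1] := leP 1 t.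
    by rewrite !cdf_ge1// (mass_transfer measurable_perturbation mu01) nuT !subrr mulr0 subr0 normr0.
  have Ut : unit_itv R t by rewrite /= in_itv/= t0 ltW.
  have [s [Us ts tsd ->]] := cdf_transfer Ut mu01.
  rewrite cnu clamp_id// opprK.
  have -> : W t = om t + c * delta.
    rewrite /W (_ : mval (charge_of dir) _ = 1) ?mulr1// dirE indicE mem_set//.
    by rewrite /window /= in_itv/= subr0 t0 subr_lt0 t1.
  set g := w1 t - w2 t.
  have gc : `|g| <= c.
    have a1 := bounded_cdf_ge0 t h1; have a2 := bounded_cdf_ge0 t h2.
    have a3 := bounded_cdf_le t h1; have a4 := bounded_cdf_le t h2.
    by rewrite ler_norml /g; apply/andP; split; lra.
  have near_t x : t - delta <= x -> x <= t + delta -> `|w1 x - w2 x - g| <= om t.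
    move=> x1 x2; rewrite (_ : _ - g = (w1 x - w1 t) - (w2 x - w2 t)); last by rewrite /g; lra.
    apply: le_trans (ler_normB _ _) _; rewrite -!k1E -!k2E.
    have aE (k : {finite_measure set (MR R) -> \bar R}) :
        `|cdf (charge_of k) x - cdf (charge_of k) t| <= mval (charge_of k) (window (- delta) delta t).
      have := cdf_dist_le (charge_of k) x1 x2 (ltW d0).
      have nk A : measurable A -> (0 <= charge_of k A)%E by [].
      rewrite /abs_window; have [-> ->] := nonneg_neg0 nk (measurable_window (- delta) delta t).
      by rewrite addr0.
    exact: lerD.
  have [ts1 ts2] : - delta <= t - s /\ t - s <= delta by apply/andP; rewrite -ler_norml.
  have inc : `|cdf mu t - cdf mu s - (t - s) * g| <= `|t - s| * om t.
    have [st|ts'] := leP s t.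
      rewrite (ger0_norm (_ : 0 <= t - s)) ?subr_ge0//.
      apply: (cdf_increment gd) => //.
      by move=> x sx xt; apply: near_t; lra.
    rewrite distrC [`|t - s|]distrC (gtr0_norm (_ : 0 < s - t)) ?subr_gt0//.
    rewrite (_ : _ - _ = cdf mu s - cdf mu t - (s - t) * g); last by lra.
    apply: (cdf_increment gd) => //; first exact: ltW.
    by move=> x tx xs; apply: near_t; lra.
  have SS := lipschitz_unit_itv Ut Us.
  (* Substituting t - s = delta S(s) separates the oscillation of the density, at most om t after
     division by delta, from the variation of S, at most c delta. *)
  have -> : delta^-1 * (cdf mu s - cdf mu t) + g * S t =
     - (delta^-1 * (cdf mu t - cdf mu s - (t - s) * g)) + g * (S t - S s).
    rewrite ts; have dn : delta != 0 by rewrite gt_eqF.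
    by field.
  apply: le_trans (ler_normD _ _) _; rewrite normrN !normrM.
  have di : 0 < delta^-1 by rewrite invr_gt0.
  apply: lerD.
    rewrite (gtr0_norm di); apply: (@le_trans _ _ (delta^-1 * (delta * om t))).
      rewrite ler_pM2l//; apply: le_trans inc _; exact: ler_wpM2r.
    by rewrite mulrA mulVf ?gt_eqF// mul1r.
  by apply: ler_pM => //; apply: le_trans SS _.
- by rewrite le_eqVlt; apply/orP; left; apply/eqP; ring.
Qed.

End perturb.
End map_perturbation.

(** * Estimates for the perturbation of the noise radius *)

Section noise_perturbation.
Context {R : realType}.
Implicit Types (X Y rho : signed_measure R) (A B : set (MR R)).

Lemma smconv_addl rho rho' X A : measurable A ->
  mval (smconv (smadd rho rho') X) A = mval (smconv rho X) A + mval (smconv rho' X) A.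
Proof.
move=> mA; rewrite (smconvE (smadd rho rho'))// (smconvE rho)// (smconvE rho')//.
rewrite -signed_integralD; try exact: bounded_measurable_shift.
congr (signed_integral X _); apply/funext => z; rewrite mval_add//.
exact: (measurable_preimage (measurable_translate z)).
Qed.

Lemma smconv_scalel c rho X A : measurable A ->
  mval (smconv (smscale c rho) X) A = c * mval (smconv rho X) A.
Proof.
move=> mA; rewrite (smconvE (smscale c rho))// (smconvE rho)//.
rewrite -signed_integralZ; last exact: bounded_measurable_shift.
congr (signed_integral X _); apply/funext => z; rewrite mval_scale//.
exact: (measurable_preimage (measurable_translate z)).
Qed.

Lemma smconv_diracl s X A : measurable A ->
  mval (smconv (smdirac s) X) A = mval X ((fun z : R => z + s) @^-1` A).
Proof.
move=> mA; have mB : measurable ((fun z : MR R => (z : R) + s) @^-1` A).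
  exact: (measurable_preimage (measurable_translate s)).
rewrite smconvE// (mval_jordan X mB) /signed_integral.
have E (m : {finite_measure set (MR R) -> \bar R}) :
    \int[m]_z mval (smdirac s) ((fun x : MR R => (x : R) + z) @^-1` A) =
    mval (charge_of m) ((fun z : R => z + s) @^-1` A).
  transitivity (\int[m]_z (\1_((fun z : MR R => (z : R) + s) @^-1` A) z : R)).
    apply: eq_Rintegral => z _.
    transitivity (\1_((fun x : MR R => (x : R) + z) @^-1` A) (s : MR R) : R) => //.
    rewrite !indicE.
    have -> // : (s \in ((fun x : MR R => (x : R) + z) @^-1` A)) =
       (z \in ((fun z : MR R => (z : R) + s) @^-1` A)).
    by apply/idP/idP; rewrite !inE /= addrC.
  by rewrite /Rintegral integral_indic// setIT.
by rewrite !E.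
Qed.

Lemma density_shift X (g : R -> R) s : density_on_line X g ->
  density_on_line (smconv (smdirac s) X) (fun t => g (t + - s)).
Proof.
move=> [ig gX].
have lt u B : measurable B -> leb ((fun x : R => x + u) @^-1` B) = leb B :> \bar R.
  exact: lebesgue_translate.
have ih : leb.-integrable setT (EFin \o (fun t : MR R => g ((t : R) + - s))).
  exact: (integrable_comp (measurable_translate (- s)) (lt (- s)) measurableT ig).
split=> // A mA; rewrite smconv_diracl// gX; last first.
  exact: (measurable_preimage (measurable_translate s)).
rewrite -[RHS](Rintegral_comp (measurable_translate s) (lt s) mA); last first.
  exact: integrable_sub.
by apply: eq_Rintegral => t _; rewrite addrK.
Qed.

Lemma density_on_line_eq X Y (k l : MR R -> R) : (forall A, measurable A -> mval X A = mval Y A) ->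
  (forall t, k t = l t) -> density_on_line X k -> density_on_line Y l.
Proof.
move=> XY kl; have -> : k = l by apply/funext.
by move=> [ik kX]; split=> // A mA; rewrite -XY// kX.
Qed.

(** Convolving a Dirac mass with a measure that has a density shifts the density, so the singular
    part of [noise_dot] still produces a density here. *)
Lemma density_noise_dot a X (g : R -> R) : 0 < a -> density_on_line X g ->
  density_on_line (smconv (noise_dot a) X)
    (fun t => - a ^- 2 * mval X (window (- (a / 2)) (a / 2) t) +
       (a^-1 / 2 * g (t + a / 2) + a^-1 / 2 * g (t - a / 2))).
Proof.
move=> a0 gX.
have d1 := smconv_box X (- a ^- 2) (ltW a0).
have d2 := density_on_lineZ (a^-1 / 2) (density_shift (- (a / 2)) gX).
have d3 := density_on_lineZ (a^-1 / 2) (density_shift (a / 2) gX).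
apply: density_on_line_eq (density_on_lineD d1 (density_on_lineD d2 d3)).
  move=> A mA; rewrite /noise_dot (smconv_addl _ _ _ mA) (smconv_addl _ _ _ mA).
  rewrite (smconv_scalel _ _ _ mA) (smconv_scalel _ _ _ mA).
  by rewrite 2!(mval_add _ _ mA) 2!(mval_scale _ _ mA).
by move=> t; rewrite opprK.
Qed.

Section radius.
Variables (a xi : R).
Hypotheses (a0 : 0 < a) (xi0 : 0 < xi).
Let b := a + xi.

(** Widening the noise adds two strips of width xi / 2 to the window: P on the right of t, Q on the
    left. *)
Let P X t := mval X (window (- (b / 2)) (- (a / 2)) t).
Let Q X t := mval X (window (a / 2) (b / 2) t).

Lemma radius_gt0 : 0 < b.
Proof. exact: addr_gt0. Qed.

Let hP : - (b / 2) <= - (a / 2).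
Proof. by rewrite /b; have := xi0; lra. Qed.

Let hQ : a / 2 <= b / 2.
Proof. by rewrite /b; have := xi0; lra. Qed.

Let ha : - (a / 2) <= a / 2.
Proof. by have := a0; lra. Qed.

Lemma window_split X t : mval X (window (- (b / 2)) (b / 2) t) =
  mval X (window (- (a / 2)) (a / 2) t) + P X t + Q X t.
Proof.
have hb : - (b / 2) <= b / 2 by have := radius_gt0; lra.
rewrite /P /Q !mval_window_cdf//; lra.
Qed.

Lemma tv_noise_difference (T : R -> R) X : mfun01 T ->
  tv (smsub (noisy_transfer b T X) (noisy_transfer a T X)) <= 2 / a * xi * tv X.
Proof.
move=> mT; have b0 := radius_gt0; set Y := transfer T X.
pose Z := smsub (smconv (uniform_noise b) Y) (smconv (uniform_noise a) Y).
apply: (@le_trans _ _ (tv Z)).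
  apply: le_trans (tv_push Z); rewrite le_eqVlt; apply/orP; left; apply/eqP.
  apply: tv_eq => A mA; have mB := measurable_preimage_fold01 mA.
  by rewrite mval_push (mval_sub _ _ mA) (mval_sub _ _ mB).
have dZ := density_on_lineB (density_uniform_noise Y b0) (density_uniform_noise Y a0).
(* On the common window the heights differ by 1/a - 1/b = xi / (a b); on the strips the height is
   1/b. Each of the two contributions integrates to xi / b times the total variation. *)
pose W t := xi / (a * b) * abs_window Y (- (a / 2)) (a / 2) t +
  b^-1 * (abs_window Y (- (b / 2)) (- (a / 2)) t + abs_window Y (a / 2) (b / 2) t).
have c1 : 0 <= xi / (a * b) by rewrite divr_ge0 ?mulr_ge0// ltW.
have c2 : 0 <= b^-1 by rewrite invr_ge0 ltW.
have i1 := integrable_abs_window Y ha; have i2 := integrable_abs_window Y hP; have i3 := integrable_abs_window Y hQ.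
have bn : b != 0 by rewrite gt_eqF.
have an : a != 0 by rewrite gt_eqF.
apply: (tv_le_Rintegral (W := W) dZ).
- by apply: integrable_fctD => //; apply: integrable_fctZ => //; exact: integrable_fctD.
- move=> t; rewrite window_split.
  set ka := mval Y (window (- (a / 2)) (a / 2) t).
  rewrite (_ : _ - _ = - (xi / (a * b) * ka) + b^-1 * (P Y t + Q Y t)); last first.
    by move: (P Y t) (Q Y t) ka bn an; rewrite /b => p q k bn an; field; rewrite bn an.
  apply: le_trans (ler_normD _ _) _; rewrite normrN !normrM (ger0_norm c2).
  rewrite -normrM (ger0_norm c1); apply: lerD; apply: ler_wpM2l => //.
    exact: norm_window_le.
  by apply: le_trans (ler_normD _ _) _; apply: lerD; exact: norm_window_le.
- rewrite /W RintegralD//; [|exact: integrable_fctZ|by apply: integrable_fctZ => //; exact: integrable_fctD].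
  rewrite !RintegralZl//; last exact: integrable_fctD.
  rewrite RintegralD// !Rintegral_abs_window//.
  have tY : tv Y <= tv X by exact: tv_transfer.
  rewrite (_ : _ + _ = 2 * xi / b * tv Y); last first.
    by move: (tv Y) bn an; rewrite /b => p bn an; field; rewrite bn an.
  have c3 : 0 <= 2 * xi by rewrite mulr_ge0// ltW.
  apply: (@le_trans _ _ (2 * xi / b * tv X)).
    by apply: ler_wpM2l => //; rewrite divr_ge0// ltW.
  apply: ler_wpM2r; first exact: tv_ge0.
  rewrite [leRHS]mulrAC; apply: ler_wpM2l => //.
  by rewrite lef_pV2 ?posrE// lerDl ltW.
Qed.

(** The change of height on the common window cancels the box part of [noise_dot] to first order.
    The mass of a strip is xi / 2 times the density at its inner end up to the oscillation of the
    density there, which cancels the Dirac part. *)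
Lemma tv_noise_quotient (c : R) (T w1 w2 : R -> R) (f0 : signed_measure R) :
  mfun01 T -> tv f0 = 1 -> bounded_cdf w1 c -> bounded_cdf w2 c ->
  has_density (transfer T f0) (fun x => w1 x - w2 x) ->
  tv (smsub (smscale xi^-1
      (smsub (noisy_transfer b T f0) (noisy_transfer a T f0)))
    (rconv (noise_dot a) (transfer T f0))) <= (2 / a ^+ 2 + c / a) * xi.
Proof.
move=> mT tf0 h1 h2 gmu; have b0 := radius_gt0.
have gd := has_density_on_line gmu (fun x => bounded_cdf_diff0 h1 h2).
set mu := transfer T f0 in gmu gd *.
have tmu : tv mu <= 1 by rewrite -tf0; exact: tv_transfer.
pose Z := smsub (smscale xi^-1 (smsub (smconv (uniform_noise b) mu)
  (smconv (uniform_noise a) mu))) (smconv (noise_dot a) mu).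
apply: (@le_trans _ _ (tv Z)).
  apply: le_trans (tv_push Z); rewrite le_eqVlt; apply/orP; left; apply/eqP.
  apply: tv_eq => A mA; have mB := measurable_preimage_fold01 mA.
  rewrite mval_push (mval_sub _ _ mA) (mval_sub _ _ mB) (mval_scale _ _ mA) (mval_scale _ _ mB).
  by rewrite (mval_sub _ _ mA) (mval_sub _ _ mB).
have dZ := density_on_lineB (density_on_lineZ xi^-1 (density_on_lineB (density_uniform_noise mu b0) (density_uniform_noise mu a0)))
  (density_noise_dot a0 gd).
have [k1 k1E k1T] := measure_of_bounded_cdf h1; have [k2 k2E k2T] := measure_of_bounded_cdf h2.
pose om u v t := mval (charge_of k1) (window u v t) + mval (charge_of k2) (window u v t).
(* The first term is 1/a^2 - 1/(a b) on the common window, the second replaces 1/b by 1/a on the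
   strips, and the third bounds the oscillation of the density. The integrals of the first two are
   xi / (a b) times [tv mu] each; the third gives c xi / a. *)
pose W t := xi / (a ^+ 2 * b) * abs_window mu (- (a / 2)) (a / 2) t +
  ((a * b)^-1 * (abs_window mu (- (b / 2)) (- (a / 2)) t + abs_window mu (a / 2) (b / 2) t) +
   (2 * a)^-1 * (om (- (b / 2)) (- (a / 2)) t + om (a / 2) (b / 2) t)).
have a2b : 0 < a ^+ 2 * b by rewrite mulr_gt0// exprn_gt0.
have c1 : 0 <= xi / (a ^+ 2 * b) by rewrite divr_ge0 ?(ltW a2b)// ltW.
have c2 : 0 <= (a * b)^-1 by rewrite invr_ge0 mulr_ge0// ltW.
have c3 : 0 <= (2 * a)^-1 by rewrite invr_ge0 mulr_ge0// ltW.
have i1 := integrable_abs_window mu ha; have i2 := integrable_abs_window mu hP; have i3 := integrable_abs_window mu hQ.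
have iom u v : u <= v -> leb.-integrable setT (EFin \o (om u v : MR R -> R)).
  by move=> uv; apply: integrable_fctD => //; exact: integrable_mval_window.
have Iom u v : u <= v -> \int[leb]_t om u v t = (v - u) * (c + c).
  move=> uv; rewrite /om RintegralD//; try exact: integrable_mval_window.
  by rewrite !Rintegral_window// k1T k2T mulrDr.
have bn : b != 0 by rewrite gt_eqF.
have an : a != 0 by rewrite gt_eqF.
have xn : xi != 0 by rewrite gt_eqF.
have osc (p q x y : R) : p <= x -> x <= q -> p <= y -> y <= q ->
    `|(w1 x - w2 x) - (w1 y - w2 y)| <= (w1 q - w1 p) + (w2 q - w2 p).
  move=> px xq py yq; have [n1 _ _ _] := h1; have [n2 _ _ _] := h2.
  have := n1 _ _ px; have := n1 _ _ xq; have := n1 _ _ py; have := n1 _ _ yq.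
  have := n2 _ _ px; have := n2 _ _ xq; have := n2 _ _ py; have := n2 _ _ yq.
  by rewrite ler_norml => *; apply/andP; split; lra.
have omE u v t : u <= v -> om u v t =
    (w1 (t - u) - w1 (t - v)) + (w2 (t - u) - w2 (t - v)).
  by move=> uv; rewrite /om !mval_window_cdf// !k1E !k2E.
apply: (tv_le_Rintegral (W := W) dZ).
- apply: integrable_fctD => //; first exact: integrable_fctZ.
  by apply: integrable_fctD => //; apply: integrable_fctZ => //; apply: integrable_fctD => //; exact: iom.
- move=> t; rewrite window_split.
  set ka := mval mu (window (- (a / 2)) (a / 2) t).
  set g1 := w1 (t + a / 2) - w2 (t + a / 2).
  set g2 := w1 (t - a / 2) - w2 (t - a / 2).
  (* E1 and E2 compare the masses of the strips with their width times the density at the inner ends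
     t + a/2 and t - a/2. *)
  pose E1 := P mu t - xi / 2 * g1; pose E2 := Q mu t - xi / 2 * g2.
  have hE1 : `|E1| <= xi / 2 * om (- (b / 2)) (- (a / 2)) t.
    have := @cdf_increment _ mu _ (t + a / 2) (t + b / 2) g1 (om (- (b / 2)) (- (a / 2)) t) gd.
    rewrite (_ : t + b / 2 - (t + a / 2) = xi / 2); last by rewrite /b; lra.
    rewrite /E1 /P mval_window_cdf// !opprK; apply; first by rewrite lerD2l.
    move=> x px xq; rewrite omE// !opprK; apply: osc => //; first exact: ltW.
    by rewrite lerD2l.
  have hE2 : `|E2| <= xi / 2 * om (a / 2) (b / 2) t.
    have := @cdf_increment _ mu _ (t - b / 2) (t - a / 2) g2 (om (a / 2) (b / 2) t) gd.
    rewrite (_ : t - a / 2 - (t - b / 2) = xi / 2); last by rewrite /b; lra.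
    rewrite /E2 /Q mval_window_cdf//; apply; first by rewrite lerD2l lerN2.
    move=> x px xq; rewrite omE//; apply: osc => //; first exact: ltW.
    by rewrite lerD2l lerN2.
  rewrite (_ : _ - _ = xi / (a ^+ 2 * b) * ka + (- ((a * b)^-1 * (P mu t + Q mu t)) +
      (xi * a)^-1 * (E1 + E2))); last first.
    rewrite /E1 /E2; clear hE1 hE2 E1 E2.
    move: (P mu t) (Q mu t) ka g1 g2 bn an; rewrite /b => p q k g g' bn an.
    by field; rewrite bn an xn.
  apply: le_trans (ler_normD _ _) _; apply: lerD.
    rewrite normrM (ger0_norm c1); apply: ler_wpM2l => //; exact: norm_window_le.
  apply: le_trans (ler_normD _ _) _; apply: lerD.
    rewrite normrN normrM (ger0_norm c2); apply: ler_wpM2l => //.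
    by apply: le_trans (ler_normD _ _) _; apply: lerD; exact: norm_window_le.
  have c4 : 0 <= (xi * a)^-1 by rewrite invr_ge0 mulr_ge0// ltW.
  rewrite normrM (ger0_norm c4).
  apply: (@le_trans _ _ ((xi * a)^-1 * (xi / 2 * om (- (b / 2)) (- (a / 2)) t +
     xi / 2 * om (a / 2) (b / 2) t))).
    by apply: ler_wpM2l => //; apply: le_trans (ler_normD _ _) _; exact: lerD.
  rewrite le_eqVlt; apply/orP; left; apply/eqP.
  by move: (om _ _ t) (om _ _ t) => p q; field; rewrite an xn.
- rewrite /W RintegralD//; [|exact: integrable_fctZ|]; last first.
    by apply: integrable_fctD => //; apply: integrable_fctZ => //; apply: integrable_fctD => //; exact: iom.
  rewrite RintegralD//; [|by apply: integrable_fctZ => //; exact: integrable_fctD|]; last first.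
    by apply: integrable_fctZ => //; apply: integrable_fctD => //; exact: iom.
  rewrite !RintegralZl//; try solve [exact: integrable_fctD | by apply: integrable_fctD => //; exact: iom].
  have -> : \int[leb]_t (abs_window mu (- (b / 2)) (- (a / 2)) t + abs_window mu (a / 2) (b / 2) t) =
      (- (a / 2) - - (b / 2)) * tv mu + (b / 2 - a / 2) * tv mu.
    by rewrite RintegralD// !Rintegral_abs_window.
  have -> : \int[leb]_t (om (- (b / 2)) (- (a / 2)) t + om (a / 2) (b / 2) t) =
      (- (a / 2) - - (b / 2)) * (c + c) + (b / 2 - a / 2) * (c + c).
    by rewrite RintegralD//; [rewrite !Iom|exact: iom|exact: iom].
  rewrite Rintegral_abs_window//.
  rewrite [leLHS](_ : _ = 2 * xi / (a * b) * tv mu + c / a * xi); last first.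
    by move: (tv mu) bn an; rewrite /b => p bn an; field; rewrite bn an.
  rewrite [leRHS]mulrDl lerD2r.
  have c5 : 0 <= 2 * xi / (a * b) by rewrite divr_ge0 ?mulr_ge0// ltW.
  apply: (@le_trans _ _ (2 * xi / (a * b) * 1)); first exact: ler_wpM2l.
  rewrite mulr1 [leRHS]mulrAC; apply: ler_wpM2l; first by rewrite mulr_ge0// ltW.
  rewrite lef_pV2 ?posrE ?mulr_gt0// ?exprn_gt0// expr2; apply: ler_wpM2l; first exact: ltW.
  by rewrite lerDl ltW.
Qed.

End radius.
End noise_perturbation.

(** * Assembly of the two response formulas *)

Section conclusion.
Context {R : realType}.
Implicit Types (X Y : signed_measure R) (A B : set (MR R)).

(** The infimum defining [norm1] is infinite without a density, so the comparison with [tv] needs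
    this for every measure in the L1 statement. *)
Definition abs_cont01 X := exists g : R -> R, has_density X g.

Lemma abs_cont01_eq X Y : sm_eq X Y -> abs_cont01 X -> abs_cont01 Y.
Proof. by move=> XY [g gX]; exists g; exact: has_density_eq gX. Qed.

Lemma abs_cont01_add X Y : abs_cont01 X -> abs_cont01 Y -> abs_cont01 (smadd X Y).
Proof. by move=> [g gX] [h hY]; eexists; exact: has_density_add gX hY. Qed.

Lemma abs_cont01_scale c X : abs_cont01 X -> abs_cont01 (smscale c X).
Proof. by move=> [g gX]; eexists; exact: has_density_scale gX. Qed.

Lemma abs_cont01_sub X Y : abs_cont01 X -> abs_cont01 Y -> abs_cont01 (smsub X Y).
Proof. by move=> aX aY; apply: abs_cont01_add => //; exact: abs_cont01_scale. Qed.

Lemma abs_cont01_sm0 : abs_cont01 (sm0 : signed_measure R).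
Proof.
exists (fun=> 0); split; first exact: integrable0.
by move=> A mA; rewrite integral0.
Qed.

Lemma abs_cont01_rconv b X : 0 < b -> on01 X -> abs_cont01 (rconv (uniform_noise b) X).
Proof. by move=> b0 X01; have [g _ gX] := rconv_density b0 X01; exists g. Qed.

Lemma norm1_le_tv X : abs_cont01 X -> (norm1 X <= (tv X)%:E)%E.
Proof. by move=> [g]; exact: norm1_le. Qed.

Lemma cvg_tail (F : nat -> \bar R) : (forall n, 0 <= F n)%E ->
  (forall eta : R, 0 < eta -> exists M0, forall M, (M0 <= M)%N -> (F M <= eta%:E)%E) ->
  F n @[n --> \oo] --> 0%E.
Proof.
move=> F0 hF; apply/fine_cvgP; split.
  have [M0 h] := hF 1 ltr01; exists M0 => // M /= /h hM.
  by rewrite ge0_fin_numE//; apply: le_lt_trans hM (ltry _).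
apply/cvgrPdist_le => e e0; have [M0 h] := hF e e0.
exists M0 => // M /= /h hM; rewrite sub0r normrN ger0_norm ?fine_ge0//.
rewrite -lee_fin fineK// ge0_fin_numE//; apply: le_lt_trans hM (ltry _).
Qed.

(** The box contributes -1/a and each Dirac mass 1/(2a): the noise has mass 1 at every radius. *)
Lemma mass_noise_dot a X : 0 < a -> mval (smconv (noise_dot a) X) setT = 0.
Proof.
move=> a0; have mT : measurable [set: MR R] by [].
rewrite /noise_dot (smconv_addl _ _ _ mT) (smconv_addl _ _ _ mT).
rewrite (smconv_scalel _ _ _ mT) (smconv_scalel _ _ _ mT).
rewrite mass_box ?(ltW a0)// !smconv_diracl// !preimage_setT.
by move: (mval X setT) => p; field; rewrite gt_eqF.
Qed.

Section system.
Variables (T0 : R -> R) (a : R) (f0 : signed_measure R).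
Hypotheses (T0_01 : set_fun (unit_itv R) (unit_itv R) T0)
  (A1_C2 : piecewise_C2 T0) (A1_BV : transfer_BV_bounded T0) (A2 : covering T0)
  (a_gt0 : 0 < a) (f0_fixed : fixed_probability (noisy_transfer a T0) f0).

Let mT : mfun01 T0. Proof. exact: piecewise_C2_mfun. Qed.
Let L := noisy_transfer a T0.

Lemma transfer_bv : exists w1 w2 c, [/\ bounded_cdf w1 c, bounded_cdf w2 c &
  has_density (transfer T0 f0) (fun x => w1 x - w2 x)].
Proof.
have [_ _ _ _ fL] := fixed_probabilityP f0_fixed.
have [g dg gL] := rconv_density a_gt0 (on01_transfer f0 mT T0_01).
have gf : has_density f0 g by exact: has_density_eq fL gL.
have [C C0 hC] := A1_BV; have f0BV := norm_BV_lty dg gf.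
have : (norm_BV (transfer T0 f0) < +oo)%E.
  apply: le_lt_trans (hC f0 f0BV) _; apply: lte_mul_pinfty => //.
move=> /ereal_inf_lt[_ [h hd <-] hlt].
apply: (bv_bounded_cdf hd); apply: le_lt_trans hlt.
by rewrite leeDr//; apply: integral_ge0 => x _; rewrite lee_fin.
Qed.

Lemma resolvent_bound : exists2 C : R, 0 <= C &
  forall w v, zero_average w -> sm_eq (smsub w (L w)) v -> tv w <= C * tv v.
Proof.
have [E [fE Tcont]] := piecewise_C2_ends A1_C2.
have [N [e [e0 e1 LN]]] := contraction a_gt0 mT T0_01 fE Tcont A2.
exists (N%:R / e); first by rewrite divr_ge0// ltW.
by move=> w v; exact: (tv_resolvent a_gt0 mT e0 LN).
Qed.

Lemma resolvent_tv v : zero_average v -> exists r : signed_measure R,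
  [/\ zero_average r, sm_eq (smsub r (L r)) v,
    (forall eta : R, 0 < eta -> exists M0, forall M, (M0 <= M)%N ->
      tv (smsub (neumann L v M) r) <= eta) &
    forall r', zero_average r' -> sm_eq (smsub r' (L r')) v -> sm_eq r' r].
Proof.
move=> v0; have [E [fE Tcont]] := piecewise_C2_ends A1_C2.
have [N [e [e0 e1 LN]]] := contraction a_gt0 mT T0_01 fE Tcont A2.
have [r [r0 rL hr]] := resolvent_ex a_gt0 mT e0 e1 LN v0.
by exists r; split=> // r' r'0 rL'; exact: (resolvent_unique a_gt0 mT e0 LN r0 r'0 rL rL').
Qed.

Lemma abs_cont01_noisy b T X : 0 < b -> mfun01 T -> set_fun (unit_itv R) (unit_itv R) T ->
  abs_cont01 (noisy_transfer b T X).
Proof. by move=> b0 mT' TU; apply: abs_cont01_rconv => //; exact: on01_transfer. Qed.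

Lemma perturbation_of_map (S : R -> R) (dbar : R) (f : R -> signed_measure R) :
  0 < dbar -> 1.-lipschitz_(unit_itv R) S -> S 0 = 0 -> S 1 = 0 ->
  (forall delta, 0 <= delta < dbar ->
    set_bij (unit_itv R) (unit_itv R) (perturbation delta S)) ->
  (forall delta, 0 <= delta < dbar ->
    fixed_probability (noisy_transfer a (perturbation delta S \o T0)) (f delta)) ->
  exists (g : R -> R) (nu r : signed_measure R),
    [/\ has_density (transfer T0 f0) g,
        is_distr_derivative (fun x => - (g x * S x)) nu,
        is_resolvent (noisy_transfer a T0) norm1 (rconv (uniform_noise a) nu) r
      & norm1 (smsub (smscale delta^-1 (smsub (f delta) f0)) r)
          @[delta --> 0^'+] --> 0%E].
Proof.
move=> dbar0 lS S0 S1 Dbij ffix.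
have [w1 [w2 [c [h1 h2 gmu]]]] := transfer_bv.
have [nu [cnu nuT nu01 nuD]] := product_derivative h1 h2 lS S0 S1.
pose v := rconv (uniform_noise a) nu.
have v0 : zero_average v.
  by apply/zero_averageP; split; [exact: on01_rconv|rewrite mass_rconv].
have [r [r0 rL hr ru]] := resolvent_tv v0.
have av : abs_cont01 v by exact: abs_cont01_rconv.
(* The equation r = v + L r makes r absolutely continuous, because the noise gives a density to
   every measure in the image of [L]. *)
have ar : abs_cont01 r.
  apply: (@abs_cont01_eq (smadd v (L r))).
    apply/sm_eqP => A mA; rewrite (mval_add _ _ mA).
    by move/sm_eqP : rL => /(_ A mA) <-; rewrite (mval_sub _ _ mA) subrK.
  by apply: abs_cont01_add => //; exact: abs_cont01_noisy.
have an M : abs_cont01 (neumann L v M).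
  rewrite /neumann; apply: big_ind; first exact: abs_cont01_sm0.
    exact: abs_cont01_add.
  by case=> -[|n] _ _ //=; exact: abs_cont01_noisy.
have af0 : abs_cont01 f0.
  have [_ _ _ _ fL] := fixed_probabilityP f0_fixed.
  by apply: abs_cont01_eq fL _; exact: abs_cont01_noisy.
exists (fun x => w1 x - w2 x), nu, r; split=> //.
  split=> //; apply: cvg_tail => [M|eta eta0]; first exact: norm1_ge0.
  have [M0 h] := hr eta eta0; exists M0 => M /h hM.
  apply: le_trans (norm1_le_tv _) _; first exact: abs_cont01_sub.
  by rewrite lee_fin.
have [C C0 hC] := resolvent_bound.
(* Here K1 = 4 / a and K2 = 10 c / a. The restriction to delta < 1 makes D increasing. *)
apply: (@cvg_linear_bound _ _ (C * (a^-1 * 4 * (C * (a^-1 * 4)) + a^-1 * (10 * c)))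
  (Num.min dbar 1)); first by rewrite lt_min dbar0 ltr01.
move=> d d0; rewrite lt_min => /andP[ddbar d1].
have hd : 0 <= d < dbar by rewrite ltW.
have mD := mfun01_comp d lS mT T0_01.
apply/andP; split; first exact: norm1_ge0.
have DU : set_fun (unit_itv R) (unit_itv R) (perturbation d S \o T0).
  by move=> x Ux; apply: (perturbation_unit_itv (Dbij d hd)); exact: T0_01.
apply: le_trans (norm1_le_tv _) _.
  apply: abs_cont01_sub => //; apply: abs_cont01_scale; apply: abs_cont01_sub => //.
  have [_ _ _ _ fL] := fixed_probabilityP (ffix d hd).
  by apply: abs_cont01_eq fL _; exact: abs_cont01_noisy.
rewrite lee_fin; apply: (@linear_response _ a a C _ _ d T0 (perturbation d S \o T0) f0 (f d) r v) => //.
- by rewrite mulr_ge0 ?invr_ge0// ltW.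
- exact: ffix.
- by move=> X X01; exact: (tv_map_difference lS S0 d0 d1 (Dbij d hd) a_gt0 mT T0_01 X01).
- exact: (tv_map_quotient lS S0 d0 d1 (Dbij d hd) a_gt0 mT T0_01 h1 h2 gmu nu01 nuT cnu).
Qed.

Lemma perturbation_of_noise (f : R -> signed_measure R) :
  (forall xi, 0 <= xi -> fixed_probability (noisy_transfer (a + xi) T0) (f xi)) ->
  exists r : signed_measure R,
    is_resolvent (noisy_transfer a T0) norm_W
      (rconv (noise_dot a) (transfer T0 f0)) r /\
    norm_W (smsub (smscale xi^-1 (smsub (f xi) f0)) r)
      @[xi --> 0^'+] --> 0%E.
Proof.
move=> ffix; have [w1 [w2 [c [h1 h2 gmu]]]] := transfer_bv.
pose v := rconv (noise_dot a) (transfer T0 f0).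
have v0 : zero_average v.
  apply/zero_averageP; split; first exact: on01_rconv.
  by rewrite /v /rconv mval_push preimage_setT mass_noise_dot.
have [r [r0 rL hr ru]] := resolvent_tv v0.
exists r; split.
  split=> //; apply: cvg_tail => [M|eta eta0]; first exact: norm_W_ge0.
  have [M0 h] := hr eta eta0; exists M0 => M /h hM.
  by apply: le_trans (norm_W_le _) _; rewrite lee_fin.
have [C C0 hC] := resolvent_bound.
apply: (@cvg_linear_bound _ _ (C * (2 / a * (C * (2 / a)) + (2 / a ^+ 2 + c / a))) 1) => //.
move=> x x0 _; apply/andP; split; first exact: norm_W_ge0.
apply: le_trans (norm_W_le _) _; rewrite lee_fin.
have [_ _ _ tf0 _] := fixed_probabilityP f0_fixed.
apply: (@linear_response _ a (a + x) C _ _ x T0 T0 f0 (f x) r v) => //.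
- exact: addr_gt0.
- by rewrite divr_ge0// ltW.
- by apply: ffix; exact: ltW.
- by move=> X X01; exact: tv_noise_difference.
- exact: (tv_noise_quotient a_gt0 x0 mT tf0 h1 h2 gmu).
Qed.

End system.
End conclusion.

Theorem corollary43 (R : realType) (T0 : R -> R) (a : R) (f0 : signed_measure R)
    (T0_01 : set_fun (unit_itv R) (unit_itv R) T0)
    (A1_nonsingular : nonsingular T0)
    (A1_C2 : piecewise_C2 T0)
    (A1_BV : transfer_BV_bounded T0)
    (A2 : covering T0)
    (a_gt0 : 0 < a)
    (f0_fixed : fixed_probability (noisy_transfer a T0) f0) :
  (forall (S : R -> R) (dbar : R) (f : R -> signed_measure R),
      0 < dbar ->
      1.-lipschitz_(unit_itv R) S -> S 0 = 0 -> S 1 = 0 ->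
      finite_union_of_intervals (support01 S) ->
      (forall delta, 0 <= delta < dbar ->
        set_bij (unit_itv R) (unit_itv R) (perturbation delta S) /\
        {within unit_itv R, continuous (perturbation delta S)}) ->
      (forall delta, 0 <= delta < dbar ->
        fixed_probability (noisy_transfer a (perturbation delta S \o T0)) (f delta)) ->
      exists (g : R -> R) (nu r : signed_measure R),
        [/\ has_density (transfer T0 f0) g,
            is_distr_derivative (fun x => - (g x * S x)) nu,
            is_resolvent (noisy_transfer a T0) norm1 (rconv (uniform_noise a) nu) r
          & norm1 (smsub (smscale delta^-1 (smsub (f delta) f0)) r)
              @[delta --> 0^'+] --> 0%E])
  /\
  ([lipschitz T0 x | x in unit_itv R] ->
    forall f : R -> signed_measure R,
      (forall xi, 0 <= xi -> fixed_probability (noisy_transfer (a + xi) T0) (f xi)) ->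
      exists r : signed_measure R,
        is_resolvent (noisy_transfer a T0) norm_W
          (rconv (noise_dot a) (transfer T0 f0)) r /\
        norm_W (smsub (smscale xi^-1 (smsub (f xi) f0)) r)
          @[xi --> 0^'+] --> 0%E).
Proof.
split=> [S dbar f dbar0 lS S0 S1 _ Dbij ffix|_ f ffix].
  apply: (@perturbation_of_map R T0 a f0 T0_01 A1_C2 A1_BV A2 a_gt0 f0_fixed S dbar f) => //.
  by move=> delta hdelta; have [] := Dbij delta hdelta.
exact: perturbation_of_noise.
Qed.
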